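(* If $A=\{x,\;x-1,\;x^2-3x+1,\;x^3-5x^2+6x-1\}$, then $$|\lambda_A-1.798249|\le 10^{-6}.$$
   Context: $\mathbb{R}^+=[0,\infty)$, and $I(\mu)=\iint\log|x_1-x_2|\,d\mu(x_1)\,d\mu(x_2)$ is the logarithmic energy. For a finite set $A\subset\mathbb{Z}[x]$ of nonzero polynomials with only real roots, $\lambda_A=\inf_\mu\int x\,d\mu(x)$, where $\mu$ ranges over the Borel probability measures supported on $\mathbb{R}^+$ with $I(\mu)\ge 0$ and $\int\log|Q(x)|\,d\mu(x)\ge0$ for every $Q\in A$. *)

(* Defs.v *)
From HB Require Import structures.
From mathcomp Require Import all_boot all_order all_algebra finmap.
From mathcomp Require Import all_classical all_reals all_analysis.
Import numFieldNormedType.Exports.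

Set Implicit Arguments.
Unset Strict Implicit.
Unset Printing Implicit Defensive.

Import Order.TTheory GRing.Theory Num.Theory.

Local Open Scope classical_set_scope.
Local Open Scope ring_scope.

(* Logarithms are taken with the extended logarithm lne, for which
   lne 0 = -oo; the real-valued ln would give ln 0 = 0 and so drop the
   contribution of the diagonal and of the roots of Q.  A Lebesgue integral
   whose positive and negative parts are both infinite evaluates to -oo, so a
   constraint 0 <= \int ... also excludes integrals that are not defined. *)

Definition log_energy (R : realType)
    (mu : probability (measurableTypeR R) R) : \bar R :=
  (\int[mu \x mu]_z lne `|z.1 - z.2|%:E)%E.

Definition log_integral (R : realType)
    (mu : probability (measurableTypeR R) R) (Q : {poly int}) : \bar R :=
  (\int[mu]_x lne `|(map_poly intr Q).[x]|%:E)%E.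

Definition admissible (R : realType) (A : {fset {poly int}})
    (mu : probability (measurableTypeR R) R) : Prop :=
  [/\ mu (~` `[0, +oo[) = 0%E,
      (0 <= log_energy mu)%E &
      forall Q, Q \in A -> (0 <= log_integral mu Q)%E].

Definition lambda (R : realType) (A : {fset {poly int}}) : \bar R :=
  ereal_inf [set (\int[mu]_x x%:E)%E | mu in @admissible R A].

(* Main.v *)
Require Import Defs.
From HB Require Import structures.
From mathcomp Require Import all_boot all_order all_algebra finmap.
From mathcomp Require Import all_classical all_reals all_analysis.
From mathcomp Require Import measurable_realfun ring lra.
Import numFieldNormedType.Exports.
Set Implicit Arguments.
Unset Strict Implicit.
Unset Printing Implicit Defensive.
Import Order.TTheory GRing.Theory Num.Theory.
Local Open Scope classical_set_scope.
Local Open Scope ring_scope.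

(* Fix an explicit probability measure
   nu, carried by seven disjoint arcs of [0, 6] and given, after x = m + l cos t
   on each arc, by squared moduli of trigonometric polynomials in t. Write U for
   the logarithmic potential of nu. If, for all x >= 0,
     x >= c + Lam U(x) + sum_Q lam_Q log |Q(x)|   with Lam > 0, lam_Q >= 0,
   then every admissible mu has mean at least c: positive definiteness of
   -log |x - y| on differences of probability measures gives
   2 \int U dmu >= I(mu) + I(nu), and I(nu) >= 0. Conversely nu itself is
   admissible, so its mean bounds lambda_A from above. Near its arc the potential
   is an explicit trigonometric sum, away from it a rapidly convergent series, and
   the finitely many inequalities left are checked with balls of radius 2^-44
   over the integers. *)

(** The energy of nu is never integrated numerically. The reverse inequality x <= gam + Lam U(x) +
    sum_Q lam_Q log |Q(x)|, required only on the arcs, is integrated against nu; once the mean of nu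
    is large enough, I(nu) >= 0 follows. So two bounds on the field x - Lam U - sum_Q lam_Q log |Q|
    and the values of U at the roots decide everything. The whole slack is 2 / 10^6, so the field
    must be flat on the arcs to that order. Flatness is read from cosine coefficients in t: the
    arc's own potential is a finite sum, the other arcs are replaced by point charges, and a point
    charge off the arc, like a root of Q, has a geometrically decaying cosine series. These
    coefficients nearly cancel, and the sum of their absolute values bounds the oscillation. Off the
    arcs the field is convex between an arc and the next root, so two values beyond each edge
    control the whole gap. The logarithm is unbounded both ways, so integrals are taken of C - log,
    kept nonnegative for Tonelli. The constraints 0 <= integral then force integrability, and a
    measure with infinite mean needs no argument. *)

Section log_series.
Variable R : realType.
Implicit Types (a r s : R) (N : nat).

Lemma cosD_cosB (x y : R) : cos (x + y) + cos (x - y) = 2 * cos x * cos y.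
Proof. by rewrite cosD cosB; ring. Qed.

Lemma poisson_denom_ge a r : (1 - `|r|) ^+ 2 <= 1 - 2 * r * cos a + r ^+ 2.
Proof.
have h : r * cos a <= `|r|.
  rewrite (le_trans (ler_norm _))// normrM ler_piMr//.
  by rewrite ler_norml cos_geN1 cos_le1.
have : `|r| ^+ 2 = r ^+ 2 by rewrite real_normK// num_real.
by rewrite sqrrB; lra.
Qed.

Lemma poisson_denom_gt0 a r : `|r| < 1 -> 0 < 1 - 2 * r * cos a + r ^+ 2.
Proof.
move=> r1; apply: lt_le_trans (poisson_denom_ge a r).
by rewrite exprn_gt0// subr_gt0.
Qed.

(** The recurrence cos ((n+2) a) + cos (n a) = 2 cos ((n+1) a) cos a cancels all interior terms.
    What survives is 2 cos a - 2 s, minus the derivative in s of the denominator, and boundary terms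
    of order s^N, which become the remainder of the logarithmic series. *)
Lemma poisson_telescope a s N :
  (1 - 2 * s * cos a + s ^+ 2) * \sum_(n < N) 2 * s ^+ n * cos (n.+1%:R * a) =
  2 * cos a - 2 * s - 2 * s ^+ N * (cos (N.+1%:R * a) - s * cos (N%:R * a)).
Proof.
elim: N => [|N IH].
  rewrite big_ord0 mulr0 (_ : 0%:R * a = 0) ?cos0 ?mul0r// mul1r expr0 !mulr1.
  by rewrite mulrBr subrr.
rewrite big_ord_recr/= mulrDr IH.
have := cosD_cosB (N.+1%:R * a) a.
have -> : N.+1%:R * a + a = N.+2%:R * a by rewrite -(natr1 N.+1); ring.
have -> : N.+1%:R * a - a = N%:R * a by rewrite -(natr1 N); ring.
rewrite (exprS s N) => H.
have -> : cos (N.+2%:R * a) = 2 * cos (N.+1%:R * a) * cos a - cos (N%:R * a).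
  by rewrite -H addrK.
ring.
Qed.

(** Truncation of ln (1 - 2 r cos a + r^2) = - sum 2 r^n cos (n a) / n. The left side vanishes at r
    = 0 and its derivative in r is the boundary term of [poisson_telescope] over the denominator, so
    the mean value theorem bounds it. The bound is uniform in a; all later tail estimates rest on
    it. *)
Lemma ln_poisson_series a r N : `|r| < 1 ->
  `| ln (1 - 2 * r * cos a + r ^+ 2) +
     \sum_(n < N) 2 * r ^+ n.+1 * cos (n.+1%:R * a) / n.+1%:R |
  <= 4 * `|r| ^+ N.+1 / (1 - `|r|) ^+ 2.
Proof.
move=> r1.
pose f (s : R) := ln (1 - 2 * s * cos a + s ^+ 2) +
     \sum_(n < N) 2 * s ^+ n.+1 * cos (n.+1%:R * a) / n.+1%:R.
pose f' (s : R) := (1 - 2 * s * cos a + s ^+ 2)^-1 * (2 * s - 2 * cos a) +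
     \sum_(n < N) 2 * s ^+ n * cos (n.+1%:R * a).
have D s : `|s| < 1 -> is_derive s 1 f (f' s).
  move=> s1; apply: is_deriveD.
    have dD : is_derive s 1 (fun s => 1 - 2 * s * cos a + s ^+ 2)
        (2 * s - 2 * cos a).
      have -> : (fun s => 1 - 2 * s * cos a + s ^+ 2) =
          (cst 1 - (2 * cos a) \*: (@id R) + (@id R) ^+ 2).
        apply/funext => t /=; rewrite !fctE /=.
        by rewrite /GRing.scale/=; ring.
      apply: is_derive_eq; rewrite /GRing.scale/=; ring.
    have dl := @is_derive1_ln R _ (poisson_denom_gt0 a s1).
    have := @is_derive1_comp R (@ln R) (fun s => 1 - 2 * s * cos a + s ^+ 2) s _ _ dl dD.
    by [].
  have -> : (fun s => \sum_(n < N) 2 * s ^+ n.+1 * cos (n.+1%:R * a) / n.+1%:R) =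
     \sum_(n < N) ((2 * cos (n.+1%:R * a) / n.+1%:R) \*: ((@id R) ^+ n.+1)).
    apply/funext => t; rewrite fct_sumE; apply: eq_bigr => n _.
    rewrite !fctE -[RHS]/(2 * cos (n.+1%:R * a) / n.+1%:R * t ^+ n.+1).
    by move: (t ^+ n.+1) (cos _) (n.+1%:R^-1) => u v w; ring.
  apply: is_derive_eq.
  apply: eq_bigr => n _; rewrite /GRing.scale/= -mulr_natr.
  have n0 : n.+1%:R != 0 :> R by rewrite pnatr_eq0.
  by field.
have f0 : f 0 = 0.
  rewrite /f mulr0 mul0r expr0n subr0 addr0 ln1 add0r big1// => n _.
  by rewrite exprS mul0r mulr0 !mul0r.
have bnd s : `|s| <= `|r| -> `|f' s| <= 4 * `|r| ^+ N / (1 - `|r|) ^+ 2.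
  move=> sr; have s1 := le_lt_trans sr r1.
  have D0 := poisson_denom_gt0 a s1.
  have -> : f' s = (1 - 2 * s * cos a + s ^+ 2)^-1 *
     (2 * s ^+ N * (s * cos (N%:R * a) - cos (N.+1%:R * a))).
    apply: (mulfI (lt0r_neq0 D0)); rewrite /f' mulrDr poisson_telescope.
    by rewrite !mulrA mulfV ?lt0r_neq0//; ring.
  rewrite normrM [leLHS]mulrC normfV (gtr0_norm D0).
  apply: ler_pM => //.
  - by rewrite invr_ge0 ltW.
  - rewrite !normrM normr_nat normrX -mulrA.
    have -> : 4 * `|r| ^+ N = 2 * (`|r| ^+ N * 2) by ring.
    rewrite ler_pM2l//; apply: ler_pM => //.
      by apply: lerXn2r; rewrite ?nnegrE.
    rewrite (le_trans (ler_normB _ _))// (_ : 2 = 1 + 1)//; apply: lerD.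
      rewrite normrM mulr_ile1//; first exact: ltW.
      by rewrite ler_norml cos_geN1 cos_le1.
    by rewrite ler_norml cos_geN1 cos_le1.
  - rewrite lef_pV2 ?posrE//; last by rewrite exprn_gt0// subr_gt0.
    apply: le_trans (poisson_denom_ge a s).
    by apply: lerXn2r; rewrite ?nnegrE ?subr_ge0 ?lerB// ltW.
(* An ordered pair inside [-|r|, |r|] covers both [0, r] and [r, 0]. *)
have M (u v : R) : u < v -> `|u| <= `|r| -> `|v| <= `|r| ->
    `|f v - f u| <= 4 * `|r| ^+ N / (1 - `|r|) ^+ 2 * (v - u).
  move=> uv ur vr.
  have lr s : u <= s <= v -> `|s| <= `|r|.
    move=> /andP[us sv]; rewrite ler_norml; apply/andP; split.
      by rewrite (le_trans _ us)//; move: ur; rewrite ler_norml => /andP[].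
    by rewrite (le_trans sv)//; move: vr; rewrite ler_norml => /andP[].
  have [||c c01 ->] := @MVT _ f f' u v uv.
  - move=> x; rewrite in_itv/= => /andP[ux xv]; apply: D.
    by apply: le_lt_trans r1; apply: lr; rewrite !ltW.
  - apply: derivable_within_continuous => x; rewrite in_itv/= => uxv.
    by have [] := D x (le_lt_trans (lr _ uxv) r1).
  rewrite normrM (gtr0_norm (x := v - u)) ?subr_gt0//.
  rewrite ler_pM2r ?subr_gt0//; apply: bnd; apply: lr.
  by move: c01; rewrite in_itv/= => /andP[? ?]; rewrite !ltW.
rewrite -[X in `|X|]/(f r) exprS.
have -> : 4 * (`|r| * `|r| ^+ N) / (1 - `|r|) ^+ 2 = 4 * `|r| ^+ N / (1 - `|r|) ^+ 2 * `|r| by ring.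
case: (ltrgt0P r) => [r0|r0|->].
- by have := M 0 r r0; rewrite f0 !subr0 normr0 (gtr0_norm r0); apply => //; exact: ltW.
- have := M r 0 r0; rewrite f0 sub0r sub0r normrN normr0 (ltr0_norm r0).
  by apply => //; rewrite oppr_ge0 ltW.
- by rewrite f0 normr0 mulr0.
Qed.

End log_series.

(** * Integrals over [0, pi] against squared moduli of trigonometric polynomials *)

Section trig_integrals.
Variable R : realType.
Implicit Types (f g : R -> R) (P : seq R).
Local Notation mu := (@lebesgue_measure R).
Local Notation I0pi := (`[0, pi : R]%classic : set R).

Definition Ipi f : R := \int[mu]_(t in I0pi) f t.

Lemma integrable_0pi f : continuous f ->
  mu.-integrable I0pi (EFin \o f).
Proof.
move=> cf; apply: continuous_compact_integrable; first exact: segment_compact.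
exact: continuous_subspaceT.
Qed.

Lemma IpiE f : continuous f ->
  (Ipi f)%:E = (\int[mu]_(t in I0pi) (f t)%:E)%E.
Proof.
move=> cf; rewrite /Ipi /Rintegral fineK//.
exact: integrable_fin_num (integrable_0pi cf).
Qed.

Lemma IpiD f g : continuous f -> continuous g ->
  Ipi (fun t => f t + g t) = Ipi f + Ipi g.
Proof. by move=> cf cg; apply: RintegralD => //; exact: integrable_0pi. Qed.

Lemma IpiZ k f : continuous f -> Ipi (fun t => k * f t) = k * Ipi f.
Proof. by move=> cf; apply: RintegralZl => //; exact: integrable_0pi. Qed.

Lemma eq_Ipi f g : f =1 g -> Ipi f = Ipi g.
Proof. by move=> fg; congr Ipi; apply/funext. Qed.

Lemma Ipi_cst k : Ipi (fun=> k) = k * pi.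
Proof.
rewrite /Ipi Rintegral_cst//= lebesgue_measure_itv/= lte_fin pi_gt0/=.
by rewrite subr0.
Qed.

Lemma continuous_sumr (I : Type) (s : seq I) (F : I -> R -> R) :
  (forall i, continuous (F i)) -> continuous (fun t => \sum_(i <- s) F i t).
Proof.
move=> cF; elim: s => [|i s IH].
  rewrite (_ : (fun t => _) = fun=> 0); first by move=> t; exact: cvg_cst.
  by apply/funext => t; rewrite big_nil.
rewrite (_ : (fun t => _) = fun t => F i t + \sum_(j <- s) F j t).
  by move=> t; apply: cvgD; [exact: cF|exact: IH].
by apply/funext => t; rewrite big_cons.
Qed.

Lemma Ipi_sum (I : Type) (s : seq I) (F : I -> R -> R) :
  (forall i, continuous (F i)) ->
  Ipi (fun t => \sum_(i <- s) F i t) = \sum_(i <- s) Ipi (F i).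
Proof.
move=> cF; elim: s => [|i s IH].
  rewrite big_nil (@eq_Ipi _ (fun=> 0)) ?Ipi_cst ?mul0r// => t.
  by rewrite big_nil.
rewrite big_cons -IH -IpiD//; last exact: continuous_sumr.
by apply: eq_Ipi => t; rewrite big_cons.
Qed.

Lemma le_Ipi f g : continuous f -> continuous g ->
  (forall t, 0 <= t <= pi -> f t <= g t) -> Ipi f <= Ipi g.
Proof.
by move=> cf cg fg; apply: le_Rintegral => //; exact: integrable_0pi.
Qed.

Lemma continuous_mulr f g : continuous f -> continuous g ->
  continuous (fun t => f t * g t).
Proof. by move=> cf cg t; apply: cvgM; [exact: cf|exact: cg]. Qed.

Lemma continuous_addr f g : continuous f -> continuous g ->
  continuous (fun t => f t + g t).
Proof. by move=> cf cg t; apply: cvgD; [exact: cf|exact: cg]. Qed.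

Lemma continuous_cstr (k : R) : continuous (fun _ : R => k).
Proof. by move=> t; exact: cvg_cst. Qed.

Lemma continuous_cosM k : continuous (fun t : R => cos (k * t)).
Proof.
move=> t; apply: continuous_comp; last exact: continuous_cos.
exact: mulrl_continuous.
Qed.

Lemma continuous_sinM k : continuous (fun t : R => sin (k * t)).
Proof.
move=> t; apply: continuous_comp; last exact: continuous_sin.
exact: mulrl_continuous.
Qed.

Lemma sin_natpi n : sin (n%:R * pi) = 0 :> R.
Proof.
elim: n => [|n IH]; first by rewrite mul0r sin0.
by rewrite -natr1 mulrDl mul1r sinDpi IH oppr0.
Qed.

Lemma Ipi_cosB (a b : nat) :
  Ipi (fun t => cos ((a%:R - b%:R) * t)) = pi * (a == b)%:R.
Proof.
have [->|ab] := eqVneq a b.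
  under eq_Ipi do rewrite subrr mul0r cos0.
  by rewrite Ipi_cst mul1r mulr1.
have k0 : a%:R - b%:R != 0 :> R by rewrite subr_eq0 eqr_nat.
rewrite mulr0 /Ipi /Rintegral.
set k := (a%:R - b%:R : R) in k0 *.
pose F (t : R) := sin (k * t) / k.
have dF (t : R) : is_derive t 1 F (cos (k * t)).
  have dk : is_derive t 1 (fun t : R => k * t) k.
    have -> : (fun t : R => k * t) = k \*: (@id R) by [].
    by apply: is_derive_eq; rewrite /GRing.scale/= mulr1.
  have d1 := @is_derive1_comp R (@sin R) (fun t : R => k * t) t _ _
    (is_derive_sin _) dk.
  have -> : F = k^-1 \*: (@sin R \o (fun t => k * t)).
    by apply/funext => u; rewrite /F /= mulrC.
  apply: is_derive_eq; rewrite /GRing.scale/=.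
  by rewrite mulrCA mulVf// mulr1.
have cF : continuous F.
  by move=> t; apply: cvgMl; exact: continuous_sinM.
rewrite (@continuous_FTC2 R (fun t => cos (k * t)) F 0 pi (pi_gt0 R)).
- rewrite /F mulr0 sin0 mul0r sube0/= /k mulrBl sinB !sin_natpi.
  by rewrite !mul0r mulr0 subrr mul0r.
- exact/continuous_subspaceT/continuous_cosM.
- split.
  + by move=> t _; have [] := dF t.
  + exact/cvg_at_right_filter/cF.
  + exact/cvg_at_left_filter/cF.
- by move=> t _; rewrite derive1E; exact: derive_val.
Qed.

(* The square of the modulus of a trigonometric polynomial with real
   coefficients is an even nonnegative trigonometric polynomial whose Fourier
   coefficients are the autocorrelations of [P]. *)
Definition tpsq P (t : R) : R :=
  (\sum_(j < size P) P`_j * cos (j%:R * t)) ^+ 2 +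
  (\sum_(j < size P) P`_j * sin (j%:R * t)) ^+ 2.

Definition autocorr P (n : nat) : R := \sum_(j < size P) P`_j * P`_(j + n).

Lemma tpsq_ge0 P t : 0 <= tpsq P t.
Proof. by rewrite addr_ge0// sqr_ge0. Qed.

Lemma tpsqE P t : tpsq P t =
  \sum_(j < size P) \sum_(k < size P) P`_j * P`_k * cos ((j%:R - k%:R) * t).
Proof.
rewrite /tpsq !expr2 !big_distrlr/= -big_split/=; apply: eq_bigr => j _.
rewrite -big_split/=; apply: eq_bigr => k _.
by rewrite mulrBl cosB; ring.
Qed.

Lemma continuous_tpsq P : continuous (tpsq P).
Proof.
rewrite (funext (tpsqE P)).
apply: continuous_sumr => j; apply: continuous_sumr => k.
by apply: continuous_mulr; [exact: continuous_cstr|exact: continuous_cosM].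
Qed.

Lemma sum_autocorr P n :
  \sum_(j < size P) \sum_(k < size P) P`_j * P`_k * ((j + n)%N == k)%:R =
  autocorr P n.
Proof.
apply: eq_bigr => j _.
have [jn|jn] := ltnP (j + n) (size P).
  rewrite (bigD1 (Ordinal jn))//= eqxx mulr1 big1 ?addr0// => k kj.
  by rewrite (_ : (_ == _) = false) ?mulr0//; apply: contraNF kj => /eqP E; apply/eqP/val_inj/esym.
rewrite (nth_default _ jn) mulr0 big1// => k _.
rewrite (_ : (_ == _) = false) ?mulr0//; apply/negbTE.
by rewrite neq_ltn (leq_trans (ltn_ord k) jn) orbT.
Qed.

(** The product formula leaves only cosines of integer frequency, and on [0, pi] only frequency 0
    has a nonzero integral. Hence the cosine moments of the density are its autocorrelations, and
    everything about an arc is a finite expression in them. *)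
Lemma Ipi_tpsq_cos P n :
  Ipi (fun t => tpsq P t * cos (n%:R * t)) = pi * autocorr P n.
Proof.
have E t : tpsq P t * cos (n%:R * t) =
    \sum_(j < size P) \sum_(k < size P)
      (P`_j * P`_k / 2 * cos (((j + n)%:R - k%:R) * t) +
       P`_k * P`_j / 2 * cos ((j%:R - (k + n)%:R) * t)).
  rewrite tpsqE mulr_suml; apply: eq_bigr => j _.
  rewrite mulr_suml; apply: eq_bigr => k _.
  have := cosD_cosB ((j%:R - k%:R) * t) (n%:R * t).
  rewrite !natrD.
  have -> : (j%:R - k%:R) * t + n%:R * t = (j%:R + n%:R - k%:R) * t by ring.
  have -> : (j%:R - k%:R) * t - n%:R * t = (j%:R - (k%:R + n%:R)) * t by ring.
  move=> H.
  rewrite -mulrA (_ : cos _ * cos _ = 2^-1 * (2 * cos ((j%:R - k%:R) * t) * cos (n%:R * t))); last by field.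
  by rewrite -H; ring.
rewrite (eq_Ipi E).
have c1 (k x : R) : continuous (fun t : R => k * cos (x * t)).
  by apply: continuous_mulr; [exact: continuous_cstr|exact: continuous_cosM].
rewrite Ipi_sum; last first.
  by move=> j; apply: continuous_sumr => k; exact: continuous_addr.
under eq_bigr => j _.
  rewrite Ipi_sum; last by move=> k; exact: continuous_addr.
  under eq_bigr => k _.
    rewrite IpiD// !IpiZ ?Ipi_cosB//; try exact: continuous_cosM.
    over.
  rewrite big_split/=; over.
(* After exchanging j and k, both halves of the product formula give the same autocorrelation, each
   with factor pi / 2. *)
rewrite big_split/= [X in _ + X]exchange_big/=.
have -> (x : R) : pi * x = pi / 2 * x + pi / 2 * x by rewrite -mulrDl -splitr.
rewrite -{1}(sum_autocorr P n) -(sum_autocorr P n) !mulr_sumr.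
congr (_ + _); apply: eq_bigr => j _; rewrite mulr_sumr; apply: eq_bigr => k _.
  by ring.
by rewrite [in LHS]eq_sym; ring.
Qed.

End trig_integrals.

(** * Smoothed logarithmic potentials *)

Section potentials.
Variable R : realType.
Implicit Types (f g : R -> R) (P : seq R) (r s phi t : R).

(** Turns truncated estimates into exact identities: against [tpsq P] the partial sums stop changing
    once N reaches [size P], while the remainder still decays geometrically. *)
Lemma geometric_small (x C r : R) n0 : 0 <= r < 1 ->
  (forall N, (n0 <= N)%N -> `|x| <= C * r ^+ N) -> x = 0.
Proof.
move=> /andP[r0 r1] H; apply/eqP; rewrite -normr_le0.
have c : C * r ^+ N @[N --> \oo] --> C * 0.
  by apply: cvgMr; apply: cvg_expr; rewrite ger0_norm.
rewrite -(mulr0 C) -(cvg_lim _ c)//; apply: limr_ge.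
  by apply/cvg_ex; exists (C * 0).
by exists n0 => // N /= n0N; exact: H.
Qed.

Definition poissonD r t := 1 - 2 * r * cos t + r ^+ 2.

(** Averaging over phi + t and phi - t removes the sine terms, so the series contains only cos (n
    phi) cos (n t). At r = 1 this is ln (2 |cos phi - cos t|), the logarithmic kernel on an arc; r <
    1 smooths its singularity. *)
Definition log_poisson r phi t :=
  (ln (poissonD r (phi + t)) + ln (poissonD r (phi - t))) / 2.

Lemma continuous_ln_poissonD r phi (k : R) : `|r| < 1 ->
  continuous (fun t => ln (poissonD r (phi + k * t))).
Proof.
move=> r1 t; apply: (@continuous_comp _ _ _ (fun t : R => poissonD r (phi + k * t)) (@ln R)).
  apply: cvgD; last exact: cvg_cst.
  apply: cvgB; first exact: cvg_cst.
  apply: cvgMr.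
  apply: (@continuous_comp _ _ _ (fun t : R => phi + k * t) (@cos R)).
    by apply: cvgD; [exact: cvg_cst|exact: mulrl_continuous].
  exact: continuous_cos.
by apply: continuous_ln; exact: poisson_denom_gt0.
Qed.

Lemma continuous_log_poisson r phi : `|r| < 1 -> continuous (log_poisson r phi).
Proof.
move=> r1 t; apply: cvgMl; apply: cvgD.
  have := @continuous_ln_poissonD r phi 1 r1 t.
  by under eq_fun do rewrite mul1r.
have := @continuous_ln_poissonD r phi (-1) r1 t.
by under eq_fun do rewrite mulN1r.
Qed.

Lemma autocorr_default P n : (size P <= n)%N -> autocorr P n = 0.
Proof.
move=> Pn; rewrite /autocorr big1// => j _.
by rewrite (nth_default _ (leq_trans Pn (leq_addl _ _))) mulr0.
Qed.

Lemma Ipi_norm_le f P C : continuous f ->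
  (forall t, `|f t| <= C) -> `|Ipi (fun t => f t * tpsq P t)| <= C * (pi * autocorr P 0).
Proof.
move=> cf fC.
have q0 : pi * autocorr P 0 = Ipi (tpsq P).
  rewrite -Ipi_tpsq_cos; apply: eq_Ipi => t.
  by rewrite mul0r cos0 mulr1.
have cq := @continuous_tpsq R P.
rewrite ler_norml q0 -mulNr -!IpiZ//; apply/andP; split; apply: le_Ipi => //.
- by apply: continuous_mulr => //; exact: continuous_cstr.
- exact: continuous_mulr.
- move=> t _; rewrite ler_wpM2r ?tpsq_ge0//.
  by have := fC t; rewrite ler_norml => /andP[].
- exact: continuous_mulr.
- by apply: continuous_mulr => //; exact: continuous_cstr.
- move=> t _; rewrite ler_wpM2r ?tpsq_ge0//.
  by have := fC t; rewrite ler_norml => /andP[].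
Qed.

Lemma log_poisson_series r phi t N : `|r| < 1 ->
  `|log_poisson r phi t +
    \sum_(n < N) 2 * r ^+ n.+1 * cos (n.+1%:R * phi) / n.+1%:R * cos (n.+1%:R * t)|
  <= 4 * `|r| ^+ N.+1 / (1 - `|r|) ^+ 2.
Proof.
move=> r1.
have h1 := ln_poisson_series (phi + t) N r1.
have h2 := ln_poisson_series (phi - t) N r1.
set C := 4 * _ / _ in h1 h2 *.
rewrite -[X in `|_ + X|](_ :
  (\sum_(n < N) 2 * r ^+ n.+1 * cos (n.+1%:R * (phi + t)) / n.+1%:R +
   \sum_(n < N) 2 * r ^+ n.+1 * cos (n.+1%:R * (phi - t)) / n.+1%:R) / 2 = _).
  rewrite -/(poissonD _ _) in h1; rewrite -/(poissonD _ _) in h2.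
  rewrite /log_poisson -mulrDl addrACA normrM (ger0_norm (x := 2^-1))//.
  rewrite ler_pdivrMr// mulr2n mulrDr mulr1 (le_trans (ler_normD _ _))//.
  exact: lerD.
rewrite -big_split/= mulr_suml; apply: eq_bigr => n _.
rewrite !mulrDr mulrN cosD cosB.
move: (cos _) (sin _) (cos _) (sin _) (n.+1%:R^-1) => a b c d e.
by field.
Qed.

Lemma Ipi_log_poisson r phi P : `|r| < 1 ->
  Ipi (fun t => log_poisson r phi t * tpsq P t) =
  - (pi * \sum_(n < size P)
       2 * r ^+ n.+1 * cos (n.+1%:R * phi) * autocorr P n.+1 / n.+1%:R).
Proof.
move=> r1; apply/eqP; rewrite -subr_eq0 opprK; apply/eqP.
apply: (@geometric_small _ (4 * `|r| / (1 - `|r|) ^+ 2 * (pi * autocorr P 0)) `|r| (size P)).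
  by rewrite normr_ge0.
move=> N PN.
have cL := @continuous_log_poisson r phi r1.
pose S t := \sum_(n < N) 2 * r ^+ n.+1 * cos (n.+1%:R * phi) / n.+1%:R * cos (n.+1%:R * t).
have cS : continuous S.
  by apply: continuous_sumr => n; apply: continuous_mulr;
    [exact: continuous_cstr|exact: continuous_cosM].
have cq := @continuous_tpsq R P.
have := @Ipi_norm_le (fun t => log_poisson r phi t + S t) P _
  (continuous_addr cL cS) (fun t => log_poisson_series phi t N r1).
rewrite (@eq_Ipi _ _ (fun t => log_poisson r phi t * tpsq P t + S t * tpsq P t)); last first.
  by move=> t; rewrite mulrDl.
rewrite IpiD; [|exact: continuous_mulr|exact: continuous_mulr].
have -> : Ipi (fun t => S t * tpsq P t) = pi * \sum_(n < size P)
       2 * r ^+ n.+1 * cos (n.+1%:R * phi) * autocorr P n.+1 / n.+1%:R.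
  rewrite (@eq_Ipi _ _ (fun t => \sum_(n < N) (2 * r ^+ n.+1 * cos (n.+1%:R * phi) / n.+1%:R *
     (tpsq P t * cos (n.+1%:R * t))))); last first.
    by move=> t; rewrite /S mulr_suml; apply: eq_bigr => n _; rewrite -mulrA [cos _ * _]mulrC.
  rewrite Ipi_sum; last first.
    move=> n; apply: continuous_mulr; first exact: continuous_cstr.
    by apply: continuous_mulr => //; exact: continuous_cosM.
  under eq_bigr => n _.
    rewrite IpiZ ?Ipi_tpsq_cos; last by apply: continuous_mulr => //; exact: continuous_cosM.
    over.
  rewrite (big_ord_widen N (fun n => 2 * r ^+ n.+1 * cos (n.+1%:R * phi) * autocorr P n.+1 / n.+1%:R) PN).
  rewrite [in RHS]big_mkcond mulr_sumr; apply: eq_bigr => n _ /=.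
  case: ltnP => nP; last by rewrite autocorr_default ?mulr0//; exact: leqW.
  by ring.
move=> /le_trans; apply.
by rewrite exprS le_eqVlt; apply/orP; left; apply/eqP; ring.
Qed.

End potentials.

(** * The limit r -> 1: potential at a point of the arc *)

Section interior_potential.
Variable R : realType.
Implicit Types (f g : R -> R) (P : seq R) (r s phi t : R).
Local Notation mu := (@lebesgue_measure R).
Local Notation I0pi := (`[0, pi : R]%classic : set R).

Lemma poissonD_le4 r t : 0 <= r <= 1 -> poissonD r t <= 4.
Proof.
move=> /andP[r0 r1].
have := cos_geN1 t; have : r ^+ 2 <= 1 by rewrite exprn_ile1.
rewrite /poissonD; nra.
Qed.

(** At r = 1 only the last square remains, which identifies the limit kernel. For 0 < r < 1 the
    first term is nonnegative, and dropping it gives the one-sided comparison [log_poisson_ge]. *)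
Lemma poissonD_mul r phi t :
  poissonD r (phi + t) * poissonD r (phi - t) =
  (1 - r) ^+ 2 * ((1 + r) ^+ 2 - 4 * r * cos phi * cos t) +
  (2 * r * (cos phi - cos t)) ^+ 2.
Proof.
rewrite /poissonD cosD cosB.
have h1 := sin2cos2 phi; have h2 := sin2cos2 t.
have E : (sin phi * sin t) ^+ 2 = (1 - cos phi ^+ 2) * (1 - cos t ^+ 2).
  by rewrite exprMn h1 h2.
move: E; move: (sin phi) (sin t) (cos phi) (cos t) => a b c d E.
transitivity ((1 + r ^+ 2 - 2 * r * c * d) ^+ 2 - 4 * r ^+ 2 * (a * b) ^+ 2); first by ring.
by rewrite E; ring.
Qed.

Lemma cos_neq phi t : 0 <= phi <= pi -> 0 <= t <= pi -> t != phi ->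
  0 < `|cos phi - cos t|.
Proof.
move=> p0 t0 tp; rewrite normr_gt0 subr_eq0; apply: contra_neq tp => H.
by apply: cos_inj; rewrite ?in_itv.
Qed.

Lemma log_poisson_ge r phi t : 0 < r < 1 -> 0 < `|cos phi - cos t| ->
  ln r + ln (2 * `|cos phi - cos t|) <= log_poisson r phi t.
Proof.
move=> /andP[r0 r1] c0.
have nr : `|r| < 1 by rewrite gtr0_norm.
have p1 := poisson_denom_gt0 (phi + t) nr.
have p2 := poisson_denom_gt0 (phi - t) nr.
rewrite -/(poissonD _ _) in p1; rewrite -/(poissonD _ _) in p2.
have -> : ln r + ln (2 * `|cos phi - cos t|) = ln (r * (2 * `|cos phi - cos t|)).
  by rewrite [RHS]lnM ?posrE ?mulr_gt0.
rewrite /log_poisson ler_pdivlMr//.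
have -> : ln (poissonD r (phi + t)) + ln (poissonD r (phi - t)) =
    ln (poissonD r (phi + t) * poissonD r (phi - t)) by rewrite lnM ?posrE.
rewrite mulr_natr -lnXn ?mulr_gt0// ler_ln ?posrE ?exprn_gt0 ?mulr_gt0//.
rewrite poissonD_mul mulrCA mulrA.
rewrite -[X in X <= _](_ : (2 * r * (cos phi - cos t)) ^+ 2 = _); last first.
  by rewrite 2!exprMn -[in LHS](real_normK (num_real (cos phi - cos t))) -!exprMn.
rewrite lerDr mulr_ge0 ?sqr_ge0//.
have h : cos phi * cos t <= 1.
  rewrite (le_trans (ler_norm _))// normrM mulr_ile1// ler_norml ?cos_geN1 ?cos_le1//.
have : 0 <= r * (1 - cos phi * cos t) by rewrite mulr_ge0 ?subr_ge0// ltW.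
by nra.
Qed.

Lemma log_poisson_le r phi t : 0 <= r < 1 -> log_poisson r phi t <= ln 4.
Proof.
move=> /andP[r0 r1]; have nr : `|r| < 1 by rewrite ger0_norm.
have r01 : 0 <= r <= 1 by rewrite r0 ltW.
rewrite /log_poisson ler_pdivrMr// mulr2n mulrDr mulr1.
by apply: lerD; rewrite ler_ln ?posrE ?poisson_denom_gt0 ?poissonD_le4.
Qed.

Lemma cvg_log_poisson phi t (r_ : R^nat) : 0 < `|cos phi - cos t| ->
  r_ @ \oo --> (1 : R) ->
  log_poisson (r_ n) phi t @[n --> \oo] --> ln (2 * `|cos phi - cos t|).
Proof.
move=> c0 rc.
have := poissonD_mul 1 phi t; rewrite subrr expr0n mul0r add0r mulr1 => E.
have pge a : 0 <= poissonD 1 a.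
  by rewrite /poissonD; have := cos_le1 a; lra.
have P0 : 0 < poissonD 1 (phi + t) * poissonD 1 (phi - t).
  by rewrite E exprn_even_gt0//= mulf_neq0// -normr_gt0.
have p1 : 0 < poissonD 1 (phi + t).
  by rewrite lt_neqAle pge andbT eq_sym; apply: contraTneq P0 => ->; rewrite mul0r ltxx.
have p2 : 0 < poissonD 1 (phi - t).
  by rewrite lt_neqAle pge andbT eq_sym; apply: contraTneq P0 => ->; rewrite mulr0 ltxx.
have -> : ln (2 * `|cos phi - cos t|) = log_poisson 1 phi t.
  rewrite /log_poisson; apply: (canRL (mulfK _)) => //.
  rewrite mulr_natr -lnXn ?mulr_gt0// -lnM ?posrE// E.
  by rewrite !exprMn real_normK ?num_real.
have cD a : poissonD (r_ n) a @[n --> \oo] --> poissonD 1 a.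
  apply: cvgD; last by apply: cvgM.
  apply: cvgB; first exact: cvg_cst.
  by apply: cvgMl; apply: cvgMr.
have cl a : 0 < poissonD 1 a -> ln (poissonD (r_ n) a) @[n --> \oo] --> ln (poissonD 1 a).
  by move=> a0; apply: continuous_cvg; [exact: continuous_ln|exact: cD].
by apply: cvgMl; apply: cvgD; apply: cl.
Qed.

Lemma Ipi_log_poissonB r phi P : `|r| < 1 ->
  Ipi (fun t => (ln 4 - log_poisson r phi t) * tpsq P t) =
  pi * (ln 4 * autocorr P 0 + \sum_(n < size P)
       2 * r ^+ n.+1 * cos (n.+1%:R * phi) * autocorr P n.+1 / n.+1%:R).
Proof.
move=> r1.
have cq := @continuous_tpsq R P.
have cL := @continuous_log_poisson R r phi r1.
rewrite (@eq_Ipi _ _ (fun t => ln 4 * tpsq P t + -1 * (log_poisson r phi t * tpsq P t))); last first.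
  by move=> t; rewrite mulN1r mulrBl.
have c1 : continuous (fun t => log_poisson r phi t * tpsq P t) by exact: continuous_mulr.
rewrite IpiD; first last.
- by apply: continuous_mulr => //; exact: continuous_cstr.
- by apply: continuous_mulr => //; exact: continuous_cstr.
rewrite !IpiZ// Ipi_log_poisson// mulN1r opprK mulrDr; congr (_ + _).
rewrite mulrCA -Ipi_tpsq_cos; congr (_ * _); apply: eq_Ipi => t.
by rewrite mul0r cos0 mulr1.
Qed.

(** The shift makes the sequence start at 1/2 rather than 0, because ln r is needed. *)
Let r_ (n : nat) : R := 1 - harmonic n.+1.

Let r_gt0 n : 0 < r_ n < 1.
Proof.
rewrite /r_ /harmonic/= subr_gt0 invf_lt1// ltr1n/= gtrBl.
by rewrite invr_gt0.
Qed.

Let cvg_r_ : r_ @ \oo --> (1 : R).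
Proof.
rewrite -[X in _ --> X]subr0; apply: cvgB; first exact: cvg_cst.
by rewrite (cvg_shiftS (@harmonic R)); exact: cvg_harmonic.
Qed.

(** Lets r tend to 1 in [Ipi_log_poissonB]. Subtracting from ln 4 makes the integrand nonnegative,
    so Fatou gives one inequality. The point phi is removed because the real [ln] has the value 0 at
    0 there instead of the limit of the smoothed kernels. *)
Lemma interior_log_potential phi P : 0 <= phi <= pi ->
  (\int[mu]_(t in I0pi `\ phi)
     ((ln 4 - ln (2 * `|cos phi - cos t|)) * tpsq P t)%:E =
  (pi * (ln 4 * autocorr P 0 + \sum_(n < size P)
     2 * cos (n.+1%:R * phi) * autocorr P n.+1 / n.+1%:R))%:E)%E.
Proof.
move=> phi0.
have cq := @continuous_tpsq R P.
pose V s := pi * (ln 4 * autocorr P 0 + \sum_(n < size P)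
       2 * s ^+ n.+1 * cos (n.+1%:R * phi) * autocorr P n.+1 / n.+1%:R).
have VE : V 1 = pi * (ln 4 * autocorr P 0 + \sum_(n < size P)
       2 * cos (n.+1%:R * phi) * autocorr P n.+1 / n.+1%:R).
  by congr (_ * (_ + _)); apply: eq_bigr => n _; rewrite expr1n mulr1.
rewrite -VE.
have cV : V (r_ n) @[n --> \oo] --> V 1.
  have : continuous V.
    apply: continuous_mulr; first exact: continuous_cstr.
    apply: continuous_addr; first exact: continuous_cstr.
    apply: continuous_sumr => n t.
    do 3 apply: cvgMl; apply: cvgMr; exact: exprn_continuous.
  by move=> /(_ 1) h; apply: continuous_cvg.
pose g t := (ln 4 - ln (2 * `|cos phi - cos t|)) * tpsq P t.
pose f n t := (ln 4 - log_poisson (r_ n) phi t) * tpsq P t.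
have mD : measurable (I0pi `\ phi) by apply: measurableD.
have nr n : `|r_ n| < 1.
  by have /andP[h1 h2] := r_gt0 n; rewrite gtr0_norm.
have cf n : continuous (f n).
  apply: continuous_mulr => //; apply: continuous_addr; first exact: continuous_cstr.
  by move=> t; apply: cvgN; exact: continuous_log_poisson.
have mf n (A : set R) : measurable_fun A (EFin \o f n).
  apply/measurable_EFinP; apply: measurable_funTS.
  exact: continuous_measurable_fun.
have If n : (\int[mu]_(t in I0pi `\ phi) (f n t)%:E = (V (r_ n))%:E)%E.
  rewrite integral_setD1//; last exact: mf.
  by rewrite -IpiE// Ipi_log_poissonB.
have Dt t : (I0pi `\ phi) t -> [/\ 0 <= t <= pi & 0 < `|cos phi - cos t|].
  move=> [/=]; rewrite in_itv/= => t0 /eqP tp; split => //.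
  exact: cos_neq.
have cle t : `|cos phi - cos t| <= 2.
  rewrite (le_trans (ler_normB _ _))// (_ : 2 = 1 + 1)//.
  by apply: lerD; rewrite ler_norml cos_geN1 cos_le1.
have g0 t : (I0pi `\ phi) t -> 0 <= g t.
  move=> /Dt[_ c0]; rewrite mulr_ge0 ?tpsq_ge0// subr_ge0 ler_ln ?posrE ?mulr_gt0//.
  by rewrite (_ : 4 = 2 * 2) ?ler_pM2l ?cle//; ring.
have mg : measurable_fun (I0pi `\ phi) (fun t => (g t)%:E).
  apply/measurable_EFinP; apply: measurable_funTS.
  apply: measurable_funM; last exact: continuous_measurable_fun.
  apply: measurable_funB => //; apply: measurableT_comp => //.
  apply: measurable_funM => //; apply: measurableT_comp => //.
  apply: measurable_funB => //; apply: continuous_measurable_fun.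
  exact: continuous_cos.
apply/eqP; rewrite eq_le; apply/andP; split.
  have := @fatou _ _ _ mu _ mD (fun n t => (f n t)%:E) (fun n => mf n _).
  have -> : limn_einf (fun n => \int[mu]_(t in I0pi `\ phi) (f n t)%:E)%E = (V 1)%:E.
    under eq_fun do rewrite If.
    have c : (V (r_ n))%:E @[n --> \oo] --> (V 1)%:E by apply: cvg_EFin => //; exact: nearW.
    rewrite is_cvg_limn_einfE; first exact/cvg_lim.
    by apply/cvg_ex; exists (V 1)%:E.
  have -> : (\int[mu]_(t in I0pi `\ phi) limn_einf (fun n => (f n t)%:E) =
     \int[mu]_(t in I0pi `\ phi) (g t)%:E)%E.
    apply: eq_integral => t; rewrite inE => /Dt[_ c0].
    have c : (f n t)%:E @[n --> \oo] --> (g t)%:E.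
      apply: cvg_EFin; first exact: nearW.
      apply: cvgMl; apply: cvgB; first exact: cvg_cst.
      exact: cvg_log_poisson.
    rewrite is_cvg_limn_einfE; first exact/cvg_lim.
    by apply/cvg_ex; exists (g t)%:E.
  apply => n t /Dt[_ c0]; rewrite lee_fin mulr_ge0 ?tpsq_ge0// subr_ge0.
  by apply: log_poisson_le; have /andP[/ltW -> ->] := r_gt0 n.
(* The other inequality: by [log_poisson_ge] the smoothed integrand exceeds the true one by at most
   - ln (r_ n) times the density, a loss that tends to 0. *)
have ub n : ((V (r_ n) + ln (r_ n) * (pi * autocorr P 0))%:E <=
    \int[mu]_(t in I0pi `\ phi) (g t)%:E)%E.
  have q0 : pi * autocorr P 0 = Ipi (tpsq P).
    rewrite -Ipi_tpsq_cos; apply: eq_Ipi => t.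
    by rewrite mul0r cos0 mulr1.
  have cr : continuous (fun t => - ln (r_ n) * tpsq P t).
    by apply: continuous_mulr => //; exact: continuous_cstr.
  have /andP[rn0 rn1] := r_gt0 n.
  have lr0 : 0 <= - ln (r_ n) by rewrite oppr_ge0 ln_le0// ltW.
  have Iq : (\int[mu]_(t in I0pi `\ phi) (- ln (r_ n) * tpsq P t)%:E =
      (- (ln (r_ n) * (pi * autocorr P 0)))%:E)%E.
    rewrite integral_setD1//; last first.
      apply/measurable_EFinP; apply: measurable_funTS.
      exact: continuous_measurable_fun.
    by rewrite -IpiE// IpiZ// q0 mulNr.
  have : ((V (r_ n))%:E <= \int[mu]_(t in I0pi `\ phi) (g t)%:E +
      (- (ln (r_ n) * (pi * autocorr P 0)))%:E)%E.
    rewrite -If -Iq -ge0_integralD//; last 2 first.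
    - by move=> t _; rewrite lee_fin mulr_ge0 ?tpsq_ge0.
    - apply/measurable_EFinP; apply: measurable_funTS.
      exact: continuous_measurable_fun.
    apply: ge0_le_integral => //.
    - move=> t /Dt[_ c0]; rewrite lee_fin mulr_ge0 ?tpsq_ge0// subr_ge0.
      by apply: log_poisson_le; rewrite ltW.
    - exact: mf.
    - apply: emeasurable_funD => //.
      apply/measurable_EFinP; apply: measurable_funTS.
      exact: continuous_measurable_fun.
    - move=> t /Dt[_ c0]; rewrite -EFinD lee_fin -mulrDl ler_wpM2r ?tpsq_ge0//.
      by have := log_poisson_ge (r_gt0 n) c0; lra.
  by rewrite -leeBlDr// -EFinB opprK.
have cb : (V (r_ n) + ln (r_ n) * (pi * autocorr P 0))%:E @[n --> \oo] --> (V 1)%:E.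
  apply: cvg_EFin; first exact: nearW.
  rewrite -[X in _ --> X]addr0 -[X in _ --> _ + X](mul0r (pi * autocorr P 0)).
  apply: cvgD => //; apply: cvgMl; rewrite -(ln1 R).
  by apply: continuous_cvg => //; exact: continuous_ln.
rewrite -(cvg_lim _ cb)//; apply: lime_le; last exact: nearW.
by apply/cvg_ex; exists (V 1)%:E.
Qed.

End interior_potential.

(** * Potential of one arc on the whole line *)

Section interval_potential.
Variable R : realType.
Implicit Types (f g : R -> R) (P : seq R) (m l w z x phi t C : R).
Local Notation mu := (@lebesgue_measure R).
Local Notation I0pi := (`[0, pi : R]%classic : set R).

(** [pot_in] and [pot_out] are the closed forms of 1/pi times the integral of ln |x - (m + l cos t)|
    against [tpsq P], for x = m + l cos phi on the arc and x = m + l (w + 1/w) / 2 off it. The sums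
    stop at [size P], beyond which autocorrelations vanish. *)
Definition pot_in l P phi := autocorr P 0 * ln (l / 2) -
  \sum_(n < size P) 2 * cos (n.+1%:R * phi) * autocorr P n.+1 / n.+1%:R.

Definition pot_out l P w := autocorr P 0 * ln (l / (2 * `|w|)) -
  \sum_(n < size P) 2 * w ^+ n.+1 * autocorr P n.+1 / n.+1%:R.

(* The root of modulus less than 1 of w + 1/w = 2 z when |z| > 1. *)
Definition jouk z : R := z - Num.sg z * Num.sqrt (z ^+ 2 - 1).

Lemma joukP z : 1 < `|z| -> [/\ 0 < `|jouk z|, `|jouk z| < 1,
  `|jouk z| = `|z| - Num.sqrt (z ^+ 2 - 1) & (jouk z + (jouk z)^-1) / 2 = z].
Proof.
move=> z1; set s := Num.sqrt (z ^+ 2 - 1).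
have z0 : z != 0 by rewrite -normr_gt0 (lt_trans _ z1).
have z2 : 0 < z ^+ 2 - 1.
  by rewrite subr_gt0 -(real_normK (num_real z)) exprn_egt1.
have s2 : s ^+ 2 = z ^+ 2 - 1 by rewrite sqr_sqrtr// ltW.
have s0 : 0 < s by rewrite sqrtr_gt0.
have E : jouk z * (z + Num.sg z * s) = 1.
  rewrite /jouk -/s -subr_sqr exprMn sqr_sg z0 mul1r s2; ring.
have jn : `|jouk z| = `|z| - s.
  rewrite /jouk -/s {1}[z]numEsg -mulrBr normrM normr_sg z0 mul1r ger0_norm// subr_ge0.
  have := @ler_pXn2r R 2 isT s `|z|; rewrite !nnegrE normr_ge0 (ltW s0) => <- //.
  by rewrite real_normK ?num_real// s2 gerBl.
have j0 : jouk z != 0 by apply: contra_eq_neq E => ->; rewrite mul0r eq_sym oner_eq0.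
split => //; first by rewrite normr_gt0.
  rewrite jn ltrBlDr.
  have := @ltr_pXn2r R 2 isT `|z| (1 + s).
  rewrite !nnegrE normr_ge0 addr_ge0 ?(ltW s0)// => <- //.
  rewrite real_normK ?num_real// sqrrD s2 expr1n mul1r.
  by rewrite -subr_gt0 (_ : _ - _ = s *+ 2) ?mulrn_wgt0//; ring.
have -> : (jouk z)^-1 = z + Num.sg z * s by rewrite -[LHS]mulr1 -E mulKf.
by rewrite /jouk -/s; field.
Qed.

(** Under the Joukowski map the distance to a point of the arc is a Poisson denominator with radius
    w, so off the arc the smoothed kernel is already the true one and no limit is taken. *)
Lemma outer_dist m l w t : 0 < l -> 0 < `|w| < 1 ->
  `|m + l * ((w + w^-1) / 2) - (m + l * cos t)| = l / (2 * `|w|) * poissonD w t.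
Proof.
move=> l0 /andP[w0 w1].
have w00 : w != 0 by rewrite -normr_gt0.
rewrite -[poissonD w t]ger0_norm; last by rewrite ltW// poisson_denom_gt0.
have -> : l / (2 * `|w|) = `|l / (2 * w)|.
  by rewrite normrM normfV normrM normr_nat (gtr0_norm l0).
by rewrite -normrM; congr `|_|; rewrite /poissonD; field.
Qed.

Lemma pot_outP m l P w C : 0 < l -> 0 < `|w| < 1 ->
  (\int[mu]_(t in I0pi) ((C%:E -
     lne `|m + l * ((w + w^-1) / 2) - (m + l * cos t)|%:E) * (tpsq P t)%:E) =
  (pi * (C * autocorr P 0 - pot_out l P w))%:E)%E.
Proof.
move=> l0 w01; have /andP[w0 w1] := w01.
have c0 : 0 < l / (2 * `|w|) by rewrite divr_gt0// mulr_gt0.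
set c := l / _ in c0.
have cq := @continuous_tpsq R P.
have cL := @continuous_log_poisson R w 0 w1.
have cm : continuous (fun t => log_poisson w 0 t * tpsq P t) by exact: continuous_mulr.
have c1 : continuous (fun t => (C - ln c) * tpsq P t).
  by apply: continuous_mulr => //; exact: continuous_cstr.
have c2 : continuous (fun t => -1 * (log_poisson w 0 t * tpsq P t)).
  by apply: continuous_mulr => //; exact: continuous_cstr.
transitivity ((Ipi (fun t =>
   (C - ln c) * tpsq P t + -1 * (log_poisson w 0 t * tpsq P t)))%:E).
  rewrite IpiE; last exact: continuous_addr.
  apply: eq_integral => t _.
  rewrite outer_dist// -/c lne_EFin ?(mulr_gt0 c0) ?poisson_denom_gt0//.
  rewrite -EFinB -EFinM; congr EFin.
  have -> : log_poisson w 0 t = ln (poissonD w t).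
    rewrite /log_poisson; have -> : poissonD w (0 - t) = poissonD w t by rewrite /poissonD sub0r cosN.
    by rewrite add0r mulrDl -splitr.
  by rewrite lnM ?posrE ?poisson_denom_gt0//; ring.
rewrite [Ipi _](IpiD c1 c2) [X in X + _](IpiZ _ cq) [X in _ + X](IpiZ _ cm).
rewrite Ipi_log_poisson// mulN1r opprK.
have -> : Ipi (tpsq P) = pi * autocorr P 0.
  rewrite -Ipi_tpsq_cos; apply: eq_Ipi => t.
  by rewrite mul0r cos0 mulr1.
congr EFin; rewrite /pot_out -/c mulrBl.
under eq_bigr do rewrite mulr0 cos0 mulr1.
ring.
Qed.

Lemma pot_inP m l P phi C : 0 < l -> 0 <= phi <= pi ->
  (\int[mu]_(t in I0pi) ((C%:E -
     lne `|m + l * cos phi - (m + l * cos t)|%:E) * (tpsq P t)%:E) =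
  (pi * (C * autocorr P 0 - pot_in l P phi))%:E)%E.
Proof.
move=> l0 phi0.
have mD : measurable (I0pi `\ phi) by apply: measurableD.
have cq := @continuous_tpsq R P.
(* The integrand splits into the nonnegative singular part just evaluated and a constant multiple of
   the density, using l |cos phi - cos t| = (l / 2) (2 |cos phi - cos t|). *)
pose g t := (ln 4 - ln (2 * `|cos phi - cos t|)) * tpsq P t.
pose k t := (C - ln (l / 2) - ln 4) * tpsq P t.
have ck : continuous k by apply: continuous_mulr => //; exact: continuous_cstr.
have g0 t : (I0pi `\ phi) t -> 0 <= g t.
  move=> [/=]; rewrite in_itv/= => t0 /eqP tp.
  rewrite mulr_ge0 ?tpsq_ge0// subr_ge0 ler_ln ?posrE ?mulr_gt0 ?cos_neq//.
  rewrite (_ : 4 = 2 * 2) ?ler_pM2l//; last by ring.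
  rewrite (le_trans (ler_normB _ _))// (_ : 2 = 1 + 1)//.
  by apply: lerD; rewrite ler_norml cos_geN1 cos_le1.
have mg : measurable_fun (I0pi `\ phi) (EFin \o g).
  apply/measurable_EFinP; apply: measurable_funTS.
  apply: measurable_funM; last exact: continuous_measurable_fun.
  apply: measurable_funB => //; apply: measurableT_comp => //.
  apply: measurable_funM => //; apply: measurableT_comp => //.
  apply: measurable_funB => //; apply: continuous_measurable_fun.
  exact: continuous_cos.
have ig : mu.-integrable (I0pi `\ phi) (EFin \o g).
  apply/integrableP; split => //.
  have -> : (\int[mu]_(x in I0pi `\ phi) `|(EFin \o g) x| =
      \int[mu]_(x in I0pi `\ phi) (g x)%:E)%E.
    by apply: eq_integral => t; rewrite inE => tD /=; rewrite ger0_norm ?g0.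
  by rewrite [X in (X < _)%E]interior_log_potential// ltry.
have mk (A : set R) : measurable_fun A (EFin \o k).
  apply/measurable_EFinP; apply: measurable_funTS.
  exact: continuous_measurable_fun.
have ik : mu.-integrable (I0pi `\ phi) (EFin \o k).
  by apply: integrableS (integrable_0pi ck) => //; exact: subDsetl.
have E t : (I0pi `\ phi) t -> ((C%:E -
     lne `|m + l * cos phi - (m + l * cos t)|%:E) * (tpsq P t)%:E =
     (EFin \o g) t + (EFin \o k) t)%E.
  move=> tD; have c0 : 0 < `|cos phi - cos t|.
    by move: tD => [/=]; rewrite in_itv/= => t0 /eqP tp; exact: cos_neq.
  rewrite (_ : m + _ - _ = l * (cos phi - cos t)); last by ring.
  rewrite normrM (gtr0_norm l0). rewrite lne_EFin ?mulr_gt0// -EFinB -EFinM -EFinD.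
  congr EFin; rewrite /g /k.
  rewrite (_ : l * `|cos phi - cos t| = l / 2 * (2 * `|cos phi - cos t|)); last by field.
  by rewrite [ln (l / 2 * _)]lnM ?posrE ?mulr_gt0 ?divr_gt0//; ring.
rewrite -(@integral_setD1 _ _ phi)//; last first.
  apply: (eq_measurable_fun (fun t => (EFin \o g) t + (EFin \o k) t)%E).
    by move=> t; rewrite inE => /E.
  exact: emeasurable_funD.
transitivity (\int[mu]_(t in I0pi `\ phi) ((EFin \o g) t + (EFin \o k) t))%E.
  by apply: eq_integral => t; rewrite inE => /E.
rewrite integralD//.
have -> : (\int[mu]_(x in I0pi `\ phi) (EFin \o k) x)%E =
    ((C - ln (l / 2) - ln 4) * (pi * autocorr P 0))%:E.
  rewrite integral_setD1// -[LHS](IpiE ck) [Ipi _](IpiZ _ cq).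
  rewrite -Ipi_tpsq_cos; congr (_ * _)%:E; apply: eq_Ipi => t.
  by rewrite mul0r cos0 mulr1.
rewrite [X in (X + _)%E]interior_log_potential// -EFinD; congr EFin.
by rewrite /pot_in; ring.
Qed.

Definition itv_pot m l P x :=
  if `|x - m| <= l then pot_in l P (acos ((x - m) / l))
  else pot_out l P (jouk ((x - m) / l)).

Lemma itv_potP m l P x C : 0 < l ->
  (\int[mu]_(t in I0pi)
     ((C%:E - lne `|x - (m + l * cos t)|%:E) * (tpsq P t)%:E) =
  (pi * (C * autocorr P 0 - itv_pot m l P x))%:E)%E.
Proof.
move=> l0; rewrite /itv_pot; case: leP => xl.
  have z1 : -1 <= (x - m) / l <= 1.
    by rewrite -ler_norml normrM normfV (gtr0_norm l0) ler_pdivrMr// mul1r.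
  have {1}-> : x = m + l * cos (acos ((x - m) / l)).
    by rewrite acosK ?in_itv//= mulrCA mulfV ?gt_eqF// mulr1 addrC subrK.
  by apply: pot_inP => //; rewrite acos_ge0 ?acos_lepi.
have z1 : 1 < `|(x - m) / l|.
  by rewrite normrM normfV (gtr0_norm l0) ltr_pdivlMr// mul1r.
have [j0 j1 _ jE] := joukP z1.
have {1}-> : x = m + l * ((jouk ((x - m) / l) + (jouk ((x - m) / l))^-1) / 2).
  by rewrite jE mulrCA mulfV ?gt_eqF// mulr1 addrC subrK.
by apply: pot_outP => //; rewrite j0.
Qed.

Lemma autocorr0_ge0 P : 0 <= autocorr P 0.
Proof. by apply: sumr_ge0 => j _; rewrite addn0 -expr2 sqr_ge0. Qed.

(** The bound does not depend on x: each cosine or power of w is at most 1 in modulus, and the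
    logarithm only grows off the arc. It provides the lower half of the integrability of the
    potential against an arbitrary measure with finite mean. *)
Lemma itv_pot_ge m l P x : 0 < l -> autocorr P 0 * ln (l / 2) -
  \sum_(n < size P) 2 * `|autocorr P n.+1| / n.+1%:R <= itv_pot m l P x.
Proof.
move=> l0; rewrite /itv_pot /pot_in /pot_out; case: (leP `|x - m| l) => xl; apply: lerB.
- by [].
- apply: ler_sum => n _; rewrite ler_pM2r ?invr_gt0// -mulrA ler_pM2l//.
  rewrite (le_trans (ler_norm _))// normrM ler_piMl// ler_norml.
  by rewrite cos_geN1 cos_le1.
- rewrite ler_wpM2l ?autocorr0_ge0//.
  have z1 : 1 < `|(x - m) / l|.
    by rewrite normrM normfV (gtr0_norm l0) ltr_pdivlMr// mul1r.
  have [j0 j1 _ jE] := joukP z1.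
  rewrite ler_ln ?posrE ?divr_gt0 ?mulr_gt0// ler_pM2l// lef_pV2 ?posrE ?mulr_gt0//.
  by rewrite ger_pMr// ltW.
- have z1 : 1 < `|(x - m) / l|.
    by rewrite normrM normfV (gtr0_norm l0) ltr_pdivlMr// mul1r.
  have [j0 j1 _ jE] := joukP z1.
  apply: ler_sum => n _; rewrite ler_pM2r ?invr_gt0// -mulrA ler_pM2l//.
  rewrite (le_trans (ler_norm _))// normrM ler_piMl// normrX exprn_ile1//.
  exact: ltW.
Qed.

End interval_potential.

(** * The measure with a given density, and its nonnegative integrals *)

Section density_measure.
Local Open Scope ereal_scope.
Context d (T : measurableType d) (R : realType).
Variables (m : {measure set T -> \bar R}) (D : set T) (f : T -> R).
Hypotheses (mD : measurable D) (mf : measurable_fun setT f).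
Hypothesis f0 : forall x, (0 <= f x)%R.

Definition density (A : set T) : \bar R := \int[m]_(x in A `&` D) (f x)%:E.

Let density0 : density set0 = 0.
Proof. by rewrite /density set0I integral_set0. Qed.

Let density_ge0 A : 0 <= density A.
Proof. by apply: integral_ge0 => x _; rewrite lee_fin. Qed.

Let mEf A : measurable_fun A (EFin \o f).
Proof. exact/measurable_EFinP/measurable_funTS. Qed.

Let density_sigma_additive : semi_sigma_additive density.
Proof.
move=> F mF tF mUF; rewrite /density setI_bigcupl.
have mFD n : measurable (F n `&` D) by exact: measurableI.
rewrite ge0_integral_bigcup//; last 2 first.
- by move=> x _; rewrite lee_fin.
- exact: trivIset_setIr.
by apply: is_cvg_ereal_nneg_natsum => n _; exact: density_ge0.
Qed.

HB.instance Definition _ := isMeasure.Build _ _ _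
  density density0 density_ge0 density_sigma_additive.

Import HBNNSimple.

Let ge0_integral_density_nnsfun (h : {nnsfun T >-> R}) :
  \int[density]_x (h x)%:E = \int[m]_(x in D) ((h x)%:E * (f x)%:E).
Proof.
have mk k : measurable (h @^-1` [set k]) by exact: measurable_sfunP.
transitivity (\sum_(k \in range h)
    \int[density]_x (k * \1_(h @^-1` [set k]) x)%:E).
  under eq_integral do rewrite fimfunE -fsumEFin//.
  rewrite ge0_integral_fsum//.
  - by move=> y; exact/measurable_EFinP/measurable_funM.
  - by move=> y x _; rewrite nnfun_muleindic_ge0.
transitivity (\sum_(k \in range h)
    \int[m]_(x in D) ((k * \1_(h @^-1` [set k]) x)%:E * (f x)%:E)).
  apply: eq_fsbigr => k _.
  rewrite integralZl_indic_nnsfun// integral_indic// setIT.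
  have [k0|k0] := ltP k 0%R.
    rewrite preimage_nnfun0// measure0 mule0 integral0_eq// => x _.
    by rewrite indic0 mulr0 mul0e.
  under [RHS]eq_integral do rewrite EFinM -muleA.
  rewrite ge0_integralZl//; last 2 first.
  - apply: emeasurable_funM => //; apply/measurable_EFinP.
    exact: measurable_indic.
  - by move=> x _; rewrite mule_ge0 ?lee_fin.
  congr (_ * _); rewrite -[LHS]/(\int[m]_(x in _ `&` D) (f x)%:E) setIC integral_mkcondr.
  apply: eq_integral => x _; rewrite patchE indicE.
  by case: ifPn => _; rewrite ?mul1e ?mul0e.
rewrite -ge0_integral_fsum//.
- apply: eq_integral => x _; rewrite -ge0_mule_fsuml; last first.
    by move=> k; rewrite EFinM nnfun_muleindic_ge0.
  by rewrite fsumEFin// -fimfunE.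
- move=> k; apply: emeasurable_funM => //.
  exact/measurable_EFinP/measurable_funTS/measurable_funM.
- move=> k x _; apply: mule_ge0; last by rewrite lee_fin.
  by rewrite EFinM nnfun_muleindic_ge0.
Qed.

Lemma ge0_integral_density (g : T -> \bar R) : measurable_fun setT g ->
  (forall x, 0 <= g x) ->
  \int[density]_x g x = \int[m]_(x in D) (g x * (f x)%:E).
Proof.
move=> mg g0; pose g_ := nnsfun_approx measurableT mg.
transitivity (limn (fun n => \int[density]_x (g_ n x)%:E)).
  rewrite -monotone_convergence//.
  - apply: eq_integral => y _; apply/esym/cvg_lim => //.
    by apply: cvg_nnsfun_approx.
  - by move=> n; exact/measurable_EFinP.
  - by move=> n y _; rewrite lee_fin.
  - by move=> y _ a b ab; rewrite lee_fin; exact/lefP/nd_nnsfun_approx.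
under eq_fun do rewrite ge0_integral_density_nnsfun.
rewrite -monotone_convergence//.
- apply: eq_integral => y _; apply/cvg_lim => //.
  apply: cvgeZr => //; apply: cvg_nnsfun_approx => //.
- move=> n; apply: emeasurable_funM => //.
  exact/measurable_EFinP/measurable_funTS.
- by move=> n y _; rewrite mule_ge0 ?lee_fin.
- move=> y _ a b ab; rewrite lee_wpmul2r ?lee_fin//.
  exact/lefP/nd_nnsfun_approx.
Qed.

End density_measure.

(** * The probability measure nu carried by the arcs *)

Section arc_measures.
Variable R : realType.
Implicit Types (m l t : R) (P : seq R).
Local Notation mu := (@lebesgue_measure R).
Local Notation I0pi := (`[0, pi : R]%classic : set R).

Definition arc_param m l t : measurableTypeR R := m + l * cos t.

Lemma continuous_arc_param m l : continuous (arc_param m l : R -> R).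
Proof.
apply: continuous_addr; first exact: continuous_cstr.
apply: continuous_mulr; [exact: continuous_cstr|exact: continuous_cos].
Qed.

Lemma measurable_arc_param m l : measurable_fun setT (arc_param m l).
Proof. exact: continuous_measurable_fun (@continuous_arc_param m l). Qed.

Lemma measurable_tpsq P : measurable_fun setT (tpsq P).
Proof. exact: continuous_measurable_fun (@continuous_tpsq R P). Qed.

Definition arc_density P : {measure set (measurableTypeR R) -> \bar R}.
Proof.
refine (density mu I0pi (tpsq P) : {measure set (measurableTypeR R) -> \bar R}).
- exact: measurable_itv.
- exact: measurable_tpsq.
- exact: tpsq_ge0.
Defined.

Definition arc_measure m l P : {measure set (measurableTypeR R) -> \bar R}.
Proof.
refine (pushforward (arc_density P) (arc_param m l) :
  {measure set (measurableTypeR R) -> \bar R}).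
exact: measurable_arc_param.
Defined.

Lemma ge0_integral_arc_measure m l P (g : R -> \bar R) :
  measurable_fun (setT : set R) g -> (forall x, 0 <= g x)%E ->
  (\int[arc_measure m l P]_x g x =
   \int[mu]_(t in I0pi) (g (arc_param m l t) * (tpsq P t)%:E))%E.
Proof.
move=> mg g0; rewrite ge0_integral_pushforward//.
- rewrite preimage_setT ge0_integral_density//.
  + exact: measurable_tpsq.
  + exact: tpsq_ge0.
  + by apply: measurableT_comp => //; exact: measurable_arc_param.
  + by move=> x; exact: g0.
- exact: measurable_arc_param.
Qed.

(* An arc [(m, l, P)] stands for the image of the density [tpsq P] on [0, pi]
   under [t |-> m + l * cos t]. *)
Definition arc : Type := (R * R * seq R)%type.
Implicit Types (s : seq arc) (a : arc).
Definition amid a : R := a.1.1.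
Definition arad a : R := a.1.2.
Definition acoef a : seq R := a.2.
Definition arc0 : arc := ((0, 1), [::]).

Definition arcs_mass s : R := \sum_(a <- s) autocorr (acoef a) 0.

Lemma arcs_mass_ge0 s : 0 <= arcs_mass s.
Proof. by apply: sumr_ge0 => a _; exact: autocorr0_ge0. Qed.

Lemma arcs_norm_ge0 s : 0 <= (pi * arcs_mass s)^-1.
Proof. by rewrite invr_ge0 mulr_ge0 ?pi_ge0 ?arcs_mass_ge0. Qed.

(** Each [tpsq] integrates over [0, pi] to pi times its zeroth autocorrelation, whence the
    normalisation. The potentials [arcs_pot] below omit it, so they are [arcs_mass s] times those of
    nu. *)
Definition arcs_measure s : {measure set (measurableTypeR R) -> \bar R} :=
  mscale (NngNum (arcs_norm_ge0 s))
    (msum (fun i => arc_measure (amid (nth arc0 s i)) (arad (nth arc0 s i))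
             (acoef (nth arc0 s i))) (size s)).

Lemma ge0_integral_arcs s (g : R -> \bar R) :
  measurable_fun (setT : set R) g -> (forall x, 0 <= g x)%E ->
  (\int[arcs_measure s]_x g x = (pi * arcs_mass s)^-1%:E *
   \sum_(a <- s) \int[mu]_(t in I0pi)
     (g (arc_param (amid a) (arad a) t) * (tpsq (acoef a) t)%:E))%E.
Proof.
move=> mg g0; rewrite ge0_integral_mscale//= ge0_integral_measure_sum//.
congr (_ * _)%E; rewrite (big_nth arc0) big_mkord; apply: eq_bigr => i _.
by rewrite ge0_integral_arc_measure.
Qed.

Lemma arcs_measureT s : 0 < arcs_mass s -> arcs_measure s setT = 1%E.
Proof.
move=> M0; rewrite -[LHS]mul1e -(@integral_cst _ _ _ (arcs_measure s) setT)//.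
rewrite ge0_integral_arcs//.
have -> : (\sum_(a <- s) \int[mu]_(t in I0pi) (1 * (tpsq (acoef a) t)%:E) =
   (pi * arcs_mass s)%:E)%E.
  rewrite /arcs_mass mulr_sumr -sumEFin; apply: eq_bigr => a _.
  under eq_integral do rewrite mul1e.
  rewrite -(IpiE (@continuous_tpsq R _)); congr EFin.
  rewrite -Ipi_tpsq_cos; apply: eq_Ipi => t.
  by rewrite mul0r cos0 mulr1.
by rewrite -EFinM mulVf// mulf_neq0 ?gt_eqF ?pi_gt0.
Qed.

Section arcs_probability.
Variables (s : seq arc) (M0 : 0 < arcs_mass s).
Let H := Measure_isProbability.Build _ _ _ (arcs_measure s) (arcs_measureT M0).
Definition arcs_prob : probability (measurableTypeR R) R :=
  HB.pack (Measure.sort (arcs_measure s)) H.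
End arcs_probability.

End arc_measures.

(** * Products of sigma-finite measures, for the plane of window parameters *)

Section product_sigma_finite.
Local Open Scope ereal_scope.
Context d1 d2 (T1 : measurableType d1) (T2 : measurableType d2) (R : realType).
Variables (m1 : {sigma_finite_measure set T1 -> \bar R})
          (m2 : {sigma_finite_measure set T2 -> \bar R}).

Let mprod : {measure set (T1 * T2)%type -> \bar R} := (m1 \x m2)%E.

Let sigma_finite_mprod : sigma_finite setT mprod.
Proof.
have /sigma_finiteP[F [TF ndF Foo]] := sigma_finiteT m1.
have /sigma_finiteP[G [TG ndG Goo]] := sigma_finiteT m2.
exists (fun n => F n `*` G n).
  apply/seteqP; split => // -[x y] _.
  have [i _ Fx] : (\bigcup_i F i) x by rewrite -TF.
  have [j _ Gy] : (\bigcup_i G i) y by rewrite -TG.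
  exists (maxn i j) => //; split.
    by apply: (subsetPset _ _ (ndF _ _ _)) Fx; exact: leq_maxl.
  by apply: (subsetPset _ _ (ndG _ _ _)) Gy; exact: leq_maxr.
move=> k; have [? ?] := Foo k; have [? ?] := Goo k; split; first exact: measurableX.
by rewrite [ltLHS]product_measure1E// lte_mul_pinfty// ge0_fin_numE.
Qed.

Definition sigma_finite_product : {sigma_finite_measure set (T1 * T2)%type -> \bar R} :=
  HB.pack (Measure.sort mprod) (Measure_isSigmaFinite.Build _ _ _ mprod sigma_finite_mprod).

End product_sigma_finite.

(** * Positive definiteness of Gram kernels *)

Section positive_definite.
Local Open Scope ereal_scope.
Context d1 d2 (T : measurableType d1) (U : measurableType d2) (R : realType).
Variables (m : {sigma_finite_measure set T -> \bar R}).
Variable phi : T * U -> \bar R.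
Hypotheses (mphi : measurable_fun setT phi) (phi0 : forall z, 0 <= phi z).

(** A Gram kernel: by Tonelli its double integrals are inner products of the functions [pot mu] and
    [pot nu] on the parameter space. *)
Let ker (z : U * U) := \int[m]_w (phi (w, z.1) * phi (w, z.2)).

Let measurable_phiM (d3 : measure_display) (V : measurableType d3)
    (f : V -> T) (g h : V -> U) :
  measurable_fun setT f -> measurable_fun setT g -> measurable_fun setT h ->
  measurable_fun setT (fun v => phi (f v, g v) * phi (f v, h v)).
Proof.
move=> mf mg mh; apply: emeasurable_funM; apply: measurableT_comp mphi _;
  exact: measurable_fun_pair.
Qed.

Lemma measurable_pd_kernel : measurable_fun setT ker.
Proof.
apply: (@measurable_fun_fubini_tonelli_F _ _ _ _ _ m
  (fun z => phi (z.2, z.1.1) * phi (z.2, z.1.2))).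
- apply: measurable_phiM => //; exact: measurableT_comp.
- by move=> z; exact: mule_ge0.
Qed.

Let pot (mu : probability U R) (w : T) := \int[mu]_x phi (w, x).

Let mpot mu : measurable_fun setT (pot mu).
Proof. exact: measurable_fun_fubini_tonelli_F. Qed.

Let pot0 mu w : 0 <= pot mu w.
Proof. exact: integral_ge0. Qed.

Lemma integral_pd_kernel (mu nu : probability U R) :
  \int[mu \x nu]_z ker z = \int[m]_w (pot mu w * pot nu w).
Proof.
rewrite fubini_tonelli1//; last 2 first.
- exact: measurable_pd_kernel.
- by move=> z; apply: integral_ge0 => w _; exact: mule_ge0.
transitivity (\int[mu]_x \int[m]_w (phi (w, x) * pot nu w)).
  apply: eq_integral => x _; rewrite /fubini_F /ker/=.
  rewrite (@fubini_tonelli _ _ _ _ _ nu m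
    (fun z => phi (z.2, x) * phi (z.2, z.1)))//=; last 2 first.
  - by apply: measurable_phiM.
  - by move=> z; exact: mule_ge0.
  apply: eq_integral => w _; rewrite ge0_integralZl//.
  exact: measurableT_comp mphi _.
rewrite (@fubini_tonelli _ _ _ _ _ mu m
    (fun z => phi (z.2, z.1) * pot nu z.2))//=; last 2 first.
- apply: emeasurable_funM; last exact: measurableT_comp.
  by apply: measurableT_comp mphi _; exact: measurable_fun_pair.
- by move=> z; exact: mule_ge0.
apply: eq_integral => w _; rewrite ge0_integralZr//.
exact: measurableT_comp mphi _.
Qed.

(** Pointwise 2 a b <= a^2 + b^2 for the two functions [pot], including the value +oo. No difference
    of measures is formed, so only nonnegative integrals occur. *)
Lemma pd_kernel_ineq (mu nu : probability U R) :
  \int[mu \x nu]_z ker z + \int[mu \x nu]_z ker z <=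
  \int[mu \x mu]_z ker z + \int[nu \x nu]_z ker z.
Proof.
rewrite !integral_pd_kernel -!ge0_integralD//; try by
  [move=> w _; exact: mule_ge0|exact: emeasurable_funM].
apply: ge0_le_integral => //.
- by move=> w _; rewrite adde_ge0// mule_ge0.
- by apply: emeasurable_funD; exact: emeasurable_funM.
- by apply: emeasurable_funD; exact: emeasurable_funM.
move=> w _; move: (pot0 mu w) (pot0 nu w).
case: (pot mu w) => [a||] //; case: (pot nu w) => [b||] //.
- move=> _ _; rewrite -!EFinM -!EFinD lee_fin.
  by rewrite -subr_ge0 (_ : _ - _ = (a - b) ^+ 2)%R ?sqr_ge0//; ring.
- by move=> a0 _; rewrite mulyy addey// leey.
- by move=> _ b0; rewrite mulyy addye// leey.
Qed.

End positive_definite.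

(** * The logarithm as a limit of window kernels *)

Section log_kernel.
Variable R : realType.
Implicit Types (e B r t u x y : R).
Local Notation mu := (@lebesgue_measure R).

(* The windows [u, u + r] with e <= r <= B: averaging the product of the
   indicators over u with Lebesgue measure and over r with weight 1/r^2
   approximates - ln |x - y| up to an additive constant. *)
Definition window e B (z : (measurableTypeR R * measurableTypeR R) * measurableTypeR R) : \bar R :=
  (if [&& e <= z.1.1, z.1.1 <= B, z.1.2 <= z.2 & z.2 <= z.1.2 + z.1.1]
   then powR z.1.1 (-1) else 0)%:E.

Lemma window_ge0 e B z : (0 <= window e B z)%E.
Proof. by rewrite /window; case: ifP => _; rewrite lee_fin ?powR_ge0. Qed.

Lemma measurable_window e B : measurable_fun setT (window e B).
Proof.
apply/measurable_EFinP; apply: measurable_fun_ifT => //; last first.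
  apply: (measurableT_comp (@measurable_powR R (-1))).
  by apply: measurableT_comp.
do !apply: measurable_and; apply: measurable_fun_ler => //;
  do ?[exact: measurableT_comp | apply: measurable_funD].
Qed.

(** The integral of (r - t) / r^2 from max (e, t) to B, with primitive ln r + t / r; it is 0 when
    this range is empty. *)
Definition window_kernel e B t : R :=
  if Num.max e t <= B
  then ln B + t / B - ln (Num.max e t) - t / Num.max e t else 0.

(** A window [u, u + r] contains both points exactly for u in an interval of length r - |x - y|,
    empty when that is negative. Each of the two factors contributes 1/r. *)
Lemma window_inner e B r x y : 0 < e ->
  (\int[mu]_u (window e B ((r, u), x) * window e B ((r, u), y)) =
  (if (e <= r) && (r <= B) then r ^- 2 * Num.max 0 (r - `|x - y|) else 0)%:E)%E.
Proof.
move=> e0; rewrite /window/=.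
have [er|er] := boolP (e <= r); last by rewrite /= integral0_eq// => u _; rewrite mul0e.
have [rB|rB] := boolP (r <= B); last by rewrite /= integral0_eq// => u _; rewrite mul0e.
have r0 : 0 < r by exact: lt_le_trans er.
rewrite /=; transitivity (\int[mu]_(u in `[(Num.max x y - r)%R, (Num.min x y)%R]%classic) (r ^- 2)%:E)%E.
  rewrite [RHS]integral_mkcond; apply: eq_integral => u _; rewrite patchE mem_setE in_itv/=.
  rewrite lerBlDr ge_max le_min -EFinM.
  case: (u <= x); case: (u <= y); case: (x <= u + r); case: (y <= u + r) => //=;
    rewrite ?mulr0 ?mul0r//.
  by rewrite powR_inv1 ?ltW// -invfM -expr2.
rewrite integral_cst//= lebesgue_measure_itv/= lte_fin.
have E : Num.min x y - (Num.max x y - r) = r - `|x - y|.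
  by case: (lerP x y) => xy; ring.
rewrite -subr_gt0 E.
case: ltP => h.
  by rewrite -EFinD E -EFinM.
by rewrite mule0 mulr0.
Qed.

Lemma window_outer e B t : 0 < e -> 0 <= t ->
  (\int[mu]_r (if (e <= r) && (r <= B) then r ^- 2 * Num.max 0 (r - t) else 0)%:E
   = (window_kernel e B t)%:E)%E.
Proof.
move=> e0 t0; rewrite /window_kernel.
set a := Num.max e t; have a0 : 0 < a by rewrite lt_max e0.
transitivity (\int[mu]_(r in `[a, B]%classic) (r^-1 - t * r ^- 2)%R%:E)%E.
  rewrite [RHS]integral_mkcond; apply: eq_integral => r _; rewrite patchE mem_setE in_itv/=.
  rewrite ge_max; case: (lerP e r) => er //=; case: (lerP r B) => rB; rewrite ?andbF//=.
  have r0 : 0 < r by exact: lt_le_trans er.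
  case: (lerP t r) => tr /=.
    rewrite (max_idPr _) ?subr_ge0//; congr EFin.
    by field; rewrite gt_eqF.
  by rewrite (max_idPl _) ?mulr0// subr_le0 ltW.
case: leP => aB; last by rewrite set_itv_ge ?integral_set0// bnd_simp -ltNge.
move: aB; rewrite le_eqVlt => /predU1P[<-|aB].
  by rewrite set_itv1 integral_set1; congr EFin; ring.
pose F r := ln r + t * r^-1.
have dF r : 0 < r -> is_derive r 1 F (r^-1 - t * r ^- 2).
  move=> r0; have r00 : r != 0 by rewrite gt_eqF.
  have d1 := is_derive1_ln r0.
  have d2 : is_derive r 1 (fun r : R => r^-1) (- r ^- 2).
    apply: DeriveDef; first exact: (@derivableV _ _ id).
    by rewrite (@deriveV _ _ id)// derive_id /GRing.scale/= mulr1.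
  have -> : F = @ln R + t \*: (fun r : R => r^-1) by apply/funext.
  by apply: is_derive_eq; rewrite /GRing.scale/= mulrN.
rewrite (@continuous_FTC2 R (fun r => r^-1 - t * r ^- 2) F a B aB).
- by rewrite -EFinB; congr EFin; rewrite /F; ring.
- apply: derivable_within_continuous => r; rewrite in_itv/= => /andP[ar _].
  have r0 : r != 0 by rewrite gt_eqF// (lt_le_trans a0).
  have -> : (fun r : R => r^-1 - t * r ^- 2) =
     (fun r : R => r^-1) - t \*: ((fun r : R => r^-1) * (fun r : R => r^-1)).
    by apply/funext => v; rewrite !fctE /GRing.scale/= -invfM -expr2.
  have dV : derivable (fun r : R => r^-1) r 1 by exact: (@derivableV _ _ id).
  by apply: derivableB => //; apply: derivableZ; apply: derivableM.
- have cF r : 0 < r -> {for r, continuous F}.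
    move=> r0; have [dd _] := dF r r0.
    by apply: differentiable_continuous; exact/derivable1_diffP.
  split.
  + move=> r; rewrite in_itv/= => /andP[ar _].
    by have [] := dF r (lt_trans a0 ar).
  + by apply: cvg_at_right_filter; exact: cF.
  + by apply: cvg_at_left_filter; apply: cF; exact: lt_trans aB.
- move=> r; rewrite in_itv/= => /andP[ar _].
  have := dF r (lt_trans a0 ar) => dr.
  by rewrite derive1E; exact: derive_val.
Qed.

End log_kernel.

(** * The energy inequality for probability measures *)

Section log_energy_inequality.
Variable R : realType.
Implicit Types (e B r t u x y : R).
Local Notation T := (measurableTypeR R).

Lemma measurable_lne_EFin d (U : measurableType d) (f : U -> R) :
  measurable_fun setT f -> measurable_fun setT (fun v : U => lne (f v)%:E).
Proof.
move=> mf; apply: measurable_fun_ifT => //.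
- exact: measurable_fun_ler.
- by apply/measurable_EFinP; exact: measurableT_comp.
Qed.

Lemma ln_le_sub1 x : 0 < x -> ln x <= x - 1.
Proof.
move=> x0; rewrite -{1}(subrK 1 x) addrC le_ln1Dx//.
by rewrite ltrBDr addNr.
Qed.

Lemma window_kernel_ge0 e B t : 0 < e -> 0 <= t -> 0 <= window_kernel e B t.
Proof.
move=> e0 t0; rewrite -lee_fin -window_outer//; apply: integral_ge0 => r _.
rewrite lee_fin; case: ifP => // /andP[er _].
by rewrite mulr_ge0 ?le_max ?lexx// invr_ge0 sqr_ge0.
Qed.

Lemma window_kernel_le e B t : 0 < e -> e <= B -> 0 <= t ->
  window_kernel e B t <= ln B - ln e.
Proof.
move=> e0 eB t0; have B0 := lt_le_trans e0 eB.
rewrite /window_kernel; case: ifP => aB; last by rewrite subr_ge0 ler_ln.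
set a := Num.max e t in aB *; have a0 : 0 < a by rewrite lt_max e0.
have : ln e <= ln a by rewrite ler_ln// le_max lexx.
have : t / B <= t / a by rewrite ler_wpM2l// lef_pV2.
lra.
Qed.

(** With e = 1/(n+1) and B = n+1, the kernel at e <= t <= B is ln B - 1 - ln t + t/B; subtracting it
    from ln B - 1 leaves ln t up to t/B. *)
Definition log_approx (n : nat) t : R :=
  ln n.+1%:R - 1 - window_kernel n.+1%:R^-1 n.+1%:R t.

(** A dominating function independent of n. The three regimes are t below 1/B, between 1/B and B,
    and above B; all rest on ln u <= u - 1 and on B >= 1. *)
Lemma log_approx_norm_le n t : 0 < t -> `|log_approx n t| <= `|ln t| + t.
Proof.
move=> t0; rewrite /log_approx.
have : 1 <= n.+1%:R :> R by rewrite ler1n.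
move: (n.+1%:R) => B B1.
have B0 : 0 < B by exact: lt_le_trans B1.
have e0 : 0 < B^-1 by rewrite invr_gt0.
have e1 : B^-1 <= 1 by rewrite invf_le1.
have /andP[tB0 tB1] : 0 <= t / B <= t.
  by rewrite divr_ge0 ?(ltW t0) ?(ltW B0)//= ler_pdivrMr// ler_peMr// ltW.
suff [h1 h2] : ln t - t / B <= ln B - 1 - window_kernel B^-1 B t /\
    ln B - 1 - window_kernel B^-1 B t <= Num.max (ln t) 0.
  rewrite ler_norml; apply/andP; split.
    by apply: le_trans h1; have := ler_norm (- ln t); rewrite normrN; lra.
  apply: le_trans h2 _; rewrite ge_max; apply/andP; split.
    by have := ler_norm (ln t); lra.
  by rewrite addr_ge0// ltW.
have lntB : ln t <= t / B - 1 + ln B.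
  by have := ln_le_sub1 (divr_gt0 t0 B0); rewrite ln_div ?posrE//; lra.
rewrite /window_kernel; case: ifP => aB; last first.
  split; first by lra.
  move/negbT: aB; rewrite -ltNge lt_max.
  rewrite (_ : (B < B^-1) = false); last by apply/negbTE; rewrite -leNgt (le_trans e1).
  move=> /= Bt; have : ln B <= ln t by rewrite ler_ln// ltW.
  by rewrite le_max; lra.
have [et|te] := lerP B^-1 t.
  by split; rewrite ?le_max divff ?gt_eqF//; lra.
have h := ln_le_sub1 (divr_gt0 t0 e0).
have h3 : t / B^-1 <= 1 by rewrite ler_pdivrMr// mul1r ltW.
have h4 : ln B^-1 <= 0 by rewrite ln_le0.
rewrite ln_div ?posrE// in h.
by split; [lra|rewrite le_max; apply/orP; right; lra].
Qed.

Lemma log_approx_eq n t : n.+1%:R^-1 <= t -> t <= n.+1%:R ->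
  log_approx n t = ln t - t / n.+1%:R.
Proof.
move=> et tB; rewrite /log_approx /window_kernel (max_idPr et) tB.
have t0 : 0 < t by apply: lt_le_trans et; rewrite invr_gt0.
by rewrite divff ?gt_eqF//; ring.
Qed.

Lemma cvg_log_approx t : 0 < t -> log_approx n t @[n --> \oo] --> ln t.
Proof.
move=> t0.
have c : ln t - t * harmonic n @[n --> \oo] --> ln t - t * 0.
  by apply: cvgB; [exact: cvg_cst|apply: cvgMr; exact: cvg_harmonic].
rewrite mulr0 subr0 in c; apply: cvg_trans c; apply: near_eq_cvg.
have [k1 k1P] : exists k, t <= k%:R.
  by exists (Num.truncn t).+1; rewrite ltW// truncnS_gt.
have [k2 k2P] : exists k, t^-1 <= k%:R.
  by exists (Num.truncn t^-1).+1; rewrite ltW// truncnS_gt.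
exists (maxn k1 k2) => // n /=; rewrite geq_max => /andP[n1 n2].
rewrite log_approx_eq//.
- rewrite -[leRHS]invrK lef_pV2 ?posrE ?invr_gt0//.
  by rewrite (le_trans k2P)// ler_nat leqW.
- by rewrite (le_trans k1P)// ler_nat leqW.
Qed.

Let dist (z : T * T) : R := `|z.1 - z.2|.

Let mdist : measurable_fun setT dist.
Proof.
by apply: measurableT_comp => //; apply: measurable_funB.
Qed.

Let lam2 : {sigma_finite_measure set (T * T)%type -> \bar R} :=
  sigma_finite_product (@lebesgue_measure R) (@lebesgue_measure R).

Let Kn (n : nat) (z : T * T) : \bar R :=
  (\int[lam2]_w
    (window n.+1%:R^-1 n.+1%:R (w, z.1) * window n.+1%:R^-1 n.+1%:R (w, z.2)))%E.

Let measurable_Kn n : measurable_fun setT (Kn n).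
Proof.
exact: (measurable_pd_kernel lam2 (@measurable_window R n.+1%:R^-1 n.+1%:R)
  (@window_ge0 R n.+1%:R^-1 n.+1%:R)).
Qed.

Let KnE n z : Kn n z = (window_kernel n.+1%:R^-1 n.+1%:R (dist z))%:E.
Proof.
rewrite /Kn -[LHS]/(\int[(@lebesgue_measure R \x @lebesgue_measure R)%E]_w
    (window n.+1%:R^-1 n.+1%:R (w, z.1) * window n.+1%:R^-1 n.+1%:R (w, z.2)))%E.
rewrite fubini_tonelli1; last 2 first.
- have mw := @measurable_window R n.+1%:R^-1 n.+1%:R.
  by apply: emeasurable_funM; apply: (measurableT_comp mw); exact: measurable_fun_pair.
- by move=> w; apply: mule_ge0; exact: window_ge0.
rewrite -window_outer ?invr_gt0 ?normr_ge0//.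
apply: eq_integral => r _.
by rewrite /fubini_F window_inner// invr_gt0.
Qed.

Let integrable_Kn (m : {measure set (T * T) -> \bar R}) n :
  m setT = 1%E -> m.-integrable setT (Kn n).
Proof.
move=> m1.
have ic : m.-integrable setT (EFin \o (fun z : T * T => ln n.+1%:R - ln n.+1%:R^-1)).
  apply/integrableP; split; first exact/measurable_EFinP.
  by under eq_integral do rewrite /=; rewrite integral_cst//= m1 mule1 ltry.
apply: le_integrable ic => //.
move=> z _; rewrite KnE /= lee_fin ger0_norm; last first.
  by rewrite window_kernel_ge0// ?invr_gt0 ?normr_ge0.
rewrite (le_trans _ (ler_norm _))// window_kernel_le ?invr_gt0 ?normr_ge0//.
by rewrite (@le_trans _ _ 1) ?invf_le1 ?ler1n.
Qed.

Lemma cvg_integral_log_approx (m : {measure set (T * T) -> \bar R}) :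
  m setT = 1%E ->
  m.-integrable setT (fun z => lne (dist z)%:E) ->
  m.-integrable setT (EFin \o dist) ->
  ((ln n.+1%:R - 1)%:E - \int[m]_z Kn n z)%E @[n --> \oo] -->
    (\int[m]_z lne (dist z)%:E)%E.
Proof.
move=> m1 iF iD.
have mF := measurable_int _ iF.
have mK n : measurable_fun setT (fun z => (log_approx n (dist z))%:E).
  apply/measurable_EFinP; apply: measurable_funB => //.
  apply/measurable_EFinP.
  have -> : (EFin \o (fun z => window_kernel n.+1%:R^-1 n.+1%:R (dist z))) = Kn n.
    by apply/funext => z; rewrite KnE.
  exact: measurable_Kn.
(* Integrability makes [lne] finite almost everywhere, hence the diagonal negligible; pointwise
   convergence is only known off it. *)
have ae0 : {ae m, forall z, setT z -> 0 < dist z}.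
  have := integrable_ae measurableT iF; apply: filterS => z /(_ Logic.I).
  rewrite /lne; case: ifPn => // h _ _; by rewrite ltNge.
have ic c : m.-integrable setT (EFin \o (fun z : T * T => c)).
  apply/integrableP; split; first exact/measurable_EFinP.
  by under eq_integral do rewrite /=; rewrite integral_cst//= m1 mule1 ltry.
have E : (fun n => ((ln n.+1%:R - 1)%:E - \int[m]_z Kn n z)%E) =
    (fun n => \int[m]_z (log_approx n (dist z))%:E)%E.
  apply/funext => n.
  have -> : (ln n.+1%:R - 1)%:E = (\int[m]_z (ln n.+1%:R - 1)%:E)%E.
    by rewrite integral_cst//= m1 mule1.
  rewrite -(integralB measurableT (ic _) (integrable_Kn n m1)).
  by apply: eq_integral => z _ /=; rewrite KnE.
rewrite E.
have [] := @dominated_convergence _ _ _ m setT measurableT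
  (fun n z => (log_approx n (dist z))%:E) (fun z => lne (dist z)%:E)
  (fun z => `|lne (dist z)%:E| + (dist z)%:E)%E mK mF => //.
- move: ae0; apply: filterS => z /(_ Logic.I) z0 _.
  rewrite lne_EFin//; apply: cvg_EFin; first exact: nearW.
  exact: cvg_log_approx.
- apply: integrableD => //; exact: integrable_abse.
- move: ae0; apply: filterS => z /(_ Logic.I) z0 n _.
  by rewrite lne_EFin// lee_fin log_approx_norm_le.
Qed.

(** The limit of [pd_kernel_ineq] for the window kernels. The diverging constants ln (n+1) - 1 occur
    twice on each side, because all the products have mass 1, and cancel. This is where probability
    measures are essential: the logarithm is only conditionally definite. *)
Theorem log_energy_ineq (P Q : probability T R) :
  let F z := lne (dist z)%:E in
  (P \x P)%E.-integrable setT F -> (P \x Q)%E.-integrable setT F ->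
  (Q \x Q)%E.-integrable setT F ->
  (P \x P)%E.-integrable setT (EFin \o dist) ->
  (P \x Q)%E.-integrable setT (EFin \o dist) ->
  (Q \x Q)%E.-integrable setT (EFin \o dist) ->
  (\int[P \x P]_z F z + \int[Q \x Q]_z F z <=
   \int[P \x Q]_z F z + \int[P \x Q]_z F z)%E.
Proof.
move=> F FPP FPQ FQQ DPP DPQ DQQ.
have m1 (P1 P2 : probability T R) : (P1 \x P2)%E setT = 1%E.
  rewrite -setXTT [LHS]product_measure1E//.
  by rewrite -[RHS]mule1; congr (_ * _)%E; exact: probability_setT.
have cPP := cvg_integral_log_approx (m1 P P) FPP DPP.
have cPQ := cvg_integral_log_approx (m1 P Q) FPQ DPQ.
have cQQ := cvg_integral_log_approx (m1 Q Q) FQQ DQQ.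
have fin (P1 P2 : probability T R) : (P1 \x P2)%E.-integrable setT F ->
  (\int[P1 \x P2]_z F z)%E \is a fin_num by move=> h; exact: integrable_fin_num h.
have c1 := cvgeD (fin_num_adde_defr _ (fin _ _ FPP)) cPP cQQ.
have c2 := cvgeD (fin_num_adde_defr _ (fin _ _ FPQ)) cPQ cPQ.
apply: (lee_cvg_to (c1 _) (c2 _)); apply: nearW => n /=.
have pd := pd_kernel_ineq lam2 (@measurable_window R n.+1%:R^-1 n.+1%:R)
  (@window_ge0 R n.+1%:R^-1 n.+1%:R) P Q.
have kf (P1 P2 : probability T R) : (\int[P1 \x P2]_z Kn n z)%E \is a fin_num.
  exact: integrable_fin_num (integrable_Kn n (m1 P1 P2)).
move: pd (kf P P) (kf P Q) (kf Q Q); rewrite -/(Kn n).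
case: (\int[P \x P]_z Kn n z)%E => // a; case: (\int[P \x Q]_z Kn n z)%E => // b.
case: (\int[Q \x Q]_z Kn n z)%E => // c.
by rewrite -!EFinD !lee_fin => h _ _ _; lra.
Qed.

End log_energy_inequality.

(** * Potential and support of the union of arcs *)

Section arcs_potential.
Variable R : realType.
Local Notation T := (measurableTypeR R).
Local Notation mu := (@lebesgue_measure R).
Local Notation I0pi := (`[0, pi : R]%classic : set R).
Implicit Types (s : seq (arc R)) (a : arc R) (x y r B C : R).

Definition arcs_pot s x : R :=
  \sum_(a <- s) itv_pot (amid a) (arad a) (acoef a) x.

Definition arcs_mean s : R :=
  \sum_(a <- s) (amid a * autocorr (acoef a) 0 + arad a * autocorr (acoef a) 1).

Definition arcs_in s B := forall a, a \in s -> 0 < arad a /\ `|amid a| + arad a <= B.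

Lemma measurable_lne_dist x :
  measurable_fun (setT : set T) (fun y : T => lne `|x - y|%:E).
Proof.
by apply: measurable_lne_EFin; apply: measurableT_comp => //; apply: measurable_funB.
Qed.

Lemma arc_param_le a B t : 0 < arad a -> `|amid a| + arad a <= B ->
  `|arc_param (amid a) (arad a) t| <= B.
Proof.
move=> a0 /(le_trans _); apply.
rewrite /arc_param (le_trans (ler_normD _ _))// lerD2l normrM (gtr0_norm a0).
by rewrite ler_piMr ?(ltW a0)// ler_norml cos_geN1 cos_le1.
Qed.

Lemma lne_le x C : 0 < x -> ln x <= C -> forall y, 0 <= y <= x -> (lne y%:E <= C%:E)%E.
Proof.
move=> x0 xC y /andP[y0 yx]; rewrite /lne; case: ifPn => [_|]; first exact: leNye.
rewrite -ltNge => y1; rewrite lee_fin (le_trans _ xC)// ler_ln ?posrE//.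
Qed.

(** The integration formula for arcs is available for nonnegative integrands. Truncation at 0 makes
    the integrand nonnegative everywhere and is inactive on the arcs, where |x - y| <= |x| + B. *)
Lemma arcs_potP s B x C : 0 < arcs_mass s -> arcs_in s B ->
  0 < `|x| + B -> ln (`|x| + B) <= C ->
  (\int[arcs_measure s]_y maxe 0 (C%:E - lne `|x - y|%:E) =
   (C - arcs_pot s x / arcs_mass s)%:E)%E.
Proof.
move=> M0 sB xB xC.
have mlne := measurable_lne_dist x.
rewrite ge0_integral_arcs//; last 2 first.
- apply: measurable_maxe => //; exact: emeasurable_funB.
- by move=> y; rewrite le_max lexx.
have -> : (\sum_(a <- s) \int[mu]_(t in I0pi)
   (maxe 0 (C%:E - lne `|x - arc_param (amid a) (arad a) t|%:E) * (tpsq (acoef a) t)%:E) =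
   (pi * (C * arcs_mass s - arcs_pot s x))%:E)%E.
  rewrite /arcs_mass /arcs_pot [(C * _)%R]mulr_sumr -sumrB mulr_sumr -sumEFin.
  rewrite !big_seq; apply: eq_bigr => a /sB[a0 aB].
  rewrite -itv_potP//; apply: eq_integral => t _.
  rewrite (max_idPr _)// subre_ge0// (lne_le xB xC)// normr_ge0/=.
  by rewrite (le_trans (ler_normB _ _))// lerD2l arc_param_le.
rewrite -EFinM; congr EFin.
have pi0 : pi != 0 :> R by rewrite gt_eqF// pi_gt0.
have M0' : arcs_mass s != 0 by rewrite gt_eqF.
move: (pi : R) pi0 (arcs_mass s) M0' => p p0 M M1.
by field; rewrite p0 M1.
Qed.

Lemma arcs_pot_ge s B : arcs_in s B ->
  exists K : R, forall x, K <= arcs_pot s x.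
Proof.
move=> sB; exists (\sum_(a <- s) (autocorr (acoef a) 0 * ln (arad a / 2) -
  \sum_(n < size (acoef a)) 2 * `|autocorr (acoef a) n.+1| / n.+1%:R)) => x.
rewrite /arcs_pot !big_seq; apply: ler_sum => a /sB[a0 _].
exact: itv_pot_ge.
Qed.

Lemma arcs_support s B : arcs_in s B -> forall A : set T, measurable A ->
  (forall a t, a \in s -> ~ A (arc_param (amid a) (arad a) t)) ->
  arcs_measure s A = 0%E.
Proof.
move=> sB A mA nA.
have -> : arcs_measure s A = (\int[arcs_measure s]_x (\1_A x)%:E)%E.
  by rewrite integral_indic// setIT.
rewrite ge0_integral_arcs//.
- rewrite big_seq big1 ?mule0// => a ain; rewrite integral0_eq// => t _.
  by rewrite indicE memNset ?mul0e//; exact: nA.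
- by apply/measurable_EFinP; exact: measurable_indic.
Qed.

End arcs_potential.

(** * Integrability forced by a nonnegative integral *)

Section integrability.
Context d (U : measurableType d) (R : realType).
Variable m : {measure set U -> \bar R}.
Implicit Types (f g h : U -> \bar R).

(** The majorant makes the positive part finite; an infinite negative part would then make the
    integral -oo. Thus the constraints in [admissible] are themselves what makes logarithmic energy
    and log |Q| integrable. *)
Lemma integrable_of_ge0 f h : measurable_fun setT f -> m.-integrable setT h ->
  (forall x, f x <= h x)%E -> (0 <= \int[m]_x f x)%E -> m.-integrable setT f.
Proof.
move=> mf ih fh; rewrite integralE => f0.
have pos : (\int[m]_x (f^\+ x) < +oo)%E.
  have := integral_funepos_lt_pinfty measurableT ih.
  apply: le_lt_trans.
  apply: ge0_le_integral => //; try exact: measurable_funepos.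
    by apply: measurable_funepos; case/integrableP: ih.
  by move=> x _; rewrite funeposE ge_max !funeposE !le_max lexx orbT fh.
have neg : (\int[m]_x (f^\- x) < +oo)%E.
  rewrite ltey; apply/negP => /eqP neg; move: f0; rewrite neg.
  by rewrite addeNy leeNy_eq.
apply/integrableP; split => //.
have -> : (\int[m]_x `|f x| = \int[m]_x (f^\+ x + f^\- x))%E.
  by apply: eq_integral => x _; rewrite -[RHS]/((f^\+ \+ f^\-)%E x) -fune_abse.
rewrite ge0_integralD//; last 2 first.
- exact: measurable_funepos.
- exact: measurable_funeneg.
by rewrite lte_add_pinfty.
Qed.

Lemma ae_le_integral f g : m.-integrable setT f -> m.-integrable setT g ->
  {ae m, forall x, (f x <= g x)%E} -> (\int[m]_x f x <= \int[m]_x g x)%E.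
Proof.
move=> fi gi [N [mN N0 fgN]].
rewrite (negligible_integral mN _ fi N0)// (negligible_integral mN _ gi N0)//.
apply: le_integral.
- exact: measurableD.
- by apply: integrableS fi => //; exact: measurableD.
- by apply: integrableS gi => //; exact: measurableD.
- by move=> x /set_mem[_ Nx]; apply: contrapT => xN; exact/Nx/fgN.
Qed.

Lemma ae_sub_integral (c : U -> R) f g : measurable_fun setT f ->
  m.-integrable setT (EFin \o c) -> m.-integrable setT g ->
  {ae m, forall x, f x = ((c x)%:E - g x)%E} ->
  m.-integrable setT f /\
  (\int[m]_x f x = \int[m]_x (c x)%:E - \int[m]_x g x)%E.
Proof.
move=> mf ci gi fcg.
have icg := integrableB measurableT ci gi.
have mcg : measurable_fun setT ((EFin \o c) \- g)%E by case/integrableP: icg.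
have H : ae_eq m setT f ((EFin \o c) \- g)%E.
  by apply: filterS fcg => x + _.
split; last by rewrite -integralB//; exact: ae_eq_integral.
apply/integrableP; split => //; case/integrableP: icg => _.
have -> : (\int[m]_x `|f x| = \int[m]_x `|((EFin \o c) \- g) x|)%E => //.
apply: ae_eq_integral => //; try exact: measurableT_comp.
by apply: filterS H => x /= + _ => ->.
Qed.

End integrability.

Lemma lneM_ge0 (R : realType) (a b : R) : 0 <= a -> 0 <= b ->
  lne (a * b)%:E = (lne a%:E + lne b%:E)%E.
Proof.
rewrite !le_eqVlt => /orP[/eqP<-|a0] /orP[/eqP<-|b0].
- by rewrite mul0r /= lexx addNye.
- by rewrite mul0r /= lexx addNye.
- by rewrite mulr0 /= lexx addeNy.
- by rewrite !lne_EFin ?mulr_gt0// lnM ?posrE.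
Qed.

Lemma lne_prod (R : realType) (rs : seq R) (x : R) :
  lne `|\prod_(r <- rs) (x - r)|%:E = (\sum_(r <- rs) lne `|x - r|%:E)%E.
Proof.
elim: rs => [|r rs IH]; first by rewrite !big_nil normr1 lne_EFin// ln1.
by rewrite !big_cons normrM lneM_ge0// IH.
Qed.

Lemma lne_le_norm (R : realType) (x : R) : (lne `|x|%:E <= `|x|%:E)%E.
Proof. exact/ltW/lne_sublinear. Qed.

(** * Logarithmic integrals against nu and against products with nu *)

Section arcs_integrals.
Variable R : realType.
Local Notation T := (measurableTypeR R).
Local Notation mu := (@lebesgue_measure R).
Local Notation I0pi := (`[0, pi : R]%classic : set R).
Local Notation arc := (arc R).
Lemma measurable_norm_gt (B : R) : measurable [set x : T | B < `|x|].
Proof.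
rewrite (_ : mkset _ = setT `&` (@Num.norm R R : T -> R) @^-1` `]B, +oo[).
  by apply: measurable_funTS => //; exact: measurable_itv.
by rewrite setTI; apply/seteqP; split => x /=; rewrite in_itv/= andbT.
Qed.

Variables (s : seq arc) (B : R).
Hypotheses (M0 : 0 < arcs_mass s) (sB : arcs_in s B) (B1 : 1 <= B).
Local Notation nu := (arcs_prob M0).
Let M := arcs_mass s.

Lemma arcs_prob_out : nu [set x : T | B < `|x|] = 0%E.
Proof.
apply: (arcs_support sB (measurable_norm_gt B)).
move=> a t /sB[a0 aB] /=.
by apply/negP; rewrite -leNgt arc_param_le.
Qed.

(** Since ln u <= u, the truncation does nothing for |y| <= B, hence almost nowhere for nu. The
    majorant |x| + B is integrable as soon as the other measure has a first moment. *)
Let gap (x y : R) : \bar R := (maxe 0 ((`|x| + B)%:E - lne `|x - y|%:E))%E.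

Let gap_ge0 x y : (0 <= gap x y)%E.
Proof. by rewrite /gap le_max lexx. Qed.

Let measurable_gap : measurable_fun setT (fun z : T * T => gap z.1 z.2).
Proof.
apply: measurable_maxe => //; apply: emeasurable_funB.
  by apply/measurable_EFinP; apply: measurable_funD => //; apply: measurableT_comp.
by apply: measurable_lne_EFin; apply: measurableT_comp => //; exact: measurable_funB.
Qed.

Let measurable_gap2 x : measurable_fun setT (gap x : T -> \bar R).
Proof.
apply: measurable_maxe => //; apply: emeasurable_funB => //.
exact: measurable_lne_dist.
Qed.

Let int_gap x : (\int[nu]_y gap x y = (`|x| + B - arcs_pot s x / M)%:E)%E.
Proof.
apply: (arcs_potP M0 sB); first by rewrite ltr_wpDl// (lt_le_trans ltr01).
have x0 : 0 < `|x| + B by rewrite ltr_wpDl// (lt_le_trans ltr01).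
by apply/ltW/ln_sublinear.
Qed.

Let gapE x y : `|y| <= B -> lne `|x - y|%:E = ((`|x| + B)%:E - gap x y)%E.
Proof.
move=> yB; have x0 : 0 < `|x| + B by rewrite ltr_wpDl// (lt_le_trans ltr01).
have le : (lne `|x - y|%:E <= (`|x| + B)%:E)%E.
  rewrite (le_trans (lne_le_norm _))// lee_fin (le_trans (ler_normB _ _))//.
  by rewrite lerD2l.
rewrite /gap (max_idPr _) ?sube_ge0//; move: le.
case: (lne _) => [r||]//= _.
  by rewrite -EFinB opprB addrC subrK.
by rewrite orbT.
Qed.

Lemma integrable_lne_arcs x :
  nu.-integrable setT (fun y : T => lne `|x - y|%:E) /\
  (\int[nu]_y lne `|x - y|%:E = (arcs_pot s x / M)%:E)%E.
Proof.
have gi : nu.-integrable setT (gap x).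
  apply/integrableP; split; first exact: measurable_gap2.
  under eq_integral do rewrite gee0_abs ?gap_ge0//.
  by rewrite int_gap ltry.
have [||fi ->] := @ae_sub_integral _ _ _ nu (fun=> `|x| + B) _ _
  (measurable_lne_dist x) _ gi _.
- exact: finite_measure_integrable_cst.
- exists [set x | B < `|x|]; split.
  + exact: measurable_norm_gt.
  + exact: arcs_prob_out.
  + move=> y /= H; rewrite ltNge; apply/negP => yB; exact/H/gapE.
- split=> //; rewrite int_gap.
  rewrite (_ : (fun _ => _) = cst (`|x| + B)%:E)// integral_cst//.
  rewrite (_ : _ setT = 1%E); last exact: probability_setT.
  rewrite mule1 -EFinB; congr EFin; ring.
Qed.

Section product_with_arcs.
Variable P : probability T R.
Hypothesis Pid : P.-integrable setT (EFin : T -> \bar R).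

Lemma integrable_norm_fst : P.-integrable setT (fun x : T => (`|x| + B)%:E).
Proof.
rewrite (_ : (fun _ => _) = (abse \o (EFin : T -> \bar R)) \+ cst B%:E)%E//.
apply: integrableD => //; first exact: integrable_abse.
exact: finite_measure_integrable_cst.
Qed.

Let PT (Q : probability T R) : Q setT = 1%E. Proof. exact: probability_setT. Qed.

Lemma integrable_fst (Q : probability T R) (f : T -> R) :
  P.-integrable setT (EFin \o f) ->
  (P \x Q)%E.-integrable setT (fun z => (f z.1)%:E) /\
  (\int[P \x Q]_z (f z.1)%:E = \int[P]_x (f x)%:E)%E.
Proof.
move=> fi; have mf : measurable_fun setT (fun z : T * T => (f z.1)%:E).
  by case/integrableP: fi => + _ => /measurableT_comp; apply.
have cst_int c : (\int[Q]_y (cst c%:E) y = c%:E)%E.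
  by rewrite integral_cst//= PT mule1.
have H : (P \x Q)%E.-integrable setT (fun z => (f z.1)%:E).
  apply/integrable12ltyP => //.
  case/integrableP: fi => _; apply: le_lt_trans; rewrite le_eqVlt; apply/orP; left.
  by apply/eqP/eq_integral => x _; exact: (cst_int `|f x|).
split=> //; rewrite -(integral12_prod_meas1 H).
by apply: eq_integral => x _; exact: (cst_int (f x)).
Qed.

(** A finite first moment of P suffices: the potential is bounded below by a constant and above by M
    (|x| + B), so the Tonelli integral of [gap] is finite and the logarithm is recovered as a
    difference. *)
Lemma integrable_lne_arcs_prod :
  [/\ (P \x nu)%E.-integrable setT (fun z => lne `|z.1 - z.2|%:E),
      P.-integrable setT (fun x => (arcs_pot s x)%:E) &
      (\int[P \x nu]_z lne `|z.1 - z.2|%:E =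
       \int[P]_x (arcs_pot s x)%:E * (M^-1)%:E)%E].
Proof.
have M0' : M != 0 by rewrite gt_eqF.
have mpot : measurable_fun setT (fun x : T => \int[nu]_y gap x y)%E.
  exact: (@measurable_fun_fubini_tonelli_F _ _ _ _ _ nu _ measurable_gap
      (fun z => gap_ge0 z.1 z.2)).
have mpot' : measurable_fun setT (fun x : T => (`|x| + B - arcs_pot s x / M)%R).
  by apply/measurable_EFinP; apply: eq_measurable_fun mpot => x _; exact: int_gap.
have mnorm : measurable_fun setT (fun x : T => `|x| + B).
  by apply: measurable_funD => //; exact: measurableT_comp.
(* Measurability is inherited from the Tonelli integral of [gap], not derived from the piecewise
   closed form. *)
have mp : measurable_fun setT (fun x : T => arcs_pot s x).
  rewrite (_ : (fun _ => _) = (fun x : T => M * ((`|x| + B) - (`|x| + B - arcs_pot s x / M)))).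
    by apply: measurable_funM => //; exact: measurable_funB.
  apply/funext => x; rewrite opprB addrC subrK.
  by rewrite mulrC mulfVK.
have [K KP] := arcs_pot_ge sB.
have potle x : arcs_pot s x <= M * (`|x| + B).
  have : (0%:E <= (`|x| + B - arcs_pot s x / M)%:E)%E.
    by rewrite -int_gap; apply: integral_ge0.
  by rewrite lee_fin subr_ge0 ler_pdivrMr// mulrC.
have ipot : P.-integrable setT (fun x => (arcs_pot s x)%:E).
  apply: (@le_integrable _ _ _ P _ measurableT _
    (fun x : T => (M * (`|x| + B) + `|K|)%:E)).
  - exact/measurable_EFinP.
  - move=> x _; rewrite lee_fin.
    have h0 : 0 <= M * (`|x| + B).
      by rewrite mulr_ge0 ?(ltW M0)// addr_ge0// (le_trans ler01).
    rewrite (ger0_norm (addr_ge0 h0 (normr_ge0 K))) ler_norml.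
    apply/andP; split; last by rewrite (le_trans (potle x))// lerDl.
    rewrite (le_trans _ (KP x))// lerNl (le_trans (ler_norm _))// normrN.
    by rewrite lerDr.
  - rewrite (_ : (fun _ => _) =
      (fun x => M%:E * (`|x| + B)%:E) \+ cst (`|K|)%:E)%E//.
    apply: integrableD => //; last exact: finite_measure_integrable_cst.
    by apply: integrableZl => //; exact: integrable_norm_fst.
have idiff : P.-integrable setT (fun x => (`|x| + B - arcs_pot s x / M)%:E).
  rewrite (_ : (fun _ => _) =
    (fun x => (`|x| + B)%:E) \- (fun x => M^-1%:E * (arcs_pot s x)%:E))%E.
    by apply: integrableB => //; [exact: integrable_norm_fst|exact: integrableZl].
  by apply/funext => x; rewrite mulrC.
have gi : (P \x nu)%E.-integrable setT (fun z => gap z.1 z.2).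
  apply/integrable12ltyP => //.
  have -> : (\int[P]_x \int[nu]_y `|gap x y| =
             \int[P]_x (`|x| + B - arcs_pot s x / M)%:E)%E.
    apply: eq_integral => x _; rewrite -int_gap; apply: eq_integral => y _.
    by rewrite gee0_abs.
  exact: integrable_lty.
have [ni nE] := integrable_fst nu integrable_norm_fst.
have [||Fi FE] := @ae_sub_integral _ _ _ (P \x nu)%E (fun z => `|z.1| + B)
   (fun z => lne `|z.1 - z.2|%:E) (fun z => gap z.1 z.2) _ ni gi.
- by apply: measurable_lne_EFin; apply: measurableT_comp => //; exact: measurable_funB.
- exists (setT `*` [set x | B < `|x|]); split.
  + by apply: measurableX => //; exact: measurable_norm_gt.
  + rewrite [LHS]product_measure1E//; last exact: measurable_norm_gt.
    by rewrite [X in (_ * X)%E]arcs_prob_out mule0.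
  + move=> [x y] /= H; split=> //=; rewrite ltNge; apply/negP => yB.
    exact/H/gapE.
split=> //; rewrite FE nE -(integral12_prod_meas1 gi).
have -> : (\int[P]_x fubini_F nu (fun z => gap z.1 z.2) x =
           \int[P]_x (`|x| + B - arcs_pot s x / M)%:E)%E.
  by apply: eq_integral => x _; rewrite -int_gap.
rewrite -integralB//; last exact: integrable_norm_fst.
rewrite muleC -integralZl//; apply: eq_integral => x _.
rewrite /= -EFinB -EFinM; congr EFin; ring.
Qed.

End product_with_arcs.

End arcs_integrals.

(** * Mean of nu and integrability of distances *)

Section certificate.
Variable R : realType.
Local Notation T := (measurableTypeR R).
Local Notation mu := (@lebesgue_measure R).
Local Notation I0pi := (`[0, pi : R]%classic : set R).
Local Notation arc := (arc R).

Section arcs_first_moment.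
Variables (s : seq arc) (B : R).
Hypotheses (M0 : 0 < arcs_mass s) (sB : arcs_in s B).
Local Notation nu := (arcs_prob M0).

(** B - x is nonnegative on the arcs and is truncated elsewhere to fit the nonnegative formula. The
    coordinate m + l cos t then only meets the autocorrelations 0 and 1. *)
Lemma integrable_id_arcs : 1 <= B -> nu.-integrable setT (EFin : T -> \bar R) /\
  (\int[nu]_x x%:E = (arcs_mean s / arcs_mass s)%:E)%E.
Proof.
move=> B1.
pose h (x : R) : \bar R := (Num.max 0 (B - x))%:E.
have mh : measurable_fun (setT : set T) h.
  apply/measurable_EFinP; apply: measurable_maxr => //; exact: measurable_funB.
have h0 x : (0 <= h x)%E by rewrite lee_fin le_max lexx.
have hE : (\int[nu]_x h x = (B - arcs_mean s / arcs_mass s)%:E)%E.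
  rewrite [LHS](ge0_integral_arcs s mh h0).
  have -> : (\sum_(a <- s) \int[mu]_(t in I0pi)
     (h (arc_param (amid a) (arad a) t) * (tpsq (acoef a) t)%:E) =
     (pi * (B * arcs_mass s - arcs_mean s))%:E)%E.
    rewrite /arcs_mass /arcs_mean [(B * _)%R]mulr_sumr -sumrB mulr_sumr -sumEFin.
    rewrite !big_seq; apply: eq_bigr => a /sB[a0 aB].
    have ctp := @continuous_tpsq R (acoef a).
    have ccos n : continuous (fun t : R => cos (n%:R * t)).
      by move=> t; apply: continuous_comp; [exact: mulrl_continuous|exact: continuous_cos].
    have cc n : continuous (fun t : R => tpsq (acoef a) t * cos (n%:R * t)).
      by move=> t; apply: cvgM; [exact: ctp|exact: ccos].
    have cZ k n : continuous (fun t : R => k * (tpsq (acoef a) t * cos (n%:R * t))).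
      by move=> t; apply: cvgM; [exact: cvg_cst|exact: cc].
    transitivity ((Ipi (fun t => (B - amid a) * (tpsq (acoef a) t * cos (0%:R * t)) +
       (- arad a) * (tpsq (acoef a) t * cos (1%:R * t))))%:E); last first.
      rewrite IpiD; [|exact: cZ..].
      by rewrite !IpiZ; [|exact: cc..]; rewrite !Ipi_tpsq_cos; congr EFin; ring.
    rewrite IpiE; last by move=> t; apply: cvgD; exact: cZ.
    apply: eq_integral => t _; rewrite /h -EFinM; congr EFin.
    have tB : arc_param (amid a) (arad a) t <= B.
      by rewrite (le_trans (ler_norm _))// arc_param_le.
    rewrite (max_idPr _) ?subr_ge0// /arc_param mul0r cos0 mul1r; ring.
  rewrite -EFinM; congr EFin.
  have pi0 : pi != 0 :> R by rewrite gt_eqF// pi_gt0.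
  have M0' : arcs_mass s != 0 by rewrite gt_eqF.
  move: (pi : R) pi0 (arcs_mass s) M0' => p p0 M M1.
  by field; rewrite p0 M1.
have hi : nu.-integrable setT (h : T -> \bar R).
  apply/integrableP; split => //.
  by under eq_integral do rewrite gee0_abs ?h0//; rewrite hE ltry.
have [|||ii ->] := @ae_sub_integral _ _ _ nu (fun=> B) (EFin : T -> \bar R) h _ _ hi.
- exact/measurable_EFinP.
- exact: finite_measure_integrable_cst.
- exists [set x : T | B < `|x|]; split.
  + exact: (@measurable_norm_gt R B).
  + exact: (arcs_prob_out M0 sB).
  + move=> y /= H; rewrite ltNge; apply/negP => yB; apply: H.
    have yB' : 0 <= B - y by rewrite subr_ge0 (le_trans (ler_norm _)).
    rewrite /h (max_idPr yB').
    by congr EFin; ring.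
- split=> //; rewrite hE (_ : (fun _ => _) = cst B%:E)// integral_cst//.
  rewrite (_ : _ setT = 1%E); last exact: probability_setT.
  rewrite mule1 -EFinB; congr EFin; ring.
Qed.

Lemma arcs_prob_ge0 : (forall a, a \in s -> arad a <= amid a) ->
  nu (~` `[0, +oo[) = 0%E.
Proof.
move=> sge; apply: (arcs_support sB); first exact: measurableC.
move=> a t ain H; apply: H; rewrite /= in_itv/= andbT.
have [a0 _] := sB ain; rewrite /arc_param -lerBlDl sub0r.
rewrite (@le_trans _ _ (arad a * -1))//; first by rewrite mulrN1 lerN2 sge.
by rewrite ler_pM2l// cos_geN1.
Qed.

End arcs_first_moment.

Lemma integrable_dist (P Q : probability T R) :
  P.-integrable setT (EFin : T -> \bar R) -> Q.-integrable setT (EFin : T -> \bar R) ->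
  (P \x Q)%E.-integrable setT (EFin \o (fun z : T * T => `|z.1 - z.2|)).
Proof.
move=> Pi Qi.
have QT : Q setT = 1%E by exact: probability_setT.
have mf : measurable_fun (setT : set (T * T)) (EFin \o (fun z : T * T => `|z.1 - z.2|)).
  by apply/measurable_EFinP; apply: measurableT_comp => //; exact: measurable_funB.
apply/(integrable12ltyP P Q mf).
have iQ := integrable_abse Qi.
have iQf := integrable_fin_num measurableT iQ.
pose c := (fine (\int[Q]_y `|y%:E|))%E.
have c0 : 0 <= c by apply: fine_ge0; exact: integral_ge0.
have le x : (\int[Q]_y `|(`|x - y|)%:E| <= (`|x| + c)%:E)%E.
  rewrite EFinD fineK//.
  have -> : (`|x|%:E = \int[Q]_y cst `|x|%:E y)%E.
    by rewrite integral_cst//= [X in (_ * X)%E]QT mule1.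
  have mQ : measurable_fun setT (fun y : T => `|y%:E|)%E by case/integrableP: iQ.
  rewrite -ge0_integralD//; last by move=> y _; exact: normr_ge0.
  apply: ge0_le_integral => //.
  - apply: measurableT_comp => //; apply/measurable_EFinP.
    by apply: measurableT_comp => //; exact: measurable_funB.
  - exact: emeasurable_funD.
  - by move=> y _ /=; rewrite normr_id lee_fin ler_normB.
apply: (@le_lt_trans _ _ (\int[P]_x (`|x| + c)%:E)%E).
  apply: ge0_le_integral => //.
  - move=> x _; exact: integral_ge0.
  - apply: (@measurable_fun_fubini_tonelli_F _ _ _ _ _ Q
      (fun z : T * T => `|(`|z.1 - z.2|)%:E|%E)) => //.
    exact: measurableT_comp.
  - by apply/measurable_EFinP; apply: measurable_funD => //; exact: measurableT_comp.
  - by move=> x _; exact: le.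
apply: integrable_lty => //.
rewrite (_ : (fun _ => _) = (abse \o (EFin : T -> \bar R)) \+ cst c%:E)%E//.
apply: integrableD => //; first exact: integrable_abse.
exact: finite_measure_integrable_cst.
Qed.

End certificate.

(** * From field inequalities to bounds on lambda *)

Section certificate_theorem.
Variable R : realType.
Local Notation T := (measurableTypeR R).
Local Notation arc := (arc R).
Variables (A : {fset {poly int}}) (rts : {poly int} -> seq R) (wt : {poly int} -> R).
Variables (s : seq arc) (B Lam : R).
Hypotheses (M0 : 0 < arcs_mass s) (sB : arcs_in s B) (B1 : 1 <= B).
Hypothesis rtsP : forall Q, Q \in A ->
  map_poly intr Q = \prod_(r <- rts Q) ('X - r%:P) :> {poly R}.
Hypothesis Lam0 : 0 < Lam.
Local Notation nu := (arcs_prob M0).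
Let L (Q : {poly int}) (x : R) : \bar R := lne `|(map_poly intr Q).[x]|%:E.

Let LE Q x : Q \in A -> L Q x = (\sum_(r <- rts Q) lne `|x - r|%:E)%E.
Proof.
move=> QA; rewrite /L rtsP// horner_prod.
by under eq_bigr do rewrite hornerXsubC; exact: lne_prod.
Qed.

Definition cert_rhs (c x : R) : R := c + Lam * arcs_pot s x +
  \sum_(Q <- A) wt Q * \sum_(r <- rts Q) ln `|x - r|.

(** The extended version is the one integrated. [cert_rhs] uses the real [ln], which is 0 at 0, so
    agreement is claimed only off the roots. *)
Let rhs (c : R) (x : R) : \bar R := (c%:E + Lam%:E * (arcs_pot s x)%:E +
  \sum_(Q <- A) (wt Q)%:E * L Q x)%E.

Let LfinP Q x : Q \in A -> L Q x \is a fin_num -> x \notin rts Q.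
Proof.
move=> QA; apply: contraTN => xr; rewrite /L rtsP//.
have /rootP -> : root (\prod_(r <- rts Q) ('X - r%:P)) x by rewrite root_prod_XsubC.
by rewrite normr0 /= lexx.
Qed.

Let Lfin Q x : Q \in A -> x \notin rts Q -> L Q x = (\sum_(r <- rts Q) ln `|x - r|)%:E.
Proof.
move=> QA xr; rewrite LE// -sumEFin !big_seq; apply: eq_bigr => r rr.
rewrite lne_EFin// normr_gt0 subr_eq0; apply: contraNneq xr => ->; exact: rr.
Qed.

Let rhsE c x : (forall Q, Q \in A -> x \notin rts Q) -> rhs c x = (cert_rhs c x)%:E.
Proof.
move=> xr; rewrite /rhs /cert_rhs !EFinD EFinM; congr (_ + _)%E.
rewrite -sumEFin !big_seq; apply: eq_bigr => Q QA; rewrite Lfin ?EFinM//; exact: xr.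
Qed.

Section integrate.
Variable P : probability T R.
Hypothesis Pi : P.-integrable setT (EFin : T -> \bar R).
Hypothesis Li : forall Q, Q \in A -> P.-integrable setT (L Q : T -> \bar R).

Let pi_pot : P.-integrable setT (fun x : T => (arcs_pot s x)%:E).
Proof. by have [_ + _] := integrable_lne_arcs_prod M0 sB B1 Pi. Qed.

Let AL_int : P.-integrable setT (fun x : T => \sum_(Q <- A) (wt Q)%:E * L Q x)%E.
Proof.
under eq_fun do rewrite big_seq.
by apply: integrable_sum => // Q QA; apply: integrableZl => //; exact: Li.
Qed.

Let rhs_int c : P.-integrable setT (rhs c : T -> \bar R).
Proof.
apply: (@integrableD _ _ _ P _ measurableT _ _ _ AL_int).
apply: (@integrableD _ _ _ P _ measurableT (cst c%:E)).
  exact: finite_measure_integrable_cst.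
exact: integrableZl.
Qed.

Let integral_rhs c : (\int[P]_x rhs c x = c%:E + Lam%:E * \int[P]_x (arcs_pot s x)%:E
  + \sum_(Q <- A) (wt Q)%:E * log_integral P Q)%E.
Proof.
have cint : P.-integrable setT (cst c%:E : T -> \bar R).
  exact: finite_measure_integrable_cst.
have pint : P.-integrable setT (fun x : T => Lam%:E * (arcs_pot s x)%:E)%E.
  exact: integrableZl.
rewrite (@integralD _ _ _ P _ measurableT _ _ (integrableD measurableT cint pint) AL_int).
rewrite (@integralD _ _ _ P _ measurableT _ _ cint pint) integralZl//.
rewrite integral_cst// (_ : _ setT = 1%E); last exact: probability_setT.
rewrite mule1; congr (_ + _)%E.
have fi Q : P.-integrable setT
    (fun x : T => if Q \in A then (wt Q)%:E * L Q x else 0)%E.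
  by case: (boolP (Q \in A)) => QA; [apply: integrableZl => //; exact: Li|exact: integrable0].
transitivity (\int[P]_x \sum_(Q <- A)
    (if Q \in A then (wt Q)%:E * L Q x else 0))%E.
  by apply: eq_integral => x _; apply: eq_big_seq => Q ->.
rewrite (@integral_sum _ _ _ P _ measurableT _ _ fi).
apply: eq_big_seq => Q QA; rewrite -[RHS]integralZl//; last exact: Li.
by apply: eq_integral => x _; rewrite QA.
Qed.

(** An integrable log |Q| is finite almost everywhere, so the roots carry no mass and field
    inequalities are only needed off them. *)
Let ae_notin : {ae P, forall x : T, forall Q, Q \in A -> x \notin rts Q}.
Proof.
have H Q : Q \in A -> {ae P, forall x : T, x \notin rts Q}.
  move=> QA; have := integrable_ae measurableT (Li QA).
  by apply: filterS => x /(_ Logic.I); exact: LfinP.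
have : {ae P, forall x : T, all (fun Q => x \notin rts Q) (enum_fset A)}.
  have {}H : forall Q, Q \in enum_fset A -> {ae P, forall x : T, x \notin rts Q}.
    by move=> Q QA; exact: H.
  elim: (enum_fset A) H => [|Q l IH] H; first exact: nearW.
  have h1 := H Q (mem_head _ _).
  have h2 := IH (fun Q' Q'l => H Q' (@mem_behead _ (Q :: l) _ Q'l)).
  by near=> x; apply/andP; split; near: x.
by apply: filterS => x /allP H' Q QA; exact: H'.
Unshelve. all: by end_near.
Qed.

Lemma cert_lower c : P (~` `[0, +oo[) = 0%E ->
  (forall x, 0 <= x -> (forall Q, Q \in A -> x \notin rts Q) -> cert_rhs c x <= x) ->
  (c%:E + Lam%:E * \int[P]_x (arcs_pot s x)%:E
  + \sum_(Q <- A) (wt Q)%:E * log_integral P Q <= \int[P]_x x%:E)%E.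
Proof.
move=> P0 H; rewrite -integral_rhs; apply: ae_le_integral => //.
have x0 : {ae P, forall x : T, 0 <= x}.
  exists (~` `[0, +oo[); split => //; first exact: measurableC.
  by move=> x /= x0; rewrite in_itv/= andbT.
by apply: filterS2 x0 ae_notin => x x0 xr; rewrite rhsE// lee_fin H.
Qed.

Lemma cert_upper c (S : set T) : measurable S -> P (~` S) = 0%E ->
  (forall x, S x -> (forall Q, Q \in A -> x \notin rts Q) -> x <= cert_rhs c x) ->
  (\int[P]_x x%:E <= c%:E + Lam%:E * \int[P]_x (arcs_pot s x)%:E
  + \sum_(Q <- A) (wt Q)%:E * log_integral P Q)%E.
Proof.
move=> mS P0 H; rewrite -integral_rhs; apply: ae_le_integral => //.
have x0 : {ae P, forall x : T, S x} by exists (~` S); split => //; exact: measurableC.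
by apply: filterS2 x0 ae_notin => x x0 xr; rewrite rhsE// lee_fin H.
Qed.

End integrate.

(** As |x - r| = |r - x|, integrating log |Q| against nu evaluates the potential at the roots of Q:
    admissibility of nu for Q becomes a sign condition on finitely many numbers. *)
Let L_arcs Q : Q \in A -> nu.-integrable setT (L Q : T -> \bar R) /\
  log_integral nu Q = ((\sum_(r <- rts Q) arcs_pot s r) / arcs_mass s)%:E.
Proof.
move=> QA; have E : L Q = (fun x => \sum_(r <- rts Q) lne `|r - x|%:E)%E.
  by apply/funext => x; rewrite LE//; apply: eq_bigr => r _; rewrite distrC.
have Ji r := (integrable_lne_arcs M0 sB B1 r).1.
split; first by rewrite E; apply: integrable_sum => // r _; exact: Ji.
rewrite [LHS](_ : _ = \int[nu]_x L Q x)%E// E.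
rewrite (@integral_sum _ _ _ nu _ measurableT _ _ Ji).
rewrite mulr_suml -sumEFin; apply: eq_bigr => r _.
exact: (integrable_lne_arcs M0 sB B1 r).2.
Qed.

Hypothesis wt0 : forall Q, 0 <= wt Q.
Hypothesis s0 : forall a, a \in s -> arad a <= amid a.

Let measurable_arc_union : measurable (\big[setU/set0]_(a <- s) `[amid a - arad a, amid a + arad a]%classic : set T).
Proof. by apply: bigsetU_measurable => a _; exact: measurable_itv. Qed.

(** Integrating the upper field inequality over nu gives mean <= gam + Lam E + (weighted root
    potentials) / mass, where E is the integral of [arcs_pot] and I(nu) = E / mass. The hypothesis
    on the mean then leaves Lam E >= 0. *)
Lemma mean_nu_energy gam :
  (forall a x, a \in s -> `|x - amid a| <= arad a ->
    (forall Q, Q \in A -> x \notin rts Q) -> x <= cert_rhs gam x) ->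
  gam * arcs_mass s + \sum_(Q <- A) wt Q * \sum_(r <- rts Q) arcs_pot s r <= arcs_mean s ->
  (0 <= log_energy nu)%E.
Proof.
move=> up mean.
have [idi meanE] := integrable_id_arcs M0 sB B1.
have [Fi poti FE] := integrable_lne_arcs_prod M0 sB B1 idi.
rewrite /log_energy FE mule_ge0 ?lee_fin ?invr_ge0 ?(ltW M0)//.
have := @cert_upper nu idi (fun Q QA => (L_arcs QA).1) gam _ measurable_arc_union.
have [E ->] : exists E, (\int[nu]_x (arcs_pot s x)%:E = E%:E)%E.
  exists (fine (\int[nu]_x (arcs_pot s x)%:E)%E).
  by rewrite fineK//; exact: integrable_fin_num.
rewrite meanE.
have -> : (\sum_(Q <- A) (wt Q)%:E * log_integral nu Q =
  ((\sum_(Q <- A) wt Q * \sum_(r <- rts Q) arcs_pot s r) / arcs_mass s)%:E)%E.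
  rewrite mulr_suml -sumEFin !big_seq; apply: eq_bigr => Q QA.
  by rewrite (L_arcs QA).2 -EFinM mulrA.
rewrite -EFinM -!EFinD !lee_fin => H.
have {H} : arcs_mean s / arcs_mass s <=
  gam + Lam * E + (\sum_(Q <- A) wt Q * (\sum_(r <- rts Q) arcs_pot s r)) / arcs_mass s.
  apply: H.
    apply: (arcs_support sB); first exact: measurableC measurable_arc_union.
    move=> a t ain; apply; rewrite -bigcup_seq; exists a => //=.
    have [a0 _] := sB ain; rewrite in_itv/= /arc_param lerD2l.
    by rewrite -mulrN1 ler_pM2l// cos_geN1 lerD2l ler_piMr ?(ltW a0) ?cos_le1.
  move=> x; rewrite -bigcup_seq => -[a ain /=]; rewrite in_itv/= => ax xr.
  by apply: (up a) => //; rewrite ler_distl.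
rewrite ler_pdivrMr// !mulrDl mulfVK ?gt_eqF// => H.
have : 0 <= Lam * E * arcs_mass s.
  by move: mean H; move: (arcs_mean s) (gam * _) (Lam * E * _) (\sum_(_ <- _) _) => a b c e; lra.
by rewrite pmulr_lge0// pmulr_rge0.
Qed.

Theorem arcs_certificate c gam hi :
  (forall x, 0 <= x -> (forall Q, Q \in A -> x \notin rts Q) -> cert_rhs c x <= x) ->
  (forall a x, a \in s -> `|x - amid a| <= arad a ->
    (forall Q, Q \in A -> x \notin rts Q) -> x <= cert_rhs gam x) ->
  (forall Q, Q \in A -> 0 <= \sum_(r <- rts Q) arcs_pot s r) ->
  gam * arcs_mass s + \sum_(Q <- A) wt Q * \sum_(r <- rts Q) arcs_pot s r <= arcs_mean s ->
  arcs_mean s <= hi * arcs_mass s ->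
  (c%:E <= lambda R A <= hi%:E)%E.
Proof.
move=> low up pot0 mean meanhi; have Enu := mean_nu_energy up mean.
have [idi meanE] := integrable_id_arcs M0 sB B1.
have [Fi poti FE] := integrable_lne_arcs_prod M0 sB B1 idi.
apply/andP; split; last first.
  apply: (@le_trans _ _ (\int[nu]_x x%:E)%E).
    apply: ereal_inf_lbound; exists nu => //; split => //.
      exact: (arcs_prob_ge0 M0 sB s0).
    move=> Q QA; rewrite (L_arcs QA).2 lee_fin mulr_ge0 ?invr_ge0 ?(ltW M0)//.
    exact: pot0.
  by rewrite meanE lee_fin ler_pdivrMr.
apply: le_ereal_inf_tmp => _ [m [m0 mE mL] <-].
have x0 : {ae m, forall x : T, 0 <= x}.
  exists (~` `[0, +oo[); split => //; first exact: measurableC.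
  by move=> x /= x0; rewrite in_itv/= andbT.
(* With infinite mean the lower bound is immediate; a finite first moment is what every
   integrability statement below consumes. *)
have [mfin|minf] := ltP (\int[m]_x `|(x : R)%:E|)%E +oo%E; last first.
  have -> : (\int[m]_x x%:E = \int[m]_x `|x%:E|)%E.
    have mid : measurable_fun (setT : set T) (EFin : T -> \bar R) by exact/measurable_EFinP.
    have mabs : measurable_fun (setT : set T) (fun x : T => `|(x : R)%:E|)%E.
      exact: measurableT_comp.
    apply: ae_eq_integral => //.
    by apply: filterS x0 => x x0 _; rewrite gee0_abs.
  by move: minf; rewrite leye_eq => /eqP ->; exact: leey.
have mi : m.-integrable setT (EFin : T -> \bar R).
  by apply/integrableP; split => //; exact/measurable_EFinP.
have [Fmi potmi FmE] := integrable_lne_arcs_prod M0 sB B1 mi.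
have Lmi Q : Q \in A -> m.-integrable setT (L Q : T -> \bar R).
  move=> QA; apply: (@integrable_of_ge0 _ _ _ m _
    (fun x => \sum_(r <- rts Q) (`|x%:E| + cst (`|r|)%:E x))%E).
  - rewrite (_ : L Q = fun x => \sum_(r <- rts Q) lne `|r - x|%:E)%E.
      apply: emeasurable_fun_sum => r. exact: measurable_lne_dist.
    by apply/funext => x; rewrite LE//; apply: eq_bigr => r _; rewrite distrC.
  - apply: integrable_sum => // r _; apply: integrableD => //.
      exact: integrable_abse.
    exact: finite_measure_integrable_cst.
  - move=> x; rewrite LE//; apply: lee_sum => r _.
    by rewrite (le_trans (lne_le_norm _))// lee_fin ler_normB.
  - exact: mL.
have Fm : (m \x m)%E.-integrable setT (fun z => lne `|z.1 - z.2|%:E).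
  apply: (@integrable_of_ge0 _ _ _ (m \x m)%E _ _ _ (integrable_dist mi mi)) => //.
  - apply: measurable_lne_EFin; apply: measurableT_comp => //; exact: measurable_funB.
  - by move=> z; exact: lne_le_norm.
(* Both energies are nonnegative, so twice the mutual energy of m and nu is too: the potential has
   nonnegative integral against every admissible m of finite mean. *)
have := log_energy_ineq Fm Fmi Fi (integrable_dist mi mi) (integrable_dist mi idi)
  (integrable_dist idi idi).
move=> /(le_trans (adde_ge0 mE Enu)); rewrite FmE.
have [E EE] : exists E, (\int[m]_x (arcs_pot s x)%:E = E%:E)%E.
  exists (fine (\int[m]_x (arcs_pot s x)%:E)%E).
  by rewrite fineK//; exact: integrable_fin_num.
rewrite EE -EFinM -EFinD lee_fin => E0.
have {}E0 : 0 <= E.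
  by rewrite -(pmulr_lge0 E (_ : 0 < (arcs_mass s)^-1)) ?invr_gt0//; move: E0; lra.
have := cert_lower mi Lmi m0 low; apply: le_trans.
rewrite EE -addeA leeDl// -EFinM adde_ge0 ?lee_fin ?mulr_ge0 ?(ltW Lam0)//.
by rewrite big_seq; apply: sume_ge0 => Q QA; rewrite mule_ge0 ?lee_fin//; exact: mL.
Qed.

End certificate_theorem.

(** * Cosine expansions on an arc, point charges, and convexity in gaps *)

Section real_estimates.
Variable R : realType.
Local Notation mu := (@lebesgue_measure R).
Local Notation I0pi := (`[0, pi : R]%classic : set R).
Implicit Types (m l x y w : R) (P : seq R).

Definition unjouk m l w : R := m + l * ((w + w^-1) / 2).

Lemma ln_dist_unjouk m l w phi : 0 < l -> 0 < `|w| < 1 ->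
  ln `|m + l * cos phi - unjouk m l w| =
  ln (l / (2 * `|w|)) + ln (1 - 2 * w * cos phi + w ^+ 2).
Proof.
move=> l0 /andP[w0 w1].
have d0 := poisson_denom_gt0 phi w1.
have c0 : 0 < l / (2 * `|w|) by rewrite divr_gt0// mulr_gt0.
rewrite -lnM ?posrE//; congr ln.
have wn : w != 0 by rewrite -normr_gt0.
have -> : m + l * cos phi - unjouk m l w =
    - (l / (2 * w) * (1 - 2 * w * cos phi + w ^+ 2)) by rewrite /unjouk; field.
rewrite normrN normrM (gtr0_norm d0); congr (_ * _).
by rewrite normrM normfV normrM (gtr0_norm l0) ger0_norm.
Qed.

Lemma acos_param m l x : 0 < l -> `|x - m| <= l ->
  m + l * cos (acos ((x - m) / l)) = x.
Proof.
move=> l0 xl; rewrite acosK; last first.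
  by rewrite in_itv/= -ler_norml normrM normfV (gtr0_norm l0) ler_pdivrMr ?mul1r.
by rewrite mulrC mulfVK ?gt_eqF// addrC subrK.
Qed.

Lemma acosP (z : R) : `|z| <= 1 -> cos (acos z) = z.
Proof. by move=> z1; rewrite acosK// in_itv/= -ler_norml. Qed.

(** Up to the factor 2 / (n+1), the cosine coefficient of order n+1 on the arc of the field: the
    arc's own density, the charges of weight a.1 with Joukowski parameter a.2, and x = m + l cos phi
    itself, seen only at order 1. A field constant on the arc has all of them zero. *)
Definition arc_coef P l Lam (at_ : seq (R * R)) n : R :=
  Lam * autocorr P n.+1 + \sum_(a <- at_) a.1 * a.2 ^+ n.+1 + (n == 0)%:R * (l / 2).

Definition arc_tail (at_ : seq (R * R)) M : R :=
  \sum_(a <- at_) a.1 * (4 * `|a.2| ^+ M.+1 / (1 - `|a.2|) ^+ 2).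

Lemma arc_expansion m l P Lam (at_ : seq (R * R)) M x : 0 < l -> (size P <= M)%N ->
  (0 < M)%N -> (forall a, a \in at_ -> 0 <= a.1 /\ 0 < `|a.2| < 1) -> `|x - m| <= l ->
  `|x - Lam * itv_pot m l P x - \sum_(a <- at_) a.1 * ln `|x - unjouk m l a.2| -
    (m - Lam * (autocorr P 0 * ln (l / 2)) - \sum_(a <- at_) a.1 * ln (l / (2 * `|a.2|))) -
    \sum_(n < M) 2 / n.+1%:R * arc_coef P l Lam at_ n * cos (n.+1%:R * acos ((x - m) / l))|
  <= arc_tail at_ M.
Proof.
move=> l0 PM M0 atP xl; rewrite /itv_pot xl /pot_in; set phi := acos _.
have xE : x = m + l * cos phi by rewrite acos_param.
have -> : \sum_(n < size P) 2 * cos (n.+1%:R * phi) * autocorr P n.+1 / n.+1%:R =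
   \sum_(n < M) 2 * cos (n.+1%:R * phi) * autocorr P n.+1 / n.+1%:R.
  rewrite (big_ord_widen M (fun n => 2 * cos (n.+1%:R * phi) * autocorr P n.+1 / n.+1%:R))//.
  rewrite big_mkcond; apply: eq_bigr => n _; case: ltnP => // Pn.
  by rewrite autocorr_default ?mulr0 ?mul0r// leqW.
have -> : \sum_(a <- at_) a.1 * ln `|x - unjouk m l a.2| =
   \sum_(a <- at_) a.1 * ln (l / (2 * `|a.2|)) +
   \sum_(a <- at_) a.1 * ln (1 - 2 * a.2 * cos phi + a.2 ^+ 2).
  rewrite -big_split !big_seq; apply: eq_bigr => a /atP[_ a2].
  by rewrite xE ln_dist_unjouk//= mulrDr.
have -> : \sum_(n < M) 2 / n.+1%:R * arc_coef P l Lam at_ n * cos (n.+1%:R * phi) =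
   Lam * (\sum_(n < M) 2 * cos (n.+1%:R * phi) * autocorr P n.+1 / n.+1%:R) +
   \sum_(a <- at_) a.1 * (\sum_(n < M) 2 * a.2 ^+ n.+1 * cos (n.+1%:R * phi) / n.+1%:R) +
   l * cos phi.
  have -> : l * cos phi = \sum_(n < M) 2 / n.+1%:R * ((n == 0%N :> nat)%:R * (l / 2)) *
       cos (n.+1%:R * phi).
    rewrite -(prednK M0) big_ord_recl big1 => [|i _]; last by rewrite mul0r mulr0 mul0r.
    by rewrite /= mul1r mul1r addr0 divr1; field.
  rewrite mulr_sumr; under [X in _ = _ + X + _]eq_bigr do rewrite mulr_sumr.
  rewrite exchange_big -!big_split; apply: eq_bigr => n _ /=.
  have E (u a b c v : R) : u * (a + b + c) * v = u * a * v + u * b * v + u * c * v by ring.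
  rewrite /arc_coef E; congr (_ + _ + _).
    by field; rewrite nat1r pnatr_eq0.
  rewrite mulr_sumr mulr_suml; apply: eq_bigr => a _.
  by field; rewrite nat1r pnatr_eq0.
set s1 := \sum_(n < M) _; set s2 := \sum_(a <- _) _ * ln (l / _).
set s3 := \sum_(a <- _) _ * ln (1 - _ + _); set s4 := \sum_(a <- _) _ * \sum_(_ < _) _.
have -> : x - Lam * (autocorr P 0 * ln (l / 2) - s1) - (s2 + s3) -
   (m - Lam * (autocorr P 0 * ln (l / 2)) - s2) - (Lam * s1 + s4 + l * cos phi) =
   - (s3 + s4) by rewrite {1}xE; ring.
rewrite normrN /s3 /s4 -big_split (le_trans (ler_norm_sum _ _ _))//.
rewrite /arc_tail !big_seq; apply: ler_sum => a /atP[a1 /andP[_ a2]].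
by rewrite /= -mulrDr normrM (ger0_norm a1) ler_wpM2l// ln_poisson_series.
Qed.

(** The constant term of the expansion cancels between the two points. The factor 4 is the 2 of the
    series taken at two points with |cos| <= 1. *)
Lemma arc_oscillation m l P Lam (at_ : seq (R * R)) M x x' : 0 < l -> (size P <= M)%N ->
  (0 < M)%N -> (forall a, a \in at_ -> 0 <= a.1 /\ 0 < `|a.2| < 1) ->
  `|x - m| <= l -> `|x' - m| <= l ->
  `|(x - Lam * itv_pot m l P x - \sum_(a <- at_) a.1 * ln `|x - unjouk m l a.2|) -
    (x' - Lam * itv_pot m l P x' - \sum_(a <- at_) a.1 * ln `|x' - unjouk m l a.2|)|
  <= \sum_(n < M) 4 / n.+1%:R * `|arc_coef P l Lam at_ n| + 2 * arc_tail at_ M.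
Proof.
move=> l0 PM M0 atP xl xl'.
pose H y := y - Lam * itv_pot m l P y - \sum_(a <- at_) a.1 * ln `|y - unjouk m l a.2|.
move: (arc_expansion Lam l0 PM M0 atP xl) (arc_expansion Lam l0 PM M0 atP xl').
rewrite -/(H x) -/(H x'); set C := m - _ - _.
have S y : `|\sum_(n < M) 2 / n.+1%:R * arc_coef P l Lam at_ n * cos (n.+1%:R * y)| <=
   \sum_(n < M) 2 / n.+1%:R * `|arc_coef P l Lam at_ n|.
  rewrite (le_trans (ler_norm_sum _ _ _))//; apply: ler_sum => n _.
  rewrite normrM normrM (ger0_norm (_ : 0 <= 2 / n.+1%:R)) ?divr_ge0// ler_piMr ?mulr_ge0 ?divr_ge0//.
  by rewrite ler_norml cos_geN1 cos_le1.
have := S (acos ((x - m) / l)); have := S (acos ((x' - m) / l)).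
set u := \sum_(_ < _) _ * cos _; set v := \sum_(_ < _) _ * `|_|; set u' := \sum_(_ < _) _ * cos _.
have -> : \sum_(n < M) 4 / n.+1%:R * `|arc_coef P l Lam at_ n| = 2 * v.
  rewrite /v mulr_sumr; apply: eq_bigr => n _; rewrite !mulrA; congr (_ / _ * _).
  by rewrite -natrM.
move: u v u' (H x) (H x') C (arc_tail at_ M) => u v u' h h' C' t.
rewrite !ler_norml => /andP[h1 h2] /andP[h3 h4] /andP[h5 h6] /andP[h7 h8].
by move: h1 h2 h3 h4 h5 h6 h7 h8; clear; move=> *; apply/andP; split; lra.
Qed.

(** Replaces an arc seen from outside by point charges. Equal masses cancel the leading logarithms;
    the order n terms differ by the discrepancy of the cosine moments, damped by rho^n. Only the
    charges have terms beyond order N, hence the tail. *)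
Lemma far_field l P w rho N (nd : seq (R * R)) : 0 < `|w| -> `|w| <= rho -> rho < 1 ->
  (size P <= N)%N -> (forall a, a \in nd -> 0 <= a.1 /\ `|a.2| <= 1) ->
  \sum_(a <- nd) a.1 = autocorr P 0 ->
  `|pot_out l P w -
    \sum_(a <- nd) a.1 * (ln (l / (2 * `|w|)) + ln (1 - 2 * w * a.2 + w ^+ 2))| <=
  \sum_(n < N) 2 / n.+1%:R * rho ^+ n.+1 *
     `|\sum_(a <- nd) a.1 * cos (n.+1%:R * acos a.2) - autocorr P n.+1| +
  autocorr P 0 * (4 * rho ^+ N.+1 / (1 - rho) ^+ 2).
Proof.
move=> w0 wr r1 PN ndP sumW; rewrite /pot_out.
have w1 : `|w| < 1 by exact: le_lt_trans r1.
have -> : \sum_(n < size P) 2 * w ^+ n.+1 * autocorr P n.+1 / n.+1%:R =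
   \sum_(n < N) 2 * w ^+ n.+1 * autocorr P n.+1 / n.+1%:R.
  rewrite (big_ord_widen N (fun n => 2 * w ^+ n.+1 * autocorr P n.+1 / n.+1%:R))//.
  rewrite big_mkcond; apply: eq_bigr => n _; case: ltnP => // Pn.
  by rewrite autocorr_default ?mulr0 ?mul0r// leqW.
have -> : \sum_(a <- nd) a.1 * (ln (l / (2 * `|w|)) + ln (1 - 2 * w * a.2 + w ^+ 2)) =
   autocorr P 0 * ln (l / (2 * `|w|)) +
   \sum_(a <- nd) a.1 * (ln (1 - 2 * w * cos (acos a.2) + w ^+ 2) +
      \sum_(n < N) 2 * w ^+ n.+1 * cos (n.+1%:R * acos a.2) / n.+1%:R) -
   \sum_(n < N) 2 / n.+1%:R * w ^+ n.+1 * \sum_(a <- nd) a.1 * cos (n.+1%:R * acos a.2).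
  under [X in _ - X]eq_bigr do rewrite mulr_sumr.
  rewrite exchange_big/= -sumW mulr_suml -addrA -sumrB -big_split !big_seq.
  apply: eq_bigr => a /ndP[_ a2] /=; rewrite acosP//.
  rewrite [X in _ = _ + (_ * (_ + X) - _)](_ : _ =
     \sum_(n < N) 2 / n.+1%:R * w ^+ n.+1 * cos (n.+1%:R * acos a.2)); last first.
    by apply: eq_bigr => n _; field; rewrite nat1r pnatr_eq0.
  rewrite [X in _ = _ + (_ - X)](_ : _ =
     a.1 * \sum_(n < N) 2 / n.+1%:R * w ^+ n.+1 * cos (n.+1%:R * acos a.2)); last first.
    by rewrite mulr_sumr; apply: eq_bigr => n _; ring.
  by ring.
set s1 := \sum_(n < N) _; set s2 := \sum_(a <- nd) _; set s3 := \sum_(n < N) _ * \sum_(_ <- _) _.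
have -> : autocorr P 0 * ln (l / (2 * `|w|)) - s1 - (autocorr P 0 * ln (l / (2 * `|w|)) + s2 - s3) =
  (s3 - s1) - s2 by ring.
rewrite (le_trans (ler_normB _ _))// lerD//.
  rewrite /s3 /s1 -sumrB (le_trans (ler_norm_sum _ _ _))//; apply: ler_sum => n _.
  rewrite [X in `|X|](_ : _ = 2 / n.+1%:R * w ^+ n.+1 *
    (\sum_(a <- nd) a.1 * cos (n.+1%:R * acos a.2) - autocorr P n.+1)); last first.
    by field; rewrite nat1r pnatr_eq0.
  rewrite normrM ler_wpM2r// normrM ger0_norm ?divr_ge0// ler_wpM2l ?divr_ge0//.
  by rewrite normrX lerXn2r ?nnegrE// (le_trans _ wr).
rewrite /s2 (le_trans (ler_norm_sum _ _ _))// -sumW mulr_suml !big_seq; apply: ler_sum => a /ndP[a1 _].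
rewrite normrM (ger0_norm a1) ler_wpM2l// (le_trans (ln_poisson_series _ _ w1))//.
have r1' : 0 < 1 - rho by rewrite subr_gt0.
have w1' : 0 < 1 - `|w| by rewrite subr_gt0.
rewrite -!mulrA ler_wpM2l//; apply: ler_pM; rewrite ?exprn_ge0 ?invr_ge0 ?exprn_ge0 ?(ltW w1')//.
  by rewrite lerXn2r ?nnegrE// (le_trans _ wr).
by rewrite lef_pV2 ?posrE ?exprn_gt0// lerXn2r ?nnegrE ?(ltW r1') ?(ltW w1')// lerD2l lerN2.
Qed.

(** Both tangent inequalities ln u <= u - 1, at p/t and q/t for the intermediate value t, are
    averaged; the right sides add up to 0. *)
Lemma ln_concave (p q s : R) : 0 < p -> 0 < q -> 0 < s < 1 ->
  (1 - s) * ln p + s * ln q <= ln ((1 - s) * p + s * q).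
Proof.
move=> p0 q0 /andP[s0 s1]; set t := (1 - s) * p + s * q.
have s1' : 0 < 1 - s by rewrite subr_gt0.
have t0 : 0 < t by rewrite addr_gt0// mulr_gt0.
have h1 : ln (p / t) <= p / t - 1 by apply: ln_le_sub1; rewrite divr_gt0.
have h2 : ln (q / t) <= q / t - 1 by apply: ln_le_sub1; rewrite divr_gt0.
move: h1 h2; rewrite !ln_div ?posrE// => h1 h2.
have := lerD (ler_wpM2l (ltW s1') h1) (ler_wpM2l (ltW s0) h2).
have -> : (1 - s) * (p / t - 1) + s * (q / t - 1) = 0.
  have -> : (1 - s) * (p / t - 1) + s * (q / t - 1) = t / t - 1 by rewrite {3}/t; ring.
  by rewrite divff ?subrr// gt_eqF.
move: (ln p) (ln q) (ln t) => a b c; clear; lra.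
Qed.

(** Extended values are needed because a gap starts at the edge of an arc, where x0 may coincide
    with the charge y. *)
Lemma lne_concave (x0 x2 y s C : R) : 0 < s < 1 ->
  (y <= x0 /\ y <= x2) \/ (x0 <= y /\ x2 <= y) ->
  (C%:E - lne `|(1 - s) * x0 + s * x2 - y|%:E <=
   (1 - s)%:E * (C%:E - lne `|x0 - y|%:E) + s%:E * (C%:E - lne `|x2 - y|%:E))%E.
Proof.
move=> s01 side; have /andP[s0 s1] := s01; have s1' : 0 < 1 - s by rewrite subr_gt0.
have E : `|(1 - s) * x0 + s * x2 - y| = (1 - s) * `|x0 - y| + s * `|x2 - y|.
  have -> : (1 - s) * x0 + s * x2 - y = (1 - s) * (x0 - y) + s * (x2 - y) by ring.
  case: side => -[h0 h2].
    have a0 : 0 <= x0 - y by rewrite subr_ge0.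
    have a2 : 0 <= x2 - y by rewrite subr_ge0.
    by rewrite (ger0_norm a0) (ger0_norm a2) ger0_norm// addr_ge0// mulr_ge0// ltW.
  have a0 : 0 <= y - x0 by rewrite subr_ge0.
  have a2 : 0 <= y - x2 by rewrite subr_ge0.
  rewrite (distrC x0) (distrC x2) (ger0_norm a0) (ger0_norm a2) -normrN.
  rewrite (_ : - _ = (1 - s) * (y - x0) + s * (y - x2)); last by ring.
  by rewrite ger0_norm// addr_ge0// mulr_ge0// ltW.
rewrite E.
have [p0|p0] := leP `|x0 - y| 0.
  rewrite [X in (_ * (_ - X) + _)%E](_ : _ = -oo)%E; last by rewrite /= p0.
  rewrite [(C%:E - -oo)%E]/= gt0_muley ?lte_fin//.
  rewrite addye ?leey// gt_eqF//.
  have [q0|q0] := leP `|x2 - y| 0.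
    by rewrite [X in (_ * (_ - X))%E](_ : _ = -oo)%E /= ?q0// gt0_muley ?lte_fin.
  by rewrite (lne_EFin q0) -EFinB -EFinM ltNyr.
have [q0|q0] := leP `|x2 - y| 0.
  rewrite [X in (_ + _ * (_ - X))%E](_ : _ = -oo)%E; last by rewrite /= q0.
  rewrite [(C%:E - -oo)%E]/= gt0_muley ?lte_fin//.
  by rewrite (lne_EFin p0) -EFinB -EFinM addey ?leey.
have t0 : 0 < (1 - s) * `|x0 - y| + s * `|x2 - y| by rewrite addr_gt0// mulr_gt0.
rewrite !lne_EFin// -!EFinB -!EFinM -EFinD lee_fin.
have := ln_concave p0 q0 s01.
move: (ln `|x0 - y|) (ln `|x2 - y|) (ln _) => a b c h.
by move: h; clear; nra.
Qed.

(** Concavity of each x -> log |x - y| on one side of y is integrated over the arc, which avoids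
    differentiating the Joukowski form. C is large enough to make the integrands at all three points
    nonnegative. *)
Lemma itv_pot_concave m l P x0 x2 s : 0 < l -> 0 < s < 1 ->
  (m + l <= x0 /\ m + l <= x2) \/ (x0 <= m - l /\ x2 <= m - l) ->
  (1 - s) * itv_pot m l P x0 + s * itv_pot m l P x2 <= itv_pot m l P ((1 - s) * x0 + s * x2).
Proof.
move=> l0 s01 side; have /andP[s0 s1] := s01; have s1' : 0 < 1 - s by rewrite subr_gt0.
set x := (1 - s) * x0 + s * x2.
pose C := `|x0| + `|x2| + `|m| + l.
have xi (t : R) : -1 <= cos t <= 1 by rewrite cos_geN1 cos_le1.
have yl (t : R) : `|m + l * cos t| <= `|m| + l.
  rewrite (le_trans (ler_normD _ _))// lerD2l normrM (gtr0_norm l0) ler_piMr ?(ltW l0)//.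
  by rewrite ler_norml xi.
have pos z (t : R) : `|z| <= `|x0| + `|x2| -> (0 <= C%:E - lne `|z - (m + l * cos t)|%:E)%E.
  move=> zx; rewrite sube_ge0 ?orbT// (le_trans (ltW (lne_sublinear _)))// lee_fin.
  by rewrite (le_trans (ler_normB _ _))// /C -addrA lerD.
have n0 : `|x0| <= `|x0| + `|x2| by rewrite lerDl.
have n2 : `|x2| <= `|x0| + `|x2| by rewrite lerDr.
have nx : `|x| <= `|x0| + `|x2|.
  rewrite (le_trans (ler_normD _ _))// lerD// normrM gtr0_norm// ler_piMl// ltW//.
  by rewrite ltrBlDr ltrDl.
have meas (z : R) : measurable_fun I0pi (fun t => (C%:E - lne `|z - (m + l * cos t)|%:E) * (tpsq P t)%:E)%E.
  apply: measurable_funTS; apply: emeasurable_funM; last first.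
    by apply/measurable_EFinP; exact: measurable_tpsq.
  apply: emeasurable_funB => //; apply: measurable_lne_EFin.
  apply: measurableT_comp => //; apply: measurable_funB => //.
  exact: measurable_arc_param.
have tp (t : R) : (0 <= (tpsq P t)%:E)%E by rewrite lee_fin tpsq_ge0.
suff : ((pi * (C * autocorr P 0 - itv_pot m l P x))%:E <=
   (1 - s)%:E * (pi * (C * autocorr P 0 - itv_pot m l P x0))%:E +
   s%:E * (pi * (C * autocorr P 0 - itv_pot m l P x2))%:E)%E.
  rewrite -!EFinM -EFinD lee_fin.
  have -> (a b : R) : (1 - s) * (pi * a) + s * (pi * b) = pi * ((1 - s) * a + s * b) by ring.
  rewrite ler_pM2l ?pi_gt0//.
  by move: (itv_pot m l P x) (itv_pot m l P x0) (itv_pot m l P x2) (C * _) => a b c d; clear; lra.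
have Z (z k : R) : 0 <= k -> `|z| <= `|x0| + `|x2| ->
    (k%:E * \int[mu]_(t in I0pi) ((C%:E - lne `|z - (m + l * cos t)|%:E) * (tpsq P t)%:E) =
     \int[mu]_(t in I0pi) (k%:E * ((C%:E - lne `|z - (m + l * cos t)|%:E) * (tpsq P t)%:E)))%E.
  move=> k0 zx; rewrite [RHS]ge0_integralZl_EFin//.
    by move=> t _; rewrite mule_ge0// pos.
  exact: meas.
rewrite -!itv_potP// (Z x0) ?(ltW s1')// (Z x2) ?(ltW s0)//.
rewrite -ge0_integralD//; last 4 first.
- by move=> t _; rewrite mule_ge0 ?lee_fin ?(ltW s1')// mule_ge0// pos.
- by apply: measurable_funeM; exact: meas.
- by move=> t _; rewrite mule_ge0 ?lee_fin ?(ltW s0)// mule_ge0// pos.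
- by apply: measurable_funeM; exact: meas.
apply: ge0_le_integral => //; first by move=> t _; rewrite mule_ge0// pos.
- exact: meas.
- by apply: emeasurable_funD; apply: measurable_funeM; exact: meas.
move=> t _; rewrite !muleA -ge0_muleDl ?mule_ge0 ?pos ?lee_fin ?(ltW s0) ?(ltW s1')//.
rewrite lee_wpmul2r// lne_concave//.
have ct := xi t; have lc : - l <= l * cos t <= l.
  by rewrite -ler_norml normrM (gtr0_norm l0) ler_piMr ?(ltW l0)// ler_norml ct.
have /andP[h1 h2] := lc.
case: side => -[hx0 hx2]; [left|right]; split; move: h1 h2 hx0 hx2; clear; lra.
Qed.

(** Beyond t1 convexity and f 0 <= f t1 prevent f from falling below f t1. Before t1 the secant
    through t1 and t2, extended backwards, lies below f; as t2 >= 2 t1 it stays above the smaller of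
    f t1 and 2 f t1 - f t2. *)
Lemma convex_gap (f : R -> R) (D : R -> Prop) (t1 t2 c : R) :
  (forall u v w : R, 0 <= u -> u < v -> v < w -> D w ->
     (w - u) * f v <= (w - v) * f u + (v - u) * f w) ->
  0 < t1 -> 2 * t1 <= t2 -> D t2 -> f 0 <= f t1 -> c <= f t1 -> c <= 2 * f t1 - f t2 ->
  forall t : R, 0 < t -> D t -> c <= f t.
Proof.
move=> cf t10 t12 Dt2 f01 cf1 cf2 t t0 Dt.
have [tt1|tt1|->//] := ltgtP t t1.
  have t12' : t1 < t2 by move: t10 t12; clear; lra.
  have H := cf t t1 t2 (ltW t0) tt1 t12' Dt2.
  have d0 : 0 < t2 - t1 by rewrite subr_gt0.
  rewrite -(ler_pM2l d0).
  have h1 : 0 <= (t2 - 2 * t1 + t) * (f t1 - c).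
    by rewrite mulr_ge0 ?subr_ge0//; move: t0 t12; clear; lra.
  have h2 : 0 <= (t1 - t) * (2 * f t1 - f t2 - c).
    by rewrite mulr_ge0 ?subr_ge0// ltW.
  by move: H h1 h2; move: (f t) (f t1) (f t2) => a b d; clear; lra.
have H := cf 0 t1 t (lexx 0) t10 tt1 Dt.
have h1 : 0 <= (t - t1) * (f t1 - f 0) by rewrite mulr_ge0 ?subr_ge0// ltW.
rewrite (le_trans cf1)// -(ler_pM2l t10).
by move: H h1; move: (f t) (f t1) (f 0) => a b d; clear; lra.
Qed.

End real_estimates.

From Stdlib Require Import ZArith.
From mathcomp Require Import zify ssrZ ring lra.
Import Order.TTheory GRing.Theory Num.Theory.
Local Open Scope classical_set_scope.
Local Open Scope ring_scope.

(** * Ball arithmetic over the integers, in units of 2^-44 *)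

Module Balls.

(* Opaque, so that conversion never unfolds a large numeral to unary form. *)
Fact zr_exists :
  {f : forall R : realType, Z -> R | forall R a, f R a = (int_of_Z a)%:~R}.
Proof. by exists (fun R a => (int_of_Z a)%:~R). Qed.
Definition zr (R : realType) (a : Z) : R := sval zr_exists R a.

Section integer_embedding.
Variable R : realType.
Implicit Types (a b : Z) (x y : R).
Local Notation zr := (@zr R).

Lemma zrE a : zr a = (int_of_Z a)%:~R.
Proof. exact: (svalP zr_exists). Qed.
Lemma zr0 : zr Z0 = 0. Proof. by rewrite zrE. Qed.
Lemma zr1 : zr (Zpos xH) = 1. Proof. by rewrite zrE. Qed.
Lemma zr2 : zr 2%Z = 2. Proof. by rewrite zrE. Qed.
Lemma zrD a b : zr (Z.add a b) = zr a + zr b.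
Proof. by rewrite !zrE -[Z.add a b]/(a + b) raddfD/= rmorphD. Qed.
Lemma zrN a : zr (Z.opp a) = - zr a.
Proof. by rewrite !zrE -[Z.opp a]/(- a) raddfN/= rmorphN. Qed.
Lemma zrB a b : zr (Z.sub a b) = zr a - zr b.
Proof. by rewrite -Z.add_opp_r zrD zrN. Qed.
Lemma zrM a b : zr (Z.mul a b) = zr a * zr b.
Proof. by rewrite !zrE -[Z.mul a b]/(a * b) rmorphM/= rmorphM. Qed.

Lemma zr_le a b : Z.le a b -> zr a <= zr b.
Proof. by move=> ab; rewrite !zrE ler_int; lia. Qed.
Lemma zr_lt a b : Z.lt a b -> zr a < zr b.
Proof. by move=> ab; rewrite !zrE ltr_int; lia. Qed.

Lemma zr_abs a : zr (Z.abs a) = `|zr a|.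
Proof.
have [h|h] := Z.abs_spec a; case: h => a0 ->.
  by rewrite ger0_norm// -zr0 zr_le.
by rewrite zrN ltr0_norm// -zr0 zr_lt.
Qed.

Lemma zr_ge0 a : Z.le Z0 a -> 0 <= zr a.
Proof. by move/zr_le; rewrite zr0. Qed.

Lemma zr_div a b : Z.lt Z0 b ->
  zr (Z.div a b) * zr b <= zr a < (zr (Z.div a b) + 1) * zr b.
Proof.
move=> b0; rewrite -zr1 -zrD -!zrM.
have [h1 h2] := (Z.div_mod a b (Z.neq_sym _ _ (Z.lt_neq _ _ b0)), Z.mod_pos_bound a b b0).
apply/andP; split; [apply: zr_le|apply: zr_lt]; nia.
Qed.

Lemma zr_nat n : zr (Z.of_nat n) = n%:R.
Proof. by rewrite zrE (_ : int_of_Z _ = n%:Z)//; lia. Qed.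
End integer_embedding.

#[local] Arguments Z.shiftr : simpl never.
#[local] Arguments Z.shiftl : simpl never.
#[local] Arguments Z.mul : simpl never.
#[local] Arguments Z.add : simpl never.
#[local] Arguments Z.sub : simpl never.
#[local] Arguments Z.div : simpl never.
#[local] Arguments Z.abs : simpl never.

(* A pair (c, r) represents the numbers at distance at most r / 2^44 from
   c / 2^44. *)
Notation ball44 := (Z * Z)%type.
Definition prec : Z := 44%Z.
Definition one44 : Z := Z.shiftl 1 prec.

Section ball_arithmetic.
Local Open Scope Z_scope.
Implicit Types (x y : ball44) (n : Z).

Definition bshift (a : Z) := Z.shiftr a prec.
Definition bint n : ball44 := (Z.shiftl n prec, 0).
Definition bdy (s n : Z) : ball44 := (Z.shiftr (Z.shiftl n prec) s, 1).
Definition badd x y : ball44 := (x.1 + y.1, x.2 + y.2).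
Definition bopp x : ball44 := (- x.1, x.2).
Definition bsub x y := badd x (bopp y).
(** Of the two extra units, one covers rounding the centre down and one rounding the radius down.
    The same two units occur in [bdivn]. *)
Definition bmul x y : ball44 :=
  (bshift (x.1 * y.1), bshift (Z.abs x.1 * y.2 + Z.abs y.1 * x.2 + x.2 * y.2) + 2).
Definition bscale n x : ball44 := (n * x.1, Z.abs n * x.2).
Definition bdivn x n : ball44 := (x.1 / n, x.2 / n + 2).
Definition bbound x := Z.abs x.1 + x.2.
Definition blo x := x.1 - x.2.
Definition bhi x := x.1 + x.2.
(** The midpoint is rounded down, so its distance to hi is the larger one. *)
Definition bmk lo hi : ball44 := let c := Z.shiftr (lo + hi) 1 in (c, hi - c).
Definition binv x := bmk (Z.shiftl one44 prec / bhi x) (Z.shiftl one44 prec / blo x + 1).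
Definition bsqrt x :=
  bmk (Z.sqrt (Z.shiftl (blo x) prec)) (Z.sqrt (Z.shiftl (bhi x) prec) + 1).
End ball_arithmetic.

Section ball_soundness.
Variable R : realType.
Implicit Types (x y : R) (a b : ball44) (n : Z).
Local Notation zr := (@zr R).

Definition S44 : R := zr one44.

Lemma S44_gt0 : 0 < S44.
Proof. by rewrite -(zr0 R); apply: zr_lt. Qed.

Definition inb a x := `|x * S44 - zr a.1| <= zr a.2.

Lemma zr_shiftl n : zr (Z.shiftl n prec) = zr n * S44.
Proof. by rewrite Z.shiftl_mul_pow2// zrM. Qed.

Lemma zr_bshift n : zr (bshift n) * S44 <= zr n < (zr (bshift n) + 1) * S44.
Proof. by rewrite /bshift Z.shiftr_div_pow2//; exact: zr_div. Qed.

Lemma inb_int n : inb (bint n) (zr n).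
Proof. by rewrite /inb /= zr_shiftl subrr normr0 zr0. Qed.

Lemma inb0 : inb (Z0, Z0) 0.
Proof. by rewrite /inb /= mul0r zr0 subrr normr0. Qed.

Lemma inb1 : inb (one44, Z0) 1.
Proof. by rewrite /inb /= mul1r zr0 subrr normr0. Qed.

Lemma inb_dy s n : Z.le Z0 s -> inb (bdy s n) (zr n / zr (Z.pow 2 s)).
Proof.
move=> s0; rewrite /inb /= zr1.
have p0 : Z.lt Z0 (Z.pow 2 s) by apply: Z.pow_pos_nonneg.
have := zr_div R (Z.shiftl n prec) p0; rewrite -Z.shiftr_div_pow2// zr_shiftl.
have q0 : 0 < zr (Z.pow 2 s) by rewrite -(zr0 R) zr_lt.
rewrite -ler_pdivlMr// -ltr_pdivrMr// mulrAC => /andP[].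
move: (_ / _) (zr _) => u v h1 h2; rewrite ler_norml; apply/andP; split; lra.
Qed.

Lemma inb_add a b x y : inb a x -> inb b y -> inb (badd a b) (x + y).
Proof.
rewrite /inb /= !zrD => ax bx; rewrite mulrDl opprD addrACA.
by rewrite (le_trans (ler_normD _ _))// lerD.
Qed.

Lemma inb_opp a x : inb a x -> inb (bopp a) (- x).
Proof. by rewrite /inb /= zrN mulNr -opprD normrN. Qed.

Lemma inb_sub a b x y : inb a x -> inb b y -> inb (bsub a b) (x - y).
Proof. by move=> ax b_y; apply: inb_add => //; exact: inb_opp. Qed.

Lemma inb_scale a x n : inb a x -> inb (bscale n a) (zr n * x).
Proof.
rewrite /inb /= !zrM zr_abs => ax; rewrite -mulrA -mulrBr normrM.
by rewrite ler_wpM2l.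
Qed.

Lemma inb_divn a x n : Z.lt Z0 n -> inb a x -> inb (bdivn a n) (x / zr n).
Proof.
move=> n0 ax; rewrite /inb /= zrD.
have n0' : 0 < zr n by rewrite -(zr0 R) zr_lt.
have H1 := zr_div R a.1 n0; have H2 := zr_div R a.2 n0; move: ax; rewrite /inb zr2 => ax.
rewrite -(ler_pM2r n0') -[X in _ * X <= _](gtr0_norm n0') -normrM; move: H2 H1 ax.
have -> : (x / zr n * S44 - zr (Z.div a.1 n)) * zr n =
    (x * S44 - zr a.1) + (zr a.1 - zr (Z.div a.1 n) * zr n).
  by field; rewrite gt_eqF.
set d := zr n in n0' *; set c := zr a.1; set r := zr a.2.
set q := zr (Z.div a.1 n); set q2 := zr (Z.div a.2 n).
move=> /andP[_ h1] /andP[h2 h3] ax.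
rewrite (le_trans (ler_normD _ _))// (ger0_norm (_ : 0 <= c - q * d)) ?subr_ge0//.
move: h1 h3; rewrite !mulrDl mul1r; move: ax; clear; lra.
Qed.

Lemma inb_mul a b x y : inb a x -> inb b y -> inb (bmul a b) (x * y).
Proof.
move=> ax b_y; rewrite /inb /= zrD zr2.
move: (zr_bshift (Z.mul a.1 b.1)).
move: (zr_bshift (Z.add (Z.add (Z.mul (Z.abs a.1) b.2) (Z.mul (Z.abs b.1) a.2))
   (Z.mul a.2 b.2))).
rewrite !zrD !zrM !zr_abs.
have S0 := S44_gt0; move: ax b_y; rewrite /inb.
set c := zr a.1; set r := zr a.2; set d := zr b.1; set q := zr b.2.
set m2 := zr (bshift (Z.mul a.1 b.1)); set m1 := zr (bshift _); set S : R := S44 in S0 *.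
move=> ax b_y /andP[_ h1] /andP[h2 h3].
rewrite -(ler_pM2r S0) -[X in _ * X <= _](gtr0_norm S0) -normrM.
have key (c' d' m S' x' y' : R) : (x' * y' * S' - m) * S' =
   c' * (y' * S' - d') + d' * (x' * S' - c') +
   (x' * S' - c') * (y' * S' - d') + (c' * d' - m * S') by ring.
rewrite (key c d); clear key.
have k1 : `|c * (y * S - d)| <= `|c| * q by rewrite normrM ler_wpM2l.
have k2 : `|d * (x * S - c)| <= `|d| * r by rewrite normrM ler_wpM2l.
have k3 : `|(x * S - c) * (y * S - d)| <= r * q by rewrite normrM ler_pM.
have k4 : `|c * d - m2 * S| <= S.
  rewrite ger0_norm ?subr_ge0// lerBlDr (le_trans (ltW h3))//.
  by rewrite mulrDl mul1r addrC.
have := lerD (lerD (lerD k1 k2) k3) k4.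
have n1 := ler_normD (c * (y * S - d)) (d * (x * S - c)).
have n2 := ler_normD (c * (y * S - d) + d * (x * S - c)) ((x * S - c) * (y * S - d)).
have n3 := ler_normD (c * (y * S - d) + d * (x * S - c) + (x * S - c) * (y * S - d))
   (c * d - m2 * S).
move=> h; move: n1 n2 n3 h h1; clear; lra.
Qed.

Lemma inb_bound a x : inb a x -> `|x| <= zr (bbound a) / S44.
Proof.
rewrite /inb /bbound zrD zr_abs => ax; rewrite ler_pdivlMr ?S44_gt0//.
rewrite -[X in _ * X](gtr0_norm S44_gt0) -normrM addrC -lerBlDr.
exact: le_trans (lerB_dist _ _) ax.
Qed.

Lemma inb_loP a x : inb a x -> zr (blo a) <= x * S44.
Proof.
rewrite /inb /blo ler_norml zrB => /andP[+ _].
by move: (zr a.1) (zr a.2) (x * _) => u v w; lra.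
Qed.

Lemma inb_hiP a x : inb a x -> x * S44 <= zr (bhi a).
Proof.
rewrite /inb /bhi ler_norml zrD => /andP[_].
by move: (zr a.1) (zr a.2) (x * _) => u v w; lra.
Qed.

Lemma inb_mk lo hi x : zr lo <= x * S44 <= zr hi -> inb (bmk lo hi) x.
Proof.
move=> /andP[h1 h2]; rewrite /inb /= zrB.
have := zr_div R (Z.add lo hi) (erefl : Z.lt Z0 2).
rewrite -[2%Z]/(Z.pow 2 1) -Z.shiftr_div_pow2// zrD.
rewrite (_ : zr (Z.pow 2 1) = 2) ?zr2// => /andP[h3 h4].
rewrite ler_norml; lra.
Qed.

Lemma inb_inv a x : Z.lt Z0 (blo a) -> inb a x -> inb (binv a) x^-1.
Proof.
move=> a0 ax; apply: inb_mk.
have l0 : 0 < zr (blo a) by rewrite -(zr0 R) zr_lt.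
have S0 := S44_gt0; have lo := inb_loP ax; have hi := inb_hiP ax.
have x0 : 0 < x by rewrite -(pmulr_lgt0 _ S0) (lt_le_trans l0).
have h0 : Z.lt Z0 (bhi a).
  by apply/Z.nle_gt => /(zr_le R); rewrite zr0 leNgt (lt_le_trans _ hi)// mulr_gt0.
have h0' : 0 < zr (bhi a) by rewrite -(zr0 R) zr_lt.
have := zr_div R (Z.shiftl one44 prec) a0; have := zr_div R (Z.shiftl one44 prec) h0.
rewrite zr_shiftl zrD zr1 -/S44 => /andP[h1 _] /andP[_ h2].
rewrite [x^-1 * _]mulrC; apply/andP; split.
  rewrite ler_pdivlMr// -(ler_pM2r S0) (le_trans _ h1)// -mulrA ler_wpM2l//.
  have [//|neg] := leP 0 (zr (Z.div (Z.shiftl one44 prec) (bhi a))).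
  by exfalso; move: neg; rewrite ltNge zr_ge0//; apply: Z.div_pos.
rewrite ler_pdivrMr// -(ler_pM2r S0) (le_trans (ltW h2))// -mulrA ler_wpM2l//.
by rewrite addr_ge0// zr_ge0//; apply: Z.div_pos.
Qed.

Lemma inb_sqrt a x : Z.le Z0 (blo a) -> inb a x -> inb (bsqrt a) (Num.sqrt x).
Proof.
move=> a0 ax; apply: inb_mk.
have S0 := S44_gt0; have lo := inb_loP ax; have hi := inb_hiP ax.
have l0 : 0 <= zr (blo a) by exact: zr_ge0.
have x0 : 0 <= x by rewrite -(pmulr_lge0 _ S0) (le_trans l0).
have s0 : 0 <= Num.sqrt x * S44 by rewrite mulr_ge0// ?sqrtr_ge0// ltW.
have E : (Num.sqrt x * S44) ^+ 2 = x * S44 * S44.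
  by rewrite exprMn sqr_sqrtr// expr2 mulrA.
have h0 : Z.le Z0 (bhi a).
  apply/Z.nlt_ge => /(zr_lt R); rewrite zr0 ltNge (le_trans _ hi)//.
  by rewrite mulr_ge0// ltW.
have sl n : Z.le Z0 n -> Z.le Z0 (Z.shiftl n prec).
  by move=> n0; rewrite Z.shiftl_nonneg.
have [h1 _] := Z.sqrt_spec _ (sl _ a0); have [_ h2] := Z.sqrt_spec _ (sl _ h0).
move/(zr_le R): h1; rewrite zrM zr_shiftl -expr2 => h1.
move/(zr_lt R): h2; rewrite zrM zr_shiftl -expr2 -Z.add_1_r => h2.
have nn n : 0 <= zr (Z.sqrt n) by apply/zr_ge0/Z.sqrt_nonneg.
apply/andP; split.
  rewrite -(@ler_pXn2r _ 2) ?nnegrE// E (le_trans h1)//.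
  by rewrite ler_wpM2r// ltW.
rewrite -(@ler_pXn2r _ 2) ?nnegrE ?zrD ?addr_ge0 ?nn ?zr_ge0// E.
rewrite zrD in h2; rewrite (le_trans _ (ltW h2))//.
by rewrite ler_wpM2r// ltW.
Qed.

Lemma inb_le a b x y : Z.le (bhi a) (blo b) -> inb a x -> inb b y -> x <= y.
Proof.
move=> /(zr_le R) ab /inb_hiP ax /inb_loP b_y.
by rewrite -(ler_pM2r S44_gt0) (le_trans ax)// (le_trans ab).
Qed.

Lemma inb_lt a b x y : Z.lt (bhi a) (blo b) -> inb a x -> inb b y -> x < y.
Proof.
move=> /(zr_lt R) ab /inb_hiP ax /inb_loP b_y.
by rewrite -(ltr_pM2r S44_gt0) (le_lt_trans ax)// (lt_le_trans ab).
Qed.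

End ball_soundness.

End Balls.
Export Balls.

(** * Certified logarithms *)

Module BallLn.

(** The case a = 0 of [ln_poisson_series]: the denominator becomes (1 - r)^2 and everything is
    halved. *)
Lemma ln_series (R : realType) (r : R) N : `|r| < 1 ->
  `|ln (1 - r) + \sum_(n < N) r ^+ n.+1 / n.+1%:R| <= 2 * `|r| ^+ N.+1 / (1 - `|r|) ^+ 2.
Proof.
move=> r1; have := ln_poisson_series 0 N r1.
have r1' : 0 < 1 - r by rewrite subr_gt0 (le_lt_trans (ler_norm _)).
have -> : 1 - 2 * r * cos 0 + r ^+ 2 = (1 - r) ^+ 2 by rewrite cos0; ring.
rewrite lnXn// mulr2n.
have -> : \sum_(n < N) 2 * r ^+ n.+1 * cos (n.+1%:R * 0) / n.+1%:R =
   2 * \sum_(n < N) r ^+ n.+1 / n.+1%:R.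
  rewrite mulr_sumr; apply: eq_bigr => i _; rewrite mulr0 cos0 mulr1.
  by rewrite mulrA.
have -> (u v : R) : u + u + 2 * v = 2 * (u + v) by ring.
rewrite normrM (_ : `|2| = 2 :> R); last by rewrite ger0_norm.
have -> : 4 * `|r| ^+ N.+1 / (1 - `|r|) ^+ 2 = 2 * (2 * `|r| ^+ N.+1 / (1 - `|r|) ^+ 2) :> R.
  by rewrite !mulrA -natrM.
by rewrite ler_pM2l.
Qed.

Definition bhorner (cs : seq ball44) (w : ball44) : ball44 :=
  foldr (fun c s => bmul w (badd c s)) (Z0, Z0) cs.
Definition rhorner (R : realType) (cs : seq R) (w : R) : R :=
  foldr (fun c s => w * (c + s)) 0 cs.

(** Only the sign of the centre is inspected; [inb_abs] therefore asks that the result be a strictly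
    positive ball, which fixes the sign of the number. *)
Definition babs (x : ball44) : ball44 := if Z.ltb x.1 Z0 then bopp x else x.
Definition zdiv_up (a b : Z) := Z.add (Z.div a b) 1.
Definition inv_list : seq ball44 :=
  [seq bdivn (one44, Z0) (Z.of_nat n) | n <- iota 1 30].

(** Thirty terms of the series in r = 1 - x. The radius 17/50 leaves a margin over 1/3, the distance
    from 1 guaranteed by the reduction in [bln]; the added unit covers the remainder. *)
Definition bln_near (x : ball44) : option ball44 :=
  let r := bsub (one44, Z0) x in
  if Z.leb (Z.mul 50 (bbound r)) (Z.mul 17 one44) then
    let s := bhorner inv_list r in Some (Z.opp s.1, Z.add s.2 1)
  else None.

(** ln 2 = ln (4/3) - ln (2/3), both arguments lying in the range of [bln_near]. *)
Definition bln2 : option ball44 :=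
  if bln_near (bdivn (bint 4) 3) is Some a then
    if bln_near (bdivn (bint 2) 3) is Some b then Some (bsub a b) else None
  else None.

Definition bln (l2 x : ball44) : option ball44 :=
  if Z.ltb Z0 (blo x) then
    (* Taking the binary logarithm of 3x/2 makes x / 2^k fall between 2/3 and 4/3, symmetrically
       about 1. This choice is not trusted: [bln_near] tests the range. *)
    let k := Z.sub (Z.log2 (Z.shiftr (Z.mul 3 x.1) 1)) prec in
    let y := if Z.ltb k Z0 then bscale (Z.pow 2 (Z.opp k)) x
             else bdivn x (Z.pow 2 k) in
    if bln_near y is Some s then Some (badd s (bscale k l2)) else None
  else None.

Section log_soundness.
Variable R : realType.
Local Notation zr := (@zr R).
Implicit Types (x : R) (a b : ball44).

Fixpoint inbs (bs : seq ball44) (xs : seq R) : Prop :=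
  match bs, xs with
  | [::], [::] => True
  | b :: bs', x :: xs' => inb b x /\ inbs bs' xs'
  | _, _ => False
  end.

Lemma inbs_map (I : eqType) (l : seq I) (f : I -> ball44) (g : I -> R) :
  (forall i, i \in l -> inb (f i) (g i)) -> inbs (map f l) (map g l).
Proof.
elim: l => //= i l IH H; split; first exact/H/mem_head.
by apply: IH => j jl; apply: H; rewrite inE jl orbT.
Qed.

Lemma inbs_size bs xs : inbs bs xs -> size bs = size xs.
Proof. by elim: bs xs => [|b bs IH] [|x xs]//= [_ /IH ->]. Qed.

Lemma inbs_nth bs xs : inbs bs xs -> forall i, inb (nth (Z0, Z0) bs i) xs`_i.
Proof.
elim: bs xs => [|b bs IH] [|x xs]//= => [_ i|[bx /IH H] [|i]//]; last exact: H.
by rewrite !nth_nil; exact: inb0.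
Qed.

Lemma inb_horner cs xs a x : inbs cs xs -> inb a x ->
  inb (bhorner cs a) (rhorner xs x).
Proof.
move=> + ax; elim: cs xs => [|c cs IH] [|y ys]//=; first by move=> _; exact: inb0.
by case=> cy /IH h; apply: inb_mul => //; exact: inb_add.
Qed.

Lemma rhornerE (cs : seq R) x : rhorner cs x = \sum_(i < size cs) cs`_i * x ^+ i.+1.
Proof.
elim: cs => [|c cs IH]; first by rewrite big_ord0.
rewrite /= IH big_ord_recl /= mulrDr expr1 mulrC mulr_sumr; congr (_ + _).
by apply: eq_bigr => i _; rewrite mulrCA -exprS.
Qed.

Lemma zr_pow (a : Z) n : zr (Z.pow a (Z.of_nat n)) = zr a ^+ n.
Proof.
elim: n => [|n IH]; first by rewrite zr1.
by rewrite Nat2Z.inj_succ Z.pow_succ_r ?zrM ?IH ?exprS//; lia.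
Qed.

Lemma inb_abs a x : inb a x -> Z.lt Z0 (blo (babs a)) -> inb (babs a) `|x|.
Proof.
rewrite /babs; case: ifP => _ ax h; have S0 := S44_gt0 R.
  have := @inb_lt _ (Z0, Z0) _ _ _ h (inb0 R) (inb_opp ax).
  by rewrite oppr_gt0 => x0; rewrite ltr0_norm//; exact: inb_opp.
by have := @inb_lt _ (Z0, Z0) _ _ _ h (inb0 R) ax => x0; rewrite gtr0_norm.
Qed.

Lemma inb_ln_near a b x : bln_near a = Some b -> inb a x -> inb b (ln x).
Proof.
rewrite /bln_near; case: (Z.leb_spec (Z.mul 50 _) _) => [rb|_ H]; last by discriminate H.
move=> /Some_inj <- ax.
have ir := inb_sub (inb1 R) ax.
have S0 := S44_gt0 R.
have r17 : `|1 - x| <= 17 / 50.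
  rewrite (le_trans (inb_bound ir))// ler_pdivrMr// mulrAC ler_pdivlMr//.
  move/(zr_le R): rb; rewrite zrM [zr (Z.mul 17 _)]zrM -/(S44 R).
  have -> : zr 50%Z = 50 by rewrite zrE.
  have -> : zr 17%Z = 17 by rewrite zrE.
  by rewrite mulrC.
have r1 : `|1 - x| < 1.
  by apply: (le_lt_trans r17); clear; lra.
have := ln_series 30 r1; rewrite (_ : 1 - (1 - x) = x); last by clear; ring.
move=> H.
have hs : inb (bhorner inv_list (bsub (one44, Z0) a)) (\sum_(n < 30) (1 - x) ^+ n.+1 / n.+1%:R).
  have : inbs inv_list [seq 1 / zr (Z.of_nat n) | n <- iota 1 30].
    apply: inbs_map => n; rewrite mem_iota => /andP[n0 _]; apply: inb_divn.
      by move: n0; lia.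
    exact: inb1.
  move=> /inb_horner /(_ ir); rewrite rhornerE size_map size_iota.
  congr (inb _ _); apply: eq_bigr => i _.
  rewrite [LHS]mulrC (nth_map O) ?size_iota// nth_iota//; congr (_ * _).
  by rewrite zr_nat div1r add1n.
move: hs; move: (bhorner _ _) => h hs; rewrite /inb /= zrN zrD zr1.
have S8 : S44 R = 8 ^+ 15 / 2.
  rewrite /S44 (_ : one44 = Z.pow 2 (Z.of_nat 44))// zr_pow zr2.
  by rewrite (_ : 8 = 2 ^+ 3 :> R) -?exprM ?[2 ^+ (3 * 15)]exprSr ?mulfK//; ring.
set y := `|1 - x| in r17 r1 H *.
have y0 : 0 <= y by exact: normr_ge0.
(* (17/50)^2 <= 1/8 gives y^30 <= 8^-15 = 2^-45, so in units of 2^-44 the remainder is at most y /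
   (1 - y)^2, which is below 1. *)
have y2 : y ^+ 2 <= 8^-1.
  by rewrite (@le_trans _ _ ((17 / 50) ^+ 2))// ?lerXn2r ?nnegrE//; clear; lra.
have y30 : y ^+ 30 * 8 ^+ 15 <= 1.
  have -> : y ^+ 30 = (y ^+ 2) ^+ 15 by rewrite -exprM.
  rewrite -exprMn exprn_ile1 ?mulr_ge0 ?exprn_ge0//.
  by rewrite -ler_pdivlMr// mul1r.
have tail : 2 * y ^+ 31 / (1 - y) ^+ 2 * S44 R <= 1.
  have d0 : 0 < (1 - y) ^+ 2 by rewrite exprn_gt0// subr_gt0.
  rewrite mulrAC ler_pdivrMr// mul1r S8 exprS.
  have -> (u v : R) : 2 * (y * u) * (v / 2) = y * (u * v) by field.
  rewrite (@le_trans _ _ y)//; first by rewrite ler_piMr.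
  have h' : 33 / 50 <= 1 - y by move: r17; clear; lra.
  have : (33 / 50) ^+ 2 <= (1 - y) ^+ 2.
    by rewrite lerXn2r ?nnegrE//; move: h'; clear; lra.
  by move: r17; clear; lra.
move: hs; rewrite /inb; set sm := \sum_(_ < _) _ in H *.
move=> hs.
have -> : ln x * S44 R - - zr h.1 = (ln x + sm) * S44 R - (sm * S44 R - zr h.1) by ring.
rewrite (le_trans (ler_normB _ _))// addrC lerD//.
by rewrite normrM (gtr0_norm S0) (le_trans _ tail)// ler_pM2r.
Qed.

Lemma inb_ln2 b : bln2 = Some b -> inb b (ln 2 : R).
Proof.
rewrite /bln2; case E1 : bln_near => [c|//]; case E2 : bln_near => [d|//] /Some_inj <-.
have -> : ln 2 = ln (4 / 3) - ln (2 / 3) :> R.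
  by rewrite -ln_div ?posrE// ?divr_gt0//; congr ln; field.
have h n : inb (bdivn (bint n) 3) (zr n / zr 3%Z) by apply: inb_divn => //; exact: inb_int.
have {}h m : inb (bdivn (bint (Z.of_nat m)) 3) (m%:R / 3 : R).
  have z3 : zr 3%Z = 3 by rewrite zrE.
  by rewrite -z3 -zr_nat; exact: h.
by apply: inb_sub; [exact: inb_ln_near E1 (h 4%nat)|exact: inb_ln_near E2 (h 2%nat)].
Qed.

Lemma inb_ln l2 a b x : inb l2 (ln 2 : R) -> bln l2 a = Some b -> inb a x ->
  0 < x /\ inb b (ln x).
Proof.
move=> l2P; rewrite /bln; case: (Z.ltb_spec Z0 (blo a)) => [a0|_ H]; last by discriminate H.
set k := Z.sub _ _; set y := if _ then _ else _; case E : bln_near => [c|//] /Some_inj <- ax.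
have x0 : 0 < x by exact: (@inb_lt _ (Z0, Z0) _ _ _ a0 (inb0 R) ax).
split=> //; have p0 j : Z.le Z0 j -> 0 < zr (Z.pow 2 j).
  by move=> j0; rewrite -(zr0 R); apply: zr_lt; exact: Z.pow_pos_nonneg.
have lnp j : Z.le Z0 j -> ln (zr (Z.pow 2 j)) = zr j * ln 2.
  move=> j0; rewrite -(Z2Nat.id _ j0) zr_pow lnXn ?zr2// zr_nat mulr_natl.
  by [].
have [z [yz ->]] : exists z, inb y z /\ ln x = ln z + zr k * ln 2.
  rewrite /y; case: ifP => [/Z.ltb_lt k0|/Z.ltb_ge k0].
    have k0' : Z.le Z0 (Z.opp k) by lia.
    exists (zr (Z.pow 2 (Z.opp k)) * x); split; first exact: inb_scale.
    by rewrite lnM ?posrE ?p0// lnp// zrN; ring.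
  exists (x / zr (Z.pow 2 k)); split; first by apply: inb_divn => //; exact: Z.pow_pos_nonneg.
  by rewrite ln_div ?posrE ?p0// lnp// subrK.
by apply: inb_add; [exact: inb_ln_near E yz|exact: inb_scale].
Qed.

End log_soundness.

End BallLn.
Export BallLn.

(** * Arc data and enclosures of arc potentials *)

Module BallFunctions.

Definition ball0 : ball44 := (Z0, Z0).
Definition ball1 : ball44 := (one44, Z0).

Fixpoint osum (I : Type) (f : I -> option ball44) (l : seq I) : option ball44 :=
  if l is i :: l' then
    if f i is Some u then if osum f l' is Some v then Some (badd u v) else None else None
  else Some ball0.

Fixpoint omaps (I J : Type) (f : I -> option J) (l : seq I) : option (seq J) :=
  if l is i :: l' then
    if f i is Some u then if omaps f l' is Some v then Some (u :: v) else None else None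
  else Some [::].

Fixpoint zdot (P Q : seq Z) : Z :=
  match P, Q with x :: P', y :: Q' => Z.add (Z.mul x y) (zdot P' Q') | _, _ => Z0 end.
Definition zauto (P : seq Z) n := zdot P (drop n P).

(* Abscissas are multiples of 2^-40 and coefficients multiples of 2^-37, so
   autocorrelations and node weights are multiples of 2^-74.  The weight of the
   first node is what is left of the mass. *)
Record zarc := ZArc { zmid : Z; zrad : Z; zcoef : seq Z; znode : seq Z; zwt : seq Z;
  zleft : Z * Z; zright : Z * Z }.

Record barc := BArc { bmid : ball44; brad : ball44; binvrad : ball44;
  bauto : seq ball44; bser : seq ball44 }.

Definition mk_barc (a : zarc) : barc :=
  let A := [seq zauto (zcoef a) n | n <- iota 0 (size (zcoef a)).+1] in
  BArc (bdy 40 (zmid a)) (bdy 40 (zrad a)) (binv (bdy 40 (zrad a)))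
    [seq bdy 74 z | z <- A]
    [seq bdivn (bdy 74 (Z.mul 2 (zauto (zcoef a) n))) (Z.of_nat n)
       | n <- iota 1 (size (zcoef a))].

(** Returns 1/|w| and w for w = jouk z. It computes |z| + sqrt (z^2 - 1) and inverts it, avoiding
    the cancellation in |z| - sqrt (z^2 - 1). *)
Definition bjouk (a : barc) (x : ball44) : option (ball44 * ball44) :=
  let z := bmul (bsub x (bmid a)) (binvrad a) in
  let y := babs z in
  let d := bsub (bmul y y) ball1 in
  let v := badd y (bsqrt d) in
  if [&& Z.ltb one44 (blo y), Z.leb Z0 (blo d) & Z.ltb Z0 (blo v)] then
    let o := binv v in Some (v, if Z.ltb z.1 Z0 then bopp o else o)
  else None.

Definition bpot_out (l2 : ball44) (a : barc) (x : ball44) : option ball44 :=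
  if bjouk a x is Some (v, o) then
    if bln l2 (bdivn (bmul (brad a) v) 2) is Some L then
      Some (bsub (bmul (nth ball0 (bauto a) 0) L) (bhorner (bser a) o)) else None
  else None.

(** At the right edge phi = 0, so all cosines are 1. The outer formula is out of reach there, since
    a ball cannot certify |z| > 1 at |z| = 1. *)
Definition bpot_edge (l2 : ball44) (a : barc) : option ball44 :=
  if bln l2 (bdivn (brad a) 2) is Some L then
    Some (bsub (bmul (nth ball0 (bauto a) 0) L) (bhorner (bser a) ball1)) else None.

Definition blnabs (l2 x : ball44) : option ball44 := bln l2 (babs x).

Lemma bln_pos l2 x u : bln l2 x = Some u -> Z.lt Z0 (blo x).
Proof. by rewrite /bln; case: (Z.ltb_spec Z0 (blo x)) => // _ H; discriminate H. Qed.

#[local] Opaque bmul bsqrt binv bdy bdivn badd bsub bopp bln bhorner.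

Lemma bhi1 : bhi ball1 = one44. Proof. by []. Qed.

Section arc_soundness.
Variable R : realType.
Local Notation zr := (@zr R).
Implicit Types (x : R) (a : zarc).

Definition dy (s : Z) (n : Z) : R := zr n / zr (Z.pow 2 s).
Definition rmid a := dy 40 (zmid a).
Definition rrad a := dy 40 (zrad a).
Definition rcoef a := [seq dy 37 c | c <- zcoef a].
Definition rarc a : arc R := ((rmid a, rrad a), rcoef a).

Lemma osumP (I : eqType) (f : I -> option ball44) (g : I -> R) l v :
  (forall i u, i \in l -> f i = Some u -> inb u (g i)) -> osum f l = Some v ->
  inb v (\sum_(i <- l) g i).
Proof.
elim: l v => [|i l IH] v H; first by case=> <-; rewrite big_nil; exact: inb0.
rewrite [osum _ _]/=; case E : (f i) => [u|//]; case E2 : (osum f l) => [w|//] /Some_inj <-.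
rewrite big_cons; apply: inb_add; first by apply: H E; exact: mem_head.
by apply: IH E2 => j u' jl; apply: H; rewrite inE jl orbT.
Qed.

Lemma pow2_gt0 s : Z.le Z0 s -> 0 < zr (Z.pow 2 s).
Proof. by move=> s0; rewrite -(zr0 R); apply: zr_lt; exact: Z.pow_pos_nonneg. Qed.

Lemma dy_gt0 s n : Z.le Z0 s -> Z.lt Z0 n -> 0 < dy s n.
Proof. by move=> s0 n0; rewrite divr_gt0 ?pow2_gt0// -(zr0 R) zr_lt. Qed.

Lemma dy_ge0 s n : Z.le Z0 s -> Z.le Z0 n -> 0 <= dy s n.
Proof. by move=> s0 n0; apply: divr_ge0; [exact: zr_ge0|exact/ltW/pow2_gt0]. Qed.

Lemma dyD s n k : dy s (Z.add n k) = dy s n + dy s k.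
Proof. by rewrite /dy zrD mulrDl. Qed.

Lemma dyN s n : dy s (Z.opp n) = - dy s n.
Proof. by rewrite /dy zrN mulNr. Qed.

Lemma dy_le s n k : Z.le Z0 s -> Z.le n k -> dy s n <= dy s k.
Proof. by move=> s0 nk; rewrite ler_pM2r ?invr_gt0 ?pow2_gt0// zr_le. Qed.

Lemma dy_lt s n k : Z.le Z0 s -> Z.lt n k -> dy s n < dy s k.
Proof. by move=> s0 nk; rewrite ltr_pM2r ?invr_gt0 ?pow2_gt0// zr_lt. Qed.

Lemma autocorr_dy a n : autocorr (rcoef a) n = dy 74 (zauto (zcoef a) n).
Proof.
have E74 : zr (Z.pow 2 74) = zr (Z.pow 2 37) * zr (Z.pow 2 37).
  by rewrite -zrM -Z.pow_add_r.
have D (P Q : seq Z) : \sum_(j < size P) (map (dy 37) P)`_j * (map (dy 37) Q)`_j =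
    dy 74 (zdot P Q).
  elim: P Q => [|p P IH] [|q Q] //=; rewrite ?big_ord0 /dy ?zr0 ?mul0r//.
    by rewrite big1// => j _; rewrite nth_nil mulr0.
  rewrite big_ord_recl/= IH /dy zrD [zr (Z.mul p q)]zrM mulrDl; congr (_ + _).
  by rewrite E74 invfM mulrACA.
rewrite /autocorr size_map /zauto -D; apply: eq_bigr => j _; congr (_ * _).
by rewrite map_drop nth_drop addnC.
Qed.

Lemma size_rcoef a : size (rcoef a) = size (zcoef a).
Proof. by rewrite size_map. Qed.

Lemma bautoP a n : inb (nth ball0 (bauto (mk_barc a)) n) (autocorr (rcoef a) n).
Proof.
have -> : bauto (mk_barc a) = [seq bdy 74 (zauto (zcoef a) i) | i <- iota 0 (size (zcoef a)).+1].
  by rewrite (map_comp (bdy 74) (zauto (zcoef a))).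
have H : inbs [seq bdy 74 (zauto (zcoef a) i) | i <- iota 0 (size (zcoef a)).+1]
    [seq autocorr (rcoef a) i | i <- iota 0 (size (zcoef a)).+1].
  by apply: inbs_map => i _; rewrite autocorr_dy; exact: inb_dy.
have := inbs_nth H n; rewrite -/ball0.
suff -> : [seq autocorr (rcoef a) i | i <- iota 0 (size (zcoef a)).+1]`_n =
  autocorr (rcoef a) n by [].
have [nP|nP] := ltnP n (size (zcoef a)).+1.
  by rewrite (nth_map 0) ?size_iota// nth_iota.
by rewrite nth_default ?size_map ?size_iota// autocorr_default// size_rcoef; exact: ltnW.
Qed.

Definition rser a := [seq 2 * autocorr (rcoef a) n / n%:R | n <- iota 1 (size (zcoef a))].

Lemma size_rser a : size (rser a) = size (zcoef a).
Proof. by rewrite size_map size_iota. Qed.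

Lemma bmidP a : inb (bmid (mk_barc a)) (rmid a).
Proof. exact: (@inb_dy R 40 (zmid a)). Qed.

Lemma bradP a : inb (brad (mk_barc a)) (rrad a).
Proof. exact: (@inb_dy R 40 (zrad a)). Qed.

Lemma bserP a : inbs (bser (mk_barc a)) (rser a).
Proof.
apply: inbs_map => n; rewrite mem_iota => /andP[n0 _].
rewrite -(zr_nat R n); apply: inb_divn; first by move: n0; lia.
by rewrite autocorr_dy /dy mulrA -(zr2 R) -zrM; apply: inb_dy.
Qed.

Lemma pot_outE a w : pot_out (rrad a) (rcoef a) w =
  autocorr (rcoef a) 0 * ln (rrad a / (2 * `|w|)) - rhorner (rser a) w.
Proof.
rewrite /pot_out rhornerE size_rser size_rcoef; congr (_ - _).
apply: eq_bigr => i _; rewrite (nth_map 0) ?size_iota// nth_iota// add1n.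
by ring.
Qed.

Lemma itv_pot_edge a : 0 < rrad a -> itv_pot (rmid a) (rrad a) (rcoef a) (rmid a + rrad a) =
  autocorr (rcoef a) 0 * ln (rrad a / 2) - rhorner (rser a) 1.
Proof.
move=> l0; rewrite /itv_pot (_ : rmid a + rrad a - rmid a = rrad a); last by ring.
rewrite (gtr0_norm l0) lexx divff ?gt_eqF// acos1 /pot_in rhornerE size_rser size_rcoef.
congr (_ - _); apply: eq_bigr => i _; rewrite (nth_map 0) ?size_iota// nth_iota// add1n.
by rewrite mulr0 cos0 expr1n; ring.
Qed.

Lemma jouk_inv (z : R) : 1 < `|z| ->
  `|jouk z|^-1 = `|z| + Num.sqrt (z ^+ 2 - 1) /\
  jouk z = if z < 0 then - `|jouk z| else `|jouk z|.
Proof.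
move=> z1; have [j0 j1 jE _] := joukP z1.
have z2 : 0 <= z ^+ 2 - 1.
  by rewrite subr_ge0 -(real_normK (num_real z)) exprn_ege1// ltW.
have S : (`|z| - Num.sqrt (z ^+ 2 - 1)) * (`|z| + Num.sqrt (z ^+ 2 - 1)) = 1.
  by rewrite -subr_sqr sqr_sqrtr// real_normK ?num_real//; ring.
split.
  rewrite jE; apply: (mulfI (_ : `|z| - Num.sqrt (z ^+ 2 - 1) != 0)).
    by rewrite -jE gt_eqF.
  by rewrite S mulfV// -jE gt_eqF.
rewrite jE /jouk; have [z0|z0] := ltP z 0.
  by rewrite ltr0_sg// ltr0_norm//; ring.
have z0' : 0 < z by rewrite lt_neqAle z0 andbT; apply: contraTneq z1 => <-; rewrite normr0 ltr10.
by rewrite gtr0_sg// gtr0_norm//; ring.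
Qed.

Lemma bjoukP a bx x v o : Z.lt Z0 (blo (brad (mk_barc a))) -> inb bx x ->
  bjouk (mk_barc a) bx = Some (v, o) ->
  [/\ 1 < `|(x - rmid a) / rrad a|, inb v `|jouk ((x - rmid a) / rrad a)|^-1 &
      inb o (jouk ((x - rmid a) / rrad a))].
Proof.
move=> l0 ax; rewrite /bjouk.
set z := bmul _ _; set y := babs z; set d := bsub _ _; set b := badd y _.
case: ifP => [/and3P[/Z.ltb_lt h1 /Z.leb_le h2 /Z.ltb_lt h3]|_ H]; last by discriminate H.
move=> /Some_inj /pair_equal_spec[<- <-].
have zi : inb z ((x - rmid a) / rrad a).
  apply: inb_mul; first by apply: inb_sub => //; exact: bmidP.
  by apply: inb_inv => //; exact: bradP.
have yp : Z.lt Z0 (blo (babs z)) by apply: Z.lt_trans h1.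
have yi := inb_abs zi yp.
have z1 : 1 < `|(x - rmid a) / rrad a|.
  by apply: inb_lt (inb1 R) yi; rewrite bhi1.
have [jv js] := jouk_inv z1.
have vi : inb b (`|jouk ((x - rmid a) / rrad a)|^-1).
  rewrite jv; apply: inb_add => //; apply: inb_sqrt => //.
  rewrite -(real_normK (num_real _)) expr2.
  by apply: inb_sub; [exact: inb_mul|exact: inb1].
split; [exact: z1|exact: vi|].
have oi : inb (binv b) `|jouk ((x - rmid a) / rrad a)|.
  by rewrite -[X in inb _ X]invrK; apply: inb_inv.
rewrite js; move: yp; rewrite /babs; case: ifP => [_|_] yp.
  have := @inb_lt _ ball0 _ _ _ yp (inb0 R) (inb_opp zi).
  by rewrite oppr_gt0 => ->; exact: inb_opp.
have := @inb_lt _ ball0 _ _ _ yp (inb0 R) zi => /ltW; rewrite leNgt => /negbTE -> //.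
Qed.

Variable l2 : ball44.
Hypothesis l2P : inb l2 (ln 2 : R).

Lemma bpot_outP a bx x u : Z.lt Z0 (blo (brad (mk_barc a))) -> inb bx x ->
  bpot_out l2 (mk_barc a) bx = Some u ->
  inb u (itv_pot (rmid a) (rrad a) (rcoef a) x).
Proof.
move=> l0 ax; rewrite /bpot_out; case E : bjouk => [[v o]|//].
have [z1 vi oi] := bjoukP l0 ax E; case E2 : bln => [L|//] /Some_inj <-.
have li : inb (brad (mk_barc a)) (rrad a) by exact: bradP.
have r0 : 0 < rrad a by exact: (@inb_lt _ ball0 _ _ _ l0 (inb0 R) li).
rewrite /itv_pot ifN; last first.
  by rewrite -ltNge; move: z1; rewrite normrM normfV (gtr0_norm r0) ltr_pdivlMr// mul1r.
rewrite pot_outE; apply: inb_sub; last exact: inb_horner (bserP a) oi.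
apply: inb_mul; first exact: bautoP.
have z2 : Z.lt Z0 2 by [].
have := inb_ln l2P E2 (inb_divn z2 (inb_mul li vi)); rewrite zr2 => -[_ h].
by rewrite invfM mulrA mulrAC.
Qed.

Lemma bpot_edgeP a u : Z.lt Z0 (blo (brad (mk_barc a))) ->
  bpot_edge l2 (mk_barc a) = Some u ->
  inb u (itv_pot (rmid a) (rrad a) (rcoef a) (rmid a + rrad a)).
Proof.
move=> l0; rewrite /bpot_edge; case E2 : bln => [L|//] /Some_inj <-.
have li : inb (brad (mk_barc a)) (rrad a) by exact: bradP.
have r0 : 0 < rrad a by exact: (@inb_lt _ ball0 _ _ _ l0 (inb0 R) li).
rewrite itv_pot_edge//; apply: inb_sub; last exact: inb_horner (bserP a) (inb1 R).
apply: inb_mul; first exact: bautoP.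
have z2 : Z.lt Z0 2 by [].
by have := inb_ln l2P E2 (inb_divn z2 li); rewrite zr2 => -[_].
Qed.

Lemma blnabsP bx x u : blnabs l2 bx = Some u -> inb bx x -> inb u (ln `|x|).
Proof.
rewrite /blnabs => E ax; have h : Z.lt Z0 (blo (babs bx)).
  exact: bln_pos E.
by have [] := inb_ln l2P E (inb_abs ax h).
Qed.

End arc_soundness.

(* Bounds for cosine sums, moments and tails *)
End BallFunctions.
Export BallFunctions.

Module BallSeries.

Definition bsum (bs : seq ball44) : ball44 := foldr badd ball0 bs.

Fixpoint bmuls (xs ys : seq ball44) : seq ball44 :=
  match xs, ys with x :: xs', y :: ys' => bmul x y :: bmuls xs' ys' | _, _ => [::] end.

Fixpoint badds (xs ys : seq ball44) : seq ball44 :=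
  match xs, ys with x :: xs', y :: ys' => badd x y :: badds xs' ys' | _, _ => [::] end.

Definition bcoef (Lam : ball44) (A st : seq ball44) (half : ball44) (n : nat) : ball44 :=
  badd (badd (bmul Lam (nth ball0 A n.+1)) (bsum st)) (if n is O then half else ball0).

(** The state carries weight times power of the Joukowski parameter for each charge, at one
    multiplication per order; the accumulator is rounded up. The final state is reused for the
    tail. *)
Fixpoint bosc (Lam : ball44) (A om st0 : seq ball44) (half : ball44) (M : nat) :
    Z * seq ball44 :=
  if M is n.+1 then
    let: (acc, st) := bosc Lam A om st0 half n in
    let st' := bmuls st om in
    (Z.add acc (zdiv_up (Z.mul 4 (bbound (bcoef Lam A st' half n))) (Z.of_nat n.+1)), st')
  else (Z0, st0).

Definition zmax (bs : seq ball44) : Z := foldr (fun b m => Z.max (bbound b) m) Z0 bs.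
Definition zbsum (bs : seq ball44) : Z := foldr (fun b m => Z.add (bbound b) m) Z0 bs.

Definition btail (mx s : Z) : Z :=
  zdiv_up (Z.mul (Z.mul 4 s) (Z.mul one44 one44))
    (Z.mul (Z.sub one44 mx) (Z.sub one44 mx)).

(** Chebyshev values through T_2m = 2 T_m^2 - 1 and T_(2m+1) = 2 T_m T_(m+1) - z. The index is
    halved at each use, so errors pass through logarithmically many products. *)
Fixpoint bcheb (z : ball44) (n : nat) : seq ball44 :=
  if n is n'.+1 then
    let ts := bcheb z n' in
    let a := nth ball0 ts n./2 in
    rcons ts (if n' is O then z else
      if odd n then bsub (bscale 2 (bmul a (nth ball0 ts n./2.+1))) z
      else bsub (bscale 2 (bmul a a)) ball1)
  else [:: ball1].

Definition bmoments (N : nat) (nd : seq (ball44 * ball44)) : seq ball44 :=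
  foldr (fun p acc => badds (map (bmul p.1) (bcheb p.2 N)) acc) (nseq N.+1 ball0) nd.

(** The second component is an upper rounding of rho^N, kept for the tail in [far_eps]. *)
Fixpoint bfar (A T : seq ball44) (rho : Z) (N : nat) : Z * Z :=
  if N is n.+1 then
    let: (acc, rp) := bfar A T rho n in
    let rp' := zdiv_up (Z.mul rp rho) one44 in
    (Z.add acc (zdiv_up
       (Z.mul (Z.mul 2 rp') (bbound (bsub (nth ball0 T n.+1) (nth ball0 A n.+1))))
       (Z.mul (Z.of_nat n.+1) one44)), rp')
  else (Z0, one44).

#[local] Arguments Z.mul : simpl never.
#[local] Arguments Z.add : simpl never.
#[local] Arguments Z.sub : simpl never.
#[local] Arguments Z.div : simpl never.
#[local] Arguments Z.max : simpl never.
#[local] Arguments Z.of_nat : simpl never.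

Lemma one44_gt0 : Z.lt Z0 one44. Proof. by []. Qed.

#[local] Opaque one44 bmul bsqrt binv bdy bdivn badd bsub bopp bln bhorner bbound bscale.

Section series_soundness.
Variable R : realType.
Local Notation zr := (@zr R).
Local Notation S44 := (@S44 R).

Lemma zr_div_up a b : Z.lt Z0 b -> zr a / zr b <= zr (zdiv_up a b).
Proof.
move=> b0; have b0' : 0 < zr b by rewrite -(zr0 R) zr_lt.
by rewrite ler_pdivrMr// /zdiv_up zrD zr1; have /andP[_ /ltW] := zr_div R a b0.
Qed.

Lemma bsumP bs (xs : seq R) : inbs bs xs -> inb (bsum bs) (\sum_(x <- xs) x).
Proof.
elim: bs xs => [|b bs IH] [|x xs]//=; first by rewrite big_nil => _; exact: inb0.
by case=> bx /IH h; rewrite big_cons; exact: inb_add.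
Qed.

Lemma bmulsP (I : Type) (l : seq I) (f g : I -> R) xs ys :
  inbs xs (map f l) -> inbs ys (map g l) -> inbs (bmuls xs ys) [seq f i * g i | i <- l].
Proof.
elim: l xs ys => [|i l IH] [|x xs] [|y ys]//= [h1 h2] [h3 h4]; split; first exact: inb_mul.
exact: IH.
Qed.

Lemma baddsP (I : Type) (l : seq I) (f g : I -> R) xs ys :
  inbs xs (map f l) -> inbs ys (map g l) -> inbs (badds xs ys) [seq f i + g i | i <- l].
Proof.
elim: l xs ys => [|i l IH] [|x xs] [|y ys]//= [h1 h2] [h3 h4]; split; first exact: inb_add.
exact: IH.
Qed.

Lemma boscP (P : seq R) (l Lam : R) (at_ : seq (R * R)) bLam A om st0 half M acc st :
  inb bLam Lam -> (forall n, inb (nth ball0 A n) (autocorr P n)) ->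
  inbs om [seq a.2 | a <- at_] -> inbs st0 [seq a.1 | a <- at_] -> inb half (l / 2) ->
  bosc bLam A om st0 half M = (acc, st) ->
  inbs st [seq a.1 * a.2 ^+ M | a <- at_] /\
  \sum_(n < M) 4 / n.+1%:R * `|arc_coef P l Lam at_ n| <= zr acc / S44.
Proof.
move=> LP AP omP stP hP; elim: M acc st => [|M IH] acc st.
  move=> /= /pair_equal_spec[<- <-]; rewrite big_ord0 zr0 mul0r; split=> //.
  by rewrite (eq_map (fun a => congr1 (fun u => a.1 * u) (expr0 a.2))) (eq_map (fun a => mulr1 a.1)).
rewrite [bosc _ _ _ _ _ _]/=; case E : bosc => [acc' st'] /pair_equal_spec[<- <-].
have [h1 h2] := IH _ _ E.
have h3 : inbs (bmuls st' om) [seq a.1 * a.2 ^+ M.+1 | a <- at_].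
  have := bmulsP h1 omP; congr (inbs _ _); apply: eq_map => a /=.
  by rewrite exprSr mulrA.
split=> //; rewrite big_ord_recr/= [zr (Z.add _ _)]zrD [X in _ <= X]mulrDl lerD//.
have cP : inb (bcoef bLam A (bmuls st' om) half M) (arc_coef P l Lam at_ M).
  rewrite /bcoef /arc_coef; apply: inb_add.
    apply: inb_add; first by apply: inb_mul.
    by have := bsumP h3; rewrite big_map.
  by case: (M) => [|m]; [rewrite mul1r|rewrite mul0r; exact: inb0].
have n0 : Z.lt Z0 (Z.of_nat M.+1) by lia.
rewrite ler_pdivlMr ?S44_gt0//.
apply: le_trans (zr_div_up _ n0); rewrite zrM zr_nat.
have z4 : zr 4 = 4 by rewrite zrE.
rewrite z4 -[4 / _ * _]mulrA -[_ * _ * S44]mulrA -[_ * zr _ / _]mulrA ler_wpM2l//.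
rewrite -mulrA [_^-1 * _]mulrC ler_wpM2r ?invr_ge0//.
by have := inb_bound cP; rewrite ler_pdivlMr ?S44_gt0.
Qed.

Lemma zmaxP bs (xs : seq R) : inbs bs xs -> forall x, x \in xs -> `|x| <= zr (zmax bs) / S44.
Proof.
elim: bs xs => [|b bs IH] [|y ys]//= [h1 h2] x; rewrite inE => /orP[/eqP->|xs].
  rewrite (le_trans (inb_bound h1))// ler_pM2r ?invr_gt0 ?S44_gt0// zr_le//; lia.
by rewrite (le_trans (IH _ h2 _ xs))// ler_pM2r ?invr_gt0 ?S44_gt0// zr_le//; lia.
Qed.

Lemma zbsumP bs (xs : seq R) : inbs bs xs -> \sum_(x <- xs) `|x| <= zr (zbsum bs) / S44.
Proof.
elim: bs xs => [|b bs IH] [|y ys]//=; first by rewrite big_nil zr0 mul0r.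
case=> h1 h2; rewrite big_cons zrD mulrDl lerD//; [exact: inb_bound|exact: IH].
Qed.

Lemma btailP mx s (r t : R) : Z.lt mx one44 -> 0 <= r -> r <= zr mx / S44 -> 0 <= t ->
  t <= zr s / S44 -> 4 * t / (1 - r) ^+ 2 <= zr (btail mx s) / S44.
Proof.
move=> mx1 r0 rm t0 ts; have S0 := S44_gt0 R.
have d0' : Z.lt Z0 (Z.sub one44 mx) by apply/Z.lt_0_sub.
have d0 : 0 < zr (Z.sub one44 mx) by rewrite -(zr0 R) zr_lt.
have dd : Z.lt Z0 (Z.mul (Z.sub one44 mx) (Z.sub one44 mx)) by exact: Z.mul_pos_pos.
have dE : zr (Z.sub one44 mx) / S44 <= 1 - r.
  by rewrite zrB mulrBl divff ?gt_eqF// lerD2l lerN2.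
have dp : 0 < zr (Z.sub one44 mx) / S44 by rewrite divr_gt0.
have z4 : zr 4 = 4 by rewrite zrE.
rewrite ler_pdivlMr//; apply: le_trans (zr_div_up _ dd).
rewrite [zr (Z.mul (Z.mul 4 s) _)]zrM [zr (Z.mul 4 s)]zrM z4.
rewrite [zr (Z.mul one44 one44)]zrM [zr (Z.mul (Z.sub _ _) _)]zrM.
rewrite -[zr one44]/S44.
have -> : 4 * zr s * (S44 * S44) / (zr (Z.sub one44 mx) * zr (Z.sub one44 mx)) =
   4 * (zr s / S44) / (zr (Z.sub one44 mx) / S44) ^+ 2 * S44.
  move: (zr s) (zr _) d0 S44 S0 => u v v0 w w0; clear -v0 w0.
  by field; rewrite !gt_eqF.
rewrite ler_wpM2r ?(ltW S0)//; apply: ler_pM; rewrite ?mulr_ge0 ?invr_ge0 ?exprn_ge0//.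
- by rewrite (le_trans (ltW dp)).
- by rewrite ler_wpM2l.
- rewrite lef_pV2 ?posrE ?exprn_gt0// ?(lt_le_trans dp)//.
  by rewrite lerXn2r ?nnegrE// ltW// (lt_le_trans dp).
Qed.

Lemma arc_tailP (at_ : seq (R * R)) om st M : (forall a, a \in at_ -> 0 <= a.1) ->
  inbs om [seq a.2 | a <- at_] -> inbs st [seq a.1 * a.2 ^+ M.+1 | a <- at_] ->
  Z.lt (zmax om) one44 -> arc_tail at_ M <= zr (btail (zmax om) (zbsum st)) / S44.
Proof.
move=> a0 omP stP mx; have S0 := S44_gt0 R.
have mE := zmaxP omP; have sE := zbsumP stP; set r := zr (zmax om) / S44.
have r0 : 0 <= r.
  rewrite divr_ge0 ?(ltW S0)//; apply: zr_ge0; elim: (om) => //= b bs IH.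
  by apply: Z.le_trans IH _; lia.
have r1 : 0 < 1 - r by rewrite subr_gt0 /r ltr_pdivrMr// mul1r; apply: zr_lt.
apply: le_trans (btailP mx r0 (lexx _) _ sE); last by apply: sumr_ge0 => x _.
rewrite /arc_tail big_map mulr_sumr mulr_suml !big_seq; apply: ler_sum => a aP.
have a2 : `|a.2| <= r by apply: mE; exact: map_f.
rewrite normrM (ger0_norm (a0 _ aP)) normrX.
have -> : a.1 * (4 * `|a.2| ^+ M.+1 / (1 - `|a.2|) ^+ 2) =
   4 * (a.1 * `|a.2| ^+ M.+1) / (1 - `|a.2|) ^+ 2 
  by move: (_ ^+ M.+1) (_ ^- 2) (a.1) => u v w; ring.
have d1 : 0 < 1 - `|a.2| by rewrite (lt_le_trans r1)// lerD2l lerN2.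
rewrite ler_wpM2l ?mulr_ge0 ?(a0 _ aP)//.
by rewrite lef_pV2 ?posrE ?exprn_gt0// lerXn2r ?nnegrE ?(ltW r1) ?(ltW d1)// lerD2l lerN2.
Qed.

Lemma bchebP bz (z : R) n : inb bz z -> `|z| <= 1 ->
  inbs (bcheb bz n) [seq cos (i%:R * acos z) | i <- iota 0 n.+1].
Proof.
move=> zP z1; elim: n => [|n IH].
  by rewrite /= mul0r cos0; split=> //; exact: inb1.
have rc bs (xs : seq R) b x : inbs bs xs -> inb b x -> inbs (rcons bs b) (rcons xs x).
  by elim: bs xs => [|c bs IHb] [|y ys]//= [h1 h2] h3; split => //; exact: IHb.
have T i : (i <= n)%nat -> inb (nth ball0 (bcheb bz n) i) (cos (i%:R * acos z)).
  move=> i_n; have := inbs_nth IH i.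
  by rewrite (nth_map 0) ?size_iota// nth_iota.
rewrite -[n.+2]addn1 iotaD map_cat cats1 add0n; apply: rc => //.
have cc (u v : R) : 2 * (cos u * cos v) - cos (v - u) = cos (u + v).
  by rewrite cosB cosD; ring.
case: n IH T => [|n] IH T; first by rewrite mul1r acosP.
set m := n.+2./2.
have nE : n.+2 = (odd n + m + m)%nat by rewrite -[LHS]odd_double_half -addnn addnA /= negbK.
have mn : (m <= n.+1)%nat by rewrite /m -ltnS ltn_half_double -addnn; lia.
case: ifP => od.
  have on : odd n by move: od; rewrite /= negbK.
  have mn' : (m.+1 <= n.+1)%nat by move: nE; rewrite on; lia.
  have zE : z = cos (m.+1%:R * acos z - m%:R * acos z).
    by rewrite -mulrBl -natr1 addrAC subrr add0r mul1r acosP.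
  have K : 2 * (cos (m%:R * acos z) * cos (m.+1%:R * acos z)) - z = cos (n.+2%:R * acos z).
    rewrite [X in _ - X]zE cc -mulrDl -natrD; congr (cos (_%:R * _)).
    by move: nE; rewrite on; lia.
  by have := inb_sub (inb_scale 2 (inb_mul (T _ mn) (T _ mn'))) zP; rewrite zr2 K.
have on : odd n = false by move: od; rewrite /= negbK.
have := inb_sub (inb_scale 2 (inb_mul (T _ mn) (T _ mn))) (inb1 R).
rewrite zr2; congr (inb _ _).
have := cc (m%:R * acos z) (m%:R * acos z); rewrite subrr cos0 => ->.
by rewrite -mulrDl -natrD nE on.
Qed.

Lemma bmomentsP N (bnd : seq (ball44 * ball44)) (nd : seq (R * R)) :
  inbs (unzip1 bnd) (unzip1 nd) -> inbs (unzip2 bnd) (unzip2 nd) ->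
  (forall q, q \in nd -> `|q.2| <= 1) ->
  inbs (bmoments N bnd) [seq \sum_(q <- nd) q.1 * cos (i%:R * acos q.2) | i <- iota 0 N.+1].
Proof.
have Z (l : seq nat) (f : nat -> R) : (forall i, f i = 0) ->
    inbs (nseq (size l) ball0) (map f l).
  by move=> f0; elim: l => //= i l IHl; split=> //; rewrite f0; exact: inb0.
elim: bnd nd => [|b bnd IH] [|q nd]; [|by case|by case|].
  move=> _ _ _; rewrite -[bmoments N [::]]/(nseq N.+1 ball0) -{1}(size_iota 0 N.+1).
  by apply: Z => i; rewrite big_nil.
move=> [h1 h2] [h3 h4] hq.
have -> : [seq \sum_(q0 <- q :: nd) q0.1 * cos (i%:R * acos q0.2) | i <- iota 0 N.+1] =
  [seq q.1 * cos (i%:R * acos q.2) + \sum_(q0 <- nd) q0.1 * cos (i%:R * acos q0.2)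
    | i <- iota 0 N.+1] by apply: eq_map => i; rewrite big_cons.
change (inbs (badds (map (bmul b.1) (bcheb b.2 N)) (bmoments N bnd))
  [seq q.1 * cos (i%:R * acos q.2) + \sum_(q0 <- nd) q0.1 * cos (i%:R * acos q0.2)
    | i <- iota 0 N.+1]).
apply: baddsP; last by apply: IH => // q' q'nd; apply: hq; rewrite inE q'nd orbT.
have := bchebP N h3 (hq _ (mem_head _ _)).
elim: (bcheb b.2 N) (iota 0 N.+1) => [|c cs IHc] [|i l]//= [k1 k2]; split; first exact: inb_mul.
exact: IHc.
Qed.

Lemma bfarP (A_ T_ : nat -> R) A T rho N acc rp :
  (forall n, inb (nth ball0 A n) (A_ n)) ->
  (forall n, (n <= N)%nat -> inb (nth ball0 T n) (T_ n)) -> Z.le Z0 rho ->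
  bfar A T rho N = (acc, rp) ->
  [/\ (zr rho / S44) ^+ N <= zr rp / S44 & 
   \sum_(n < N) 2 / n.+1%:R * (zr rho / S44) ^+ n.+1 * `|T_ n.+1 - A_ n.+1| <= zr acc / S44].
Proof.
move=> AP TP r0; have S0 := S44_gt0 R.
elim: N acc rp TP => [|N IH] acc rp TP.
  move=> /= /pair_equal_spec[<- <-]; rewrite big_ord0 zr0 mul0r; split=> //.
  by rewrite expr0 divff// gt_eqF.
rewrite [bfar _ _ _ _]/=; case E : bfar => [acc' rp'] /pair_equal_spec[<- <-].
have [h1 h2] := IH _ _ (fun n nN => TP n (leqW nN)) E.
have one0 := one44_gt0.
have h3 : (zr rho / S44) ^+ N.+1 <= zr (zdiv_up (Z.mul rp' rho) one44) / S44.
  rewrite exprSr (@le_trans _ _ (zr rp' / S44 * (zr rho / S44)))//.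
    by rewrite ler_wpM2r ?divr_ge0 ?(ltW S0)//; exact: zr_ge0.
  rewrite mulrACA -[zr rp' * _]zrM [X in X <= _]mulrA ler_pM2r ?invr_gt0//.
  exact: zr_div_up.
split => //; rewrite big_ord_recr/= [zr (Z.add _ _)]zrD [X in _ <= X]mulrDl lerD//.
have n0 : Z.lt Z0 (Z.mul (Z.of_nat N.+1) one44) by apply: Z.mul_pos_pos => //; lia.
rewrite ler_pdivlMr//; apply: le_trans (zr_div_up _ n0).
have dP := inb_bound (inb_sub (TP _ (leqnn _)) (AP N.+1)).
rewrite [zr (Z.mul (Z.mul 2 _) _)]zrM [zr (Z.mul 2 _)]zrM [zr (Z.mul _ one44)]zrM zr2 zr_nat -/S44.
set X := zr (zdiv_up _ _) in h3 *; set Y := zr (bbound _) in dP *.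
have -> : 2 * X * Y / (N.+1%:R * S44) = 2 / N.+1%:R * (X / S44) * (Y / S44) * S44.
  have F (u v w i : R) : w != 0 -> i != 0 ->
    2 * u * v / (i * w) = 2 / i * (u / w) * (v / w) * w.
    by move=> w0 i0; field; rewrite w0 i0.
  by rewrite F ?pnatr_eq0 ?gt_eqF.
rewrite ler_wpM2r ?(ltW S0)//.
have q0 : 0 <= zr rho / S44 by rewrite divr_ge0 ?(ltW S0)//; exact: zr_ge0.
apply: ler_pM => //; first by rewrite !mulr_ge0 ?invr_ge0 ?exprn_ge0.
by rewrite ler_wpM2l// divr_ge0.
Qed.

End series_soundness.

End BallSeries.
Export BallSeries.

(** * Oscillation on an arc and replacement of far arcs by charges *)

Module BallPotential.

#[local] Arguments Z.mul : simpl never.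
#[local] Arguments Z.add : simpl never.
#[local] Arguments Z.sub : simpl never.
#[local] Arguments Z.div : simpl never.
#[local] Arguments Z.max : simpl never.
#[local] Arguments Z.of_nat : simpl never.
#[local] Arguments Z.abs : simpl never.

Definition zsumZ (l : seq Z) : Z := foldr Z.add Z0 l.
(** Stored weights are multiples of 2^-40; the shift by 34 brings them to the scale 2^-74 of the
    autocorrelations, so that the total mass is matched exactly, as [far_field] requires. *)
Definition zwts (a : zarc) : seq Z :=
  let t := map (fun w => Z.shiftl w 34) (zwt a) in
  Z.sub (zauto (zcoef a) 0) (zsumZ t) :: t.
Definition znodes (a : zarc) : seq (Z * Z) := zip (zwts a) (znode a).
Definition bnodes (a : zarc) := [seq (bdy 74 q.1, bdy 40 q.2) | q <- znodes a].

Definition nodes_ok (a : zarc) : bool :=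
  [&& all (fun q => Z.leb Z0 q.1 && Z.leb (Z.abs q.2) (Z.pow 2 40)) (znodes a),
      Z.eqb (zsumZ (unzip1 (znodes a))) (zauto (zcoef a) 0),
      Z.ltb Z0 (zrad a) & Z.ltb Z0 (blo (brad (mk_barc a)))].

Definition zarc0 := ZArc Z0 Z0 [::] [::] [::] (Z0, Z0) (Z0, Z0).
Definition others (n k : nat) := [seq j <- iota 0 n | j != k].

Definition bsrcj (bLam : ball44) (a : zarc) : seq (ball44 * ball44) :=
  let b := mk_barc a in
  [seq (bmul bLam (bdy 74 q.1), badd (bmid b) (bmul (brad b) (bdy 40 q.2))) | q <- znodes a].

Definition bsrc (bLam : ball44) (zs : seq zarc) (rl : seq (Z * ball44)) (k : nat) :=
  flatten [seq bsrcj bLam (nth zarc0 zs j) | j <- others (size zs) k] ++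
  [seq (bdy 40 q.1, q.2) | q <- rl].

(** Bounds the oscillation on arc k when every other arc is replaced by its nodes, so that nodes and
    roots are treated alike as point charges. At least 37 orders are kept, even for shorter
    coefficient lists, since the charges have infinite series. *)
Definition arc_eps (bLam : ball44) (zs : seq zarc) (rl : seq (Z * ball44)) (k : nat) :
    option Z :=
  let a := nth zarc0 zs k in
  let b := mk_barc a in
  let src := bsrc bLam zs rl k in
  if omaps (bjouk b) (unzip2 src) is Some vo then
    let om := unzip2 vo in
    let: (acc, st) := bosc bLam (bauto b) om (unzip1 src) (bdivn (brad b) 2)
                        (maxn (size (zcoef a)) 37) in
    if Z.ltb (zmax om) one44 then
      Some (Z.add acc (Z.mul 2 (btail (zmax om) (zbsum (bmuls st om)))))
    else None
  else None.

Definition bedge (a : zarc) (r : bool) : ball44 :=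
  bdy 40 (if r then Z.add (zmid a) (zrad a) else Z.sub (zmid a) (zrad a)).

(** The error of replacing arc j by its nodes, valid on all other arcs at once: rho is the largest
    Joukowski modulus at their edges, and the modulus decreases away from arc j. *)
Definition far_eps (N : nat) (zs : seq zarc) (j : nat) : option Z :=
  let a := nth zarc0 zs j in
  let b := mk_barc a in
  if omaps (bjouk b) (flatten [seq [:: bedge (nth zarc0 zs k) false; bedge (nth zarc0 zs k) true]
                              | k <- others (size zs) j]) is Some vo then
    let rho := zmax (unzip2 vo) in
    if Z.ltb rho one44 && (size (zcoef a) <= N)%nat then
      let: (acc, rp) := bfar (bauto b) (bmoments N (bnodes a)) rho N in
      Some (Z.add acc
        (btail rho (zdiv_up (Z.mul (bbound (nth ball0 (bauto b) 0)) rp) one44)))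
    else None
  else None.

#[local] Opaque zr one44 bmul bsqrt binv bdy bdivn badd bsub bopp bln bhorner bbound bscale btail.

Lemma norm_edge_left (R : realType) (ma la mb lb y : R) : 0 < la -> ma + la < mb - lb ->
  - lb <= y - mb -> `|mb - lb - ma| <= `|y - ma|.
Proof. by move=> *; rewrite !ger0_norm; lra. Qed.

Lemma norm_edge_right (R : realType) (ma la mb lb y : R) : 0 < la -> mb + lb < ma - la ->
  y - mb <= lb -> `|mb + lb - ma| <= `|y - ma|.
Proof. by move=> *; rewrite !ler0_norm; lra. Qed.

Section arc_check.
Variable R : realType.
Local Notation zr := (@zr R).
Local Notation S44 := (@S44 R).
Local Notation dy := (@dy R).
Local Notation rmid := (@rmid R).
Local Notation rrad := (@rrad R).
Local Notation rcoef := (@rcoef R).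
Implicit Types (a : zarc) (x : R).

Definition rnodes a : seq (R * R) := [seq (dy 74 q.1, dy 40 q.2) | q <- znodes a].

Lemma rnodesP a : nodes_ok a ->
  [/\ 0 < rrad a, Z.lt Z0 (blo (brad (mk_barc a))),
    (forall q, q \in rnodes a -> 0 <= q.1 /\ `|q.2| <= 1) &
    \sum_(q <- rnodes a) q.1 = autocorr (rcoef a) 0].
Proof.
move=> /and4P[/allP nd /Z.eqb_spec sm /Z.ltb_lt l0 /Z.ltb_lt b0]; split=> //.
- exact: dy_gt0.
- move=> q /mapP[p /nd /andP[/Z.leb_le h1 /Z.leb_le h2] ->] /=; split.
    exact: dy_ge0.
  have q0 : 0 < zr (Z.pow 2 40) by exact: (@pow2_gt0 R 40).
  rewrite normrM normfV (gtr0_norm q0) -zr_abs ler_pdivrMr// mul1r; exact: zr_le.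
- rewrite autocorr_dy -sm big_map; elim: (znodes a) => [|p l IH].
    by rewrite big_nil /dy zr0 mul0r.
  by rewrite big_cons IH -dyD.
Qed.

Variables (Lam : R) (bLam : ball44) (zs : seq zarc) (rl : seq (Z * ball44)) (rr : seq R).
Hypotheses (LP : inb bLam Lam) (Lam0 : 0 <= Lam) (rrP : inbs (unzip2 rl) rr).
Hypothesis zsP : forall j, (j < size zs)%nat -> nodes_ok (nth zarc0 zs j).
Hypothesis rl0 : forall q, q \in rl -> Z.le Z0 q.1.

Definition rsrcj a : seq (R * R) :=
  [seq (Lam * q.1, rmid a + rrad a * q.2) | q <- rnodes a].

Definition rsrc (k : nat) : seq (R * R) :=
  flatten [seq rsrcj (nth zarc0 zs j) | j <- others (size zs) k] ++
  [seq (dy 40 q.1.1, q.2) | q <- zip rl rr].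

Lemma inbs_cat bs bs' (xs xs' : seq R) : inbs bs xs -> inbs bs' xs' ->
  inbs (bs ++ bs') (xs ++ xs').
Proof. by elim: bs xs => [|b bs IH] [|x xs]//= [h1 h2] h; split=> //; exact: IH. Qed.

Lemma othersP n k j : j \in others n k -> (j < n)%nat /\ j != k.
Proof. by rewrite mem_filter mem_iota add0n => /andP[-> /andP[_ ->]]. Qed.

Lemma bsrcP k : inbs (unzip1 (bsrc bLam zs rl k)) (unzip1 (rsrc k)) /\
  inbs (unzip2 (bsrc bLam zs rl k)) (unzip2 (rsrc k)).
Proof.
rewrite /bsrc /rsrc /unzip1 /unzip2 !map_cat; split; apply: inbs_cat.
- elim: (others _ _) => //= j l IH; rewrite !map_cat; apply: inbs_cat => //.
  rewrite -!map_comp; apply: inbs_map => q _ /=.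
  by apply: inb_mul => //; exact: inb_dy.
- rewrite -!map_comp; move: rrP; clear.
  elim: rl rr => [|q l IH] [|r rs]//= [h1 h2]; split; [exact: inb_dy|exact: IH].
- elim: (others _ _) => //= j l IH; rewrite !map_cat; apply: inbs_cat => //.
  rewrite -!map_comp; apply: inbs_map => q _ /=; apply: inb_add; first exact: bmidP.
  by apply: inb_mul; [exact: bradP|exact: inb_dy].
- rewrite -!map_comp; move: rrP; clear.
  by elim: rl rr => [|q l IH] [|r rs]//= [h1 h2]; split=> //; exact: IH.
Qed.

Lemma rsrc_ge0 k p : p \in rsrc k -> 0 <= p.1.
Proof.
rewrite mem_cat => /orP[/flattenP[l /mapP[j jk ->] /mapP[q qn ->]]|/mapP[q qz ->]] /=.
  have [jn _] := othersP jk; have [_ _ H _] := rnodesP (zsP jn).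
  by rewrite mulr_ge0//; have [] := H _ qn.
apply: dy_ge0 => //; apply: rl0.
have : q.1 \in unzip1 (zip rl rr) by exact: map_f.
by rewrite unzip1_zip// -(inbs_size rrP) size_map.
Qed.

Lemma omaps_joukP a bs (ys : seq R) vo : Z.lt Z0 (blo (brad (mk_barc a))) ->
  inbs bs ys -> omaps (bjouk (mk_barc a)) bs = Some vo ->
  (forall y, y \in ys -> 1 < `|(y - rmid a) / rrad a|) /\
  inbs (unzip2 vo) [seq jouk ((y - rmid a) / rrad a) | y <- ys].
Proof.
move=> b0; elim: bs ys vo => [|b bs IH] [|y ys] vo //=; first by move=> _ [<-].
case=> h1 h2; case E : bjouk => [[v o]|//]; case E2 : omaps => [w|//] /Some_inj <-.
have [k1 _ k2] := bjoukP b0 h1 E; have [k3 k4] := IH _ _ h2 E2.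
by split=> // z; rewrite inE => /orP[/eqP->//|]; exact: k3.
Qed.

Lemma unjouk_jouk (m l y : R) : 0 < l -> 1 < `|(y - m) / l| -> unjouk m l (jouk ((y - m) / l)) = y.
Proof.
move=> l0 /joukP[_ _ _ E]; rewrite /unjouk E mulrC divfK ?gt_eqF//.
by rewrite addrC subrK.
Qed.

#[local] Opaque bosc bfar omaps bmoments.

Definition arc_part k x := let a := nth zarc0 zs k in
  x - Lam * itv_pot (rmid a) (rrad a) (rcoef a) x - \sum_(p <- rsrc k) p.1 * ln `|x - p.2|.

Lemma arc_epsP k e x x' : (k < size zs)%nat -> arc_eps bLam zs rl k = Some e ->
  `|x - rmid (nth zarc0 zs k)| <= rrad (nth zarc0 zs k) ->
  `|x' - rmid (nth zarc0 zs k)| <= rrad (nth zarc0 zs k) ->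
  `|arc_part k x - arc_part k x'| <= zr e / S44.
Proof.
move=> kn; rewrite /arc_eps /arc_part; set a := nth zarc0 zs k.
have [l0 b0 _ _] := rnodesP (zsP kn); have [s1 s2] := bsrcP k.
case E : (omaps _ _) => [vo|]; last by move=> H; discriminate H.
case E2 : (bosc _ _ _ _ _ _) => [acc st].
case: (Z.ltb_spec (zmax _) _) => [mx|_ H]; last by discriminate H.
move=> /Some_inj <- xl xl'; have [z1 omP] := omaps_joukP b0 s2 E.
pose at_ := [seq (p.1, jouk ((p.2 - rmid a) / rrad a)) | p <- rsrc k].
have E1 : [seq p.1 | p <- at_] = unzip1 (rsrc k) by rewrite -map_comp.
have E3 : [seq p.2 | p <- at_] = [seq jouk ((y - rmid a) / rrad a) | y <- unzip2 (rsrc k)].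
  by rewrite -!map_comp.
have omP' : inbs (unzip2 vo) [seq p.2 | p <- at_] by rewrite E3.
have stP0 : inbs (unzip1 (bsrc bLam zs rl k)) [seq p.1 | p <- at_] by rewrite E1.
have half : inb (bdivn (brad (mk_barc a)) 2) (rrad a / 2).
  by have := @inb_divn R _ _ 2 (erefl : Z.lt Z0 2) (bradP R a); rewrite zr2.
have [stP oscP] := boscP LP (bautoP R a) omP' stP0 half E2.
have atP p : p \in at_ -> 0 <= p.1 /\ 0 < `|p.2| < 1.
  move=> /mapP[q qk ->] /=; split; first exact: rsrc_ge0 qk.
  by have [] := joukP (z1 _ (map_f snd qk)) => -> ->.
have Hsum y : \sum_(p <- rsrc k) p.1 * ln `|y - p.2| =
    \sum_(p <- at_) p.1 * ln `|y - unjouk (rmid a) (rrad a) p.2|.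
  rewrite big_map !big_seq; apply: eq_bigr => p pk /=.
  by rewrite (unjouk_jouk l0 (z1 _ (map_f snd pk))).
rewrite !Hsum.
apply: (le_trans (arc_oscillation Lam l0 (_ : size (rcoef a) <= maxn (size (zcoef a)) 37)%nat _ atP xl xl')).
- by rewrite size_rcoef leq_maxl.
- by rewrite leq_max orbT.
rewrite zrD zrM zr2 [X in _ <= X]mulrDl lerD// -mulrA ler_wpM2l//.
apply: (arc_tailP _ omP' _ mx); first by move=> p /atP[].
have := bmulsP stP omP'; congr (inbs _ _); apply: eq_map => p.
by rewrite exprSr mulrA.
Qed.

Lemma jouk_le (z z' : R) : 1 < `|z| -> `|z| <= `|z'| -> `|jouk z'| <= `|jouk z|.
Proof.
move=> z1 zz; have z1' := lt_le_trans z1 zz.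
have [j0 _ _ _] := joukP z1; have [j0' _ _ _] := joukP z1'.
rewrite -lef_pV2 ?posrE// (jouk_inv z1).1 (jouk_inv z1').1 lerD//.
apply: ler_wsqrtr; rewrite lerD2r -(real_normK (num_real z)) -(real_normK (num_real z')).
by rewrite lerXn2r ?nnegrE.
Qed.

Definition apart (i j : nat) : Prop :=
  rmid (nth zarc0 zs i) + rrad (nth zarc0 zs i) < rmid (nth zarc0 zs j) - rrad (nth zarc0 zs j).

Lemma far_epsP N k j e x : (k < size zs)%nat -> (j < size zs)%nat -> k != j ->
  apart j k \/ apart k j -> far_eps N zs j = Some e ->
  `|x - rmid (nth zarc0 zs k)| <= rrad (nth zarc0 zs k) ->
  let a := nth zarc0 zs j in
  `|itv_pot (rmid a) (rrad a) (rcoef a) x -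
    \sum_(q <- rnodes a) q.1 * ln `|x - (rmid a + rrad a * q.2)| | <= zr e / S44.
Proof.
move=> kn jn kj ap; rewrite /far_eps; set a := nth zarc0 zs j; set b := nth zarc0 zs k.
have [l0 b0 ndP sumP] := rnodesP (zsP jn).
set bs := flatten _.
pose redge c (r : bool) : R := dy 40 (if r then Z.add (zmid c) (zrad c) else Z.sub (zmid c) (zrad c)).
pose ys : seq R := flatten [seq [:: redge (nth zarc0 zs i) false; redge (nth zarc0 zs i) true]
  | i <- others (size zs) j].
have bsP : inbs bs ys.
  rewrite /bs /ys; elim: (others _ _) => //= i l IH.
  by split; [exact: inb_dy|split; [exact: inb_dy|exact: IH]].
case E : (omaps _ _) => [vo|]; last by move=> H; discriminate H.
have [z1 omP] := omaps_joukP b0 bsP E.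
case: ifP => [/andP[/Z.ltb_lt r1 PN]|_ H]; last by discriminate H.
case E2 : (bfar _ _ _ _) => [acc rp] /Some_inj <- xl; set rho := zmax (unzip2 vo) in r1 E2 *.
have kin r : redge b r \in ys.
  apply/flattenP; exists [:: redge b false; redge b true].
    by apply/mapP; exists k => //; rewrite mem_filter kj mem_iota add0n.
  by case: r; rewrite !inE eqxx ?orbT.
have S0 := S44_gt0 R.
have rhoP r : `|jouk ((redge b r - rmid a) / rrad a)| <= zr rho / S44.
  by apply: (zmaxP omP); apply: (map_f (fun y => jouk ((y - rmid a) / rrad a))).
have eF : redge b false = rmid b - rrad b by rewrite /redge /rmid /rrad /dy zrB mulrBl.
have eT : redge b true = rmid b + rrad b by rewrite /redge /rmid /rrad /dy zrD mulrDl.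
have [wr zx] : `|jouk ((x - rmid a) / rrad a)| <= zr rho / S44 /\ 1 < `|(x - rmid a) / rrad a|.
  move: xl; rewrite ler_norml => /andP[xl1 xl2].
  (* The edge of arc k facing arc j is closest to it and, by [jouk_le], has the largest Joukowski
     modulus. *)
  have [r rx] : exists r, `|(redge b r - rmid a) / rrad a| <= `|(x - rmid a) / rrad a|.
    case: ap; rewrite /apart -/a -/b => ap; [exists false|exists true];
      rewrite !normrM ler_wpM2r// ?eF ?eT.
      exact: norm_edge_left ap xl1.
    exact: norm_edge_right ap xl2.
  have zr1 := z1 _ (kin r).
  by split; [exact: le_trans (jouk_le zr1 rx) (rhoP r)|exact: lt_le_trans rx].
have [w0 w1 _ _] := joukP zx; set w := jouk _ in wr w0 w1.
rewrite /itv_pot ifN; last first.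
  by rewrite -ltNge; move: zx; rewrite normrM normfV (gtr0_norm l0) ltr_pdivlMr// mul1r.
have rho1 : zr rho / S44 < 1 by rewrite ltr_pdivrMr// mul1r; apply: zr_lt.
have rho0 : Z.le Z0 rho.
  by rewrite /rho; elim: (unzip2 vo) => //= c cs IH; lia.
have := far_field (rrad a) w0 wr rho1 (_ : size (rcoef a) <= N)%nat ndP sumP.
rewrite size_rcoef => /(_ PN).
have -> : \sum_(q <- rnodes a) q.1 * (ln (rrad a / (2 * `|w|)) + ln (1 - 2 * w * q.2 + w ^+ 2)) =
    \sum_(q <- rnodes a) q.1 * ln `|x - (rmid a + rrad a * q.2)|.
  rewrite !big_seq; apply: eq_bigr => q /ndP[_ q1]; congr (_ * _).
  have -> : `|x - (rmid a + rrad a * q.2)| =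
      `|rmid a + rrad a * cos (acos q.2) - unjouk (rmid a) (rrad a) w|.
    by rewrite (acosP q1) distrC /w (unjouk_jouk l0 zx).
  by rewrite ln_dist_unjouk ?w0// (acosP q1).
move=> H; apply: (le_trans H); rewrite zrD [X in _ <= X]mulrDl; clear H.
have TP n : (n <= N)%nat -> inb (nth ball0 (bmoments N (bnodes a)) n)
    (\sum_(q <- rnodes a) q.1 * cos (n%:R * acos q.2)).
  move=> nN; have h1 : inbs (unzip1 (bnodes a)) (unzip1 (rnodes a)).
    by rewrite /unzip1 -!map_comp; apply: inbs_map => q _; exact: inb_dy.
  have h2 : inbs (unzip2 (bnodes a)) (unzip2 (rnodes a)).
    by rewrite /unzip2 -!map_comp; apply: inbs_map => q _; exact: inb_dy.
  have := inbs_nth (bmomentsP N h1 h2 (fun q qn => (ndP q qn).2)) n.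
  by rewrite (nth_map 0) ?size_iota// nth_iota.
have [rpP farP] := bfarP (bautoP R a) TP rho0 E2.
rewrite lerD//.
have A0 := inb_bound (bautoP R a 0).
have r0 : 0 <= zr rho / S44 by rewrite divr_ge0 ?(ltW S0)//; exact: zr_ge0.
rewrite (_ : autocorr _ 0 * _ = 4 * (autocorr (rcoef a) 0 * (zr rho / S44) ^+ N.+1) /
    (1 - zr rho / S44) ^+ 2); last first.
  by move: (_ ^+ N.+1) (_ ^- 2) => u v; ring.
have a0 := autocorr0_ge0 (rcoef a).
apply: btailP => //; first by rewrite mulr_ge0// exprn_ge0.
(* The computed power is rho^N, which is enough for rho^(N+1) because rho < 1. *)
apply: (@le_trans _ _ (zr (bbound (nth ball0 (bauto (mk_barc a)) 0)) / S44 * (zr rp / S44))).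
  apply: ler_pM; rewrite ?exprn_ge0//; first by rewrite (le_trans _ A0)// ler_norm.
  by rewrite (le_trans _ rpP)// exprSr ler_piMr ?exprn_ge0// (ltW rho1).
rewrite mulrACA -zrM [X in X <= _]mulrA ler_pM2r ?invr_gt0//.
by apply: zr_div_up; exact: one44_gt0.
Qed.

End arc_check.

End BallPotential.
Export BallPotential.

(** * The field on arcs and in gaps *)

Module BallField.

#[local] Arguments Z.mul : simpl never.
#[local] Arguments Z.add : simpl never.
#[local] Arguments Z.sub : simpl never.
#[local] Arguments Z.div : simpl never.
#[local] Arguments Z.max : simpl never.
#[local] Arguments Z.of_nat : simpl never.
#[local] Arguments Z.abs : simpl never.

Lemma le0_40 : Z.le Z0 40. Proof. by []. Qed.

(** The index e names the arc whose right edge is the evaluation point, where [bpot_edge] replaces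
    the outer formula; e = [size zs] means a point off all arcs. *)
Definition bG (l2 bLam : ball44) (zs : seq zarc) (rl : seq (Z * ball44)) (e : nat)
    (x : ball44) : option ball44 :=
  if osum (fun j => let b := mk_barc (nth zarc0 zs j) in
             if j == e then bpot_edge l2 b else bpot_out l2 b x) (iota 0 (size zs)) is Some U then
    if osum (fun q : Z * ball44 => if blnabs l2 (bsub x q.2) is Some u
                                   then Some (bmul (bdy 40 q.1) u) else None) rl is Some V then
      Some (bsub (bsub x (bmul bLam U)) V)
    else None
  else None.

Definition broot (rl : seq (Z * ball44)) i : ball44 := nth ball0 (unzip2 rl) i.

(** Roots and arcs interlace, starting with a root: arc i lies between roots i and i+1. This also
    proves the roots distinct. *)
Definition order_ok (zs : seq zarc) (rl : seq (Z * ball44)) : bool :=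
  (size rl == size zs) &&
  all (fun i => all (fun j =>
    if (i < j)%nat then
      Z.ltb (Z.add (zmid (nth zarc0 zs i)) (zrad (nth zarc0 zs i)))
            (Z.sub (zmid (nth zarc0 zs j)) (zrad (nth zarc0 zs j))) &&
      Z.ltb (bhi (bedge (nth zarc0 zs i) true)) (blo (broot rl j))
    else Z.ltb (bhi (broot rl j)) (blo (bedge (nth zarc0 zs i) false)))
    (iota 0 (size zs))) (iota 0 (size zs)).

(** Hypotheses of [convex_gap] at distances t.1 and t.2 beyond the edge b. The test against r keeps
    the farther sample before the next root; [None] is the unbounded gap after the last arc.
    Comparing gam with the first sample provides f 0 <= f t1, as the edge belongs to an arc. *)
Definition gap_ok (l2 bLam : ball44) (zs : seq zarc) (rl : seq (Z * ball44)) (gam low : Z)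
    (b : Z) (sg : bool) (t : Z * Z) (r : option ball44) : bool :=
  let pt u := bdy 40 (if sg then Z.add b u else Z.sub b u) in
  [&& Z.ltb Z0 t.1, Z.leb (Z.mul 2 t.1) t.2,
    (if r is Some c then if sg then Z.ltb (bhi (pt t.2)) (blo c) else Z.ltb (bhi c) (blo (pt t.2))
     else true) &
    if bG l2 bLam zs rl (size zs) (pt t.1) is Some g1 then
      if bG l2 bLam zs rl (size zs) (pt t.2) is Some g2 then
        [&& Z.leb gam (blo g1), Z.leb low gam &
            Z.leb low (Z.sub (Z.mul 2 (blo g1)) (bhi g2))]
      else false
    else false].

(** One field value, at the right edge, plus the oscillation bounds the whole arc. In e + 4 Es the
    factor 4 is Lam <= 2 times the two compared points, at each of which the far arcs were replaced
    by charges. *)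
Definition arc_ok (l2 bLam : ball44) (zs : seq zarc) (rl : seq (Z * ball44)) (gam low : Z)
    (Es : Z) (k : nat) : bool :=
  let a := nth zarc0 zs k in
  [&& nodes_ok a,
    (if arc_eps bLam zs rl k is Some e then
       if bG l2 bLam zs rl k (bedge a true) is Some g then
         let e' := Z.add e (Z.mul 4 Es) in
         Z.leb (Z.add (bhi g) e') gam && Z.leb low (Z.sub (blo g) e')
       else false
     else false),
    gap_ok l2 bLam zs rl gam low (Z.sub (zmid a) (zrad a)) false (zleft a) (Some (broot rl k)) &
    gap_ok l2 bLam zs rl gam low (Z.add (zmid a) (zrad a)) true (zright a)
      (if (k.+1 < size zs)%nat then Some (broot rl k.+1) else None)].

Definition field_ok (l2 : ball44) (zs : seq zarc) (rl : seq (Z * ball44)) (zLam gam low : Z)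
    (N : nat) : bool :=
  [&& order_ok zs rl, Z.leb Z0 zLam, Z.leb zLam (Z.pow 2 41),
    all (fun q => Z.leb Z0 q.1) rl &
    if omaps (far_eps N zs) (iota 0 (size zs)) is Some Es then
      all (Z.leb Z0) Es &&
      all (arc_ok l2 (bdy 40 zLam) zs rl gam low (zsumZ Es)) (iota 0 (size zs))
    else false].

#[local] Opaque zr one44 bmul bsqrt binv bdy bdivn badd bsub bopp bln bhorner bbound bscale btail arc_eps far_eps.

Lemma between_le (R : realType) (c u w z : R) (sg : bool) : 0 <= u -> u <= w ->
  (z <= c -> z <= c + (if sg then 1 else -1) * w -> z <= c + (if sg then 1 else -1) * u) /\
  (c <= z -> c + (if sg then 1 else -1) * w <= z -> c + (if sg then 1 else -1) * u <= z).
Proof. by move=> u0 uw; split; case: sg; lra. Qed.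

Lemma between_lt (R : realType) (c u w z : R) (sg : bool) : 0 <= u -> u <= w ->
  (z < c -> z < c + (if sg then 1 else -1) * w -> z < c + (if sg then 1 else -1) * u) /\
  (c < z -> c + (if sg then 1 else -1) * w < z -> c + (if sg then 1 else -1) * u < z).
Proof. by move=> u0 uw; split; case: sg; lra. Qed.

Lemma secant_ge (R : realType) (a b c d e : R) : c <= a -> b <= d -> e <= 2 * c - d ->
  e <= 2 * a - b.
Proof. by lra. Qed.

Lemma osc_bounds (R : realType) (u v e gam low bh bl : R) : v <= bh -> bl <= v ->
  bh + e <= gam -> low <= bl - e -> - e <= u - v <= e -> low <= u <= gam.
Proof. by move=> h1 h2 h3 h4 /andP[h5 h6]; apply/andP; split; lra. Qed.

Section field_check.
Variable R : realType.
Local Notation zr := (@zr R).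
Local Notation S44 := (@S44 R).
Local Notation dy := (@dy R).
Local Notation rmid := (@rmid R).
Local Notation rrad := (@rrad R).
Local Notation rcoef := (@rcoef R).
Implicit Types (a : zarc) (x : R).
Variables (zs : seq zarc) (rl : seq (Z * ball44)) (rr : seq R) (zLam : Z) (l2 : ball44).
Hypotheses (rrP : inbs (unzip2 rl) rr) (l2P : inb l2 (ln 2 : R)).
Local Notation za j := (nth zarc0 zs j).
Local Notation Lam := (dy 40 zLam).
Local Notation n := (size zs).
Local Notation upot j x := (itv_pot (rmid (za j)) (rrad (za j)) (rcoef (za j)) x).

(** The certificate asks for this field to be at least low off the roots on the half line and at
    most gam on the arcs. *)
Definition rG x : R := x - Lam * (\sum_(j <- iota 0 n) upot j x) -
  \sum_(q <- zip rl rr) dy 40 q.1.1 * ln `|x - q.2|.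

Lemma bGP e bx x g : (forall j, (j < n)%nat -> nodes_ok (za j)) -> inb bx x ->
  ((e < n)%nat -> x = rmid (za e) + rrad (za e)) ->
  bG l2 (bdy 40 zLam) zs rl e bx = Some g -> inb g (rG x).
Proof.
move=> ok bxP xe; rewrite /bG.
case E1 : (osum _ (iota 0 n)) => [U|]; last by move=> H; discriminate H.
case E2 : (osum _ rl) => [V|]; last by move=> H; discriminate H.
move=> /Some_inj <-; rewrite /rG.
have UP : inb U (\sum_(j <- iota 0 n) upot j x).
  apply: (osumP _ E1) => j u; rewrite mem_iota add0n => /andP[_ jn].
  have [l0 b0 _ _] := rnodesP R (ok _ jn).
  case: eqP => [je|_]; last exact: bpot_outP.
  by rewrite (xe _) -?je//; exact: bpot_edgeP.
have VP : inb V (\sum_(q <- zip rl rr) dy 40 q.1.1 * ln `|x - q.2|).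
  move: V rrP E2; clear -bxP l2P; elim: rl rr => [|q l IH] [|r rs] V //=.
    by move=> _ [<-]; rewrite big_nil; exact: inb0.
  case=> h1 h2; case E : (blnabs _ _) => [u|]; last by move=> H; discriminate H.
  case E3 : (osum _ _) => [W|]; last by move=> H; discriminate H.
  move=> /Some_inj <-; rewrite big_cons; apply: inb_add; last exact: IH E3.
  by apply: inb_mul; [exact: inb_dy|exact: (blnabsP l2P E (inb_sub bxP h1))].
by apply: inb_sub => //; apply: inb_sub => //; apply: inb_mul => //; exact: inb_dy.
Qed.

Lemma rG_arc_part k x : (k < n)%nat -> rG x = arc_part Lam zs rl rr k x -
  Lam * \sum_(j <- others n k) (upot j x -
    \sum_(q <- rnodes R (za j)) q.1 * ln `|x - (rmid (za j) + rrad (za j) * q.2)|).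
Proof.
move=> kn; rewrite /rG /arc_part /rsrc big_cat/=.
have -> : \sum_(j <- iota 0 n) upot j x = upot k x + \sum_(j <- others n k) upot j x.
  by rewrite (bigD1_seq k) ?iota_uniq ?mem_iota ?add0n//= big_filter.
rewrite big_flatten big_map [\sum_(i <- map _ (zip _ _)) _]big_map/= sumrB.
have -> : \sum_(j <- others n k) \sum_(p <- rsrcj Lam (za j)) p.1 * ln `|x - p.2| =
  Lam * \sum_(j <- others n k) \sum_(q <- rnodes R (za j))
    q.1 * ln `|x - (rmid (za j) + rrad (za j) * q.2)|.
  rewrite mulr_sumr; apply: eq_bigr => j _; rewrite big_map mulr_sumr.
  by apply: eq_bigr => q _; rewrite mulrA.
move: (\sum_(j <- _) \sum_(q <- _) _) (\sum_(j <- _) upot j x) (\sum_(q <- zip _ _) _) => u v w.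
by ring.
Qed.

Lemma rG_osc k e Es N x x' : (k < n)%nat -> 0 <= Lam <= 2 ->
  (forall j, (j < n)%nat -> nodes_ok (za j)) -> (forall q, q \in rl -> Z.le Z0 q.1) ->
  (forall i j, (i < j)%nat -> (j < n)%nat -> @apart R zs i j) ->
  arc_eps (bdy 40 zLam) zs rl k = Some e -> omaps (far_eps N zs) (iota 0 n) = Some Es ->
  all (Z.leb Z0) Es ->
  `|x - rmid (za k)| <= rrad (za k) -> `|x' - rmid (za k)| <= rrad (za k) ->
  `|rG x - rG x'| <= zr (Z.add e (Z.mul 4 (zsumZ Es))) / S44.
Proof.
move=> kn /andP[L0 L2] ok rl0 ap eE EsE Es0 xl xl'.
have S0 := S44_gt0 R.
have eP := arc_epsP (inb_dy R zLam le0_40) L0 rrP ok rl0 kn eE xl xl'.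
pose del j y := upot j y - \sum_(q <- rnodes R (za j)) q.1 * ln `|y - (rmid (za j) + rrad (za j) * q.2)|.
have dP y : `|y - rmid (za k)| <= rrad (za k) ->
    `|\sum_(j <- others n k) del j y| <= zr (zsumZ Es) / S44.
  move=> yl; apply: (le_trans (ler_norm_sum _ _ _)).
  (* Generalised over the list for induction; nonnegativity of the bounds allows the one of arc k
     itself to be included in the total. *)
  have K (l : seq nat) Fs : (forall j, j \in l -> (j < n)%nat) -> omaps (far_eps N zs) l = Some Fs ->
      all (Z.leb Z0) Fs ->
      \sum_(j <- [seq j <- l | j != k]) `|del j y| <= zr (zsumZ Fs) / S44.
    elim: l Fs => [|j l IH] Fs ln; first by move=> [<-] _; rewrite big_nil zr0 mul0r.
    rewrite [omaps _ _]/=; case E : (far_eps _ _ _) => [f|]; last by move=> H; discriminate H.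
    case E2 : (omaps _ _) => [F|]; last by move=> H; discriminate H.
    move=> /Some_inj <- /= /andP[/Z.leb_le f0 F0]; rewrite zrD [X in _ <= X]mulrDl.
    have IH' := IH _ (fun i il => ln i (mem_behead (s := j :: l) il)) E2 F0.
    have jn := ln _ (mem_head _ _).
    case: ifP => jk; last first.
      by rewrite (le_trans IH')// lerDr divr_ge0 ?(ltW S0)//; exact: zr_ge0.
    have kj' : k != j by rewrite eq_sym jk.
    have ap' : @apart R zs j k \/ @apart R zs k j.
      by case: (ltngtP j k) jk => // h _; [left|right]; apply: ap.
    have H : `|del j y| <= zr f / S44.
      have LP := inb_dy R zLam le0_40.
      exact: (far_epsP LP L0 ok kn jn kj' ap' E yl).
    by rewrite big_cons; apply: lerD; [exact: H|exact: IH'].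
  by apply: (K _ _ _ EsE Es0) => j; rewrite mem_iota add0n => /andP[].
rewrite (rG_arc_part _ kn) (rG_arc_part x' kn) -/(del _ _).
have d1 := dP _ xl; have d2 := dP _ xl'.
move: d1 d2; rewrite -/(\sum_(j <- others n k) del j x).
set D1 := \sum_(j <- others n k) _; set D2 := \sum_(j <- others n k) _ => d1 d2.
set A1 := arc_part _ _ _ _ _ x in eP *; set A2 := arc_part _ _ _ _ _ x' in eP *.
have -> : A1 - Lam * D1 - (A2 - Lam * D2) = (A1 - A2) - Lam * (D1 - D2) by ring.
rewrite (le_trans (ler_normB _ _))// zrD [X in _ <= X]mulrDl lerD// normrM (ger0_norm L0).
rewrite zrM -mulrA (_ : zr 4 = 2 * 2); last by rewrite zrE -natrM.
rewrite -mulrA; apply: ler_pM => //.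
by rewrite (le_trans (ler_normB _ _))// mulrDl mul1r lerD.
Qed.

(** Weak for arcs and strict for roots: the gap starts at an arc edge, where the potential is
    finite, and ends at a root, where the logarithm has its pole. *)
Definition side_ok (b y : R) : Prop :=
  (forall j, (j < n)%nat ->
    (rmid (za j) + rrad (za j) <= b /\ rmid (za j) + rrad (za j) <= y) \/
    (b <= rmid (za j) - rrad (za j) /\ y <= rmid (za j) - rrad (za j))) /\
  (forall r, r \in rr -> (r < b /\ r < y) \/ (b < r /\ y < r)).

Lemma rG_convex x0 x2 s : (forall j, (j < n)%nat -> nodes_ok (za j)) -> 0 <= Lam ->
  (forall q, q \in rl -> Z.le Z0 q.1) -> 0 < s < 1 -> side_ok x0 x2 ->
  rG ((1 - s) * x0 + s * x2) <= (1 - s) * rG x0 + s * rG x2.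
Proof.
move=> ok L0 rl0 s01 [aP rP]; rewrite /rG.
have h1 : (1 - s) * (\sum_(j <- iota 0 n) upot j x0) + s * (\sum_(j <- iota 0 n) upot j x2) <=
    \sum_(j <- iota 0 n) upot j ((1 - s) * x0 + s * x2).
  rewrite !mulr_sumr -big_split !big_seq; apply: ler_sum => j.
  rewrite mem_iota add0n => /andP[_ jn]; have [l0 _ _ _] := rnodesP R (ok _ jn).
  by apply: itv_pot_concave => //; exact: aP.
have h2 : (1 - s) * (\sum_(q <- zip rl rr) dy 40 q.1.1 * ln `|x0 - q.2|) +
     s * (\sum_(q <- zip rl rr) dy 40 q.1.1 * ln `|x2 - q.2|) <=
     \sum_(q <- zip rl rr) dy 40 q.1.1 * ln `|(1 - s) * x0 + s * x2 - q.2|.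
  rewrite !mulr_sumr -big_split !big_seq; apply: ler_sum => q qz.
  have q1 : q.1 \in rl.
    have : q.1 \in unzip1 (zip rl rr) by exact: map_f.
    by rewrite unzip1_zip// -(inbs_size rrP) size_map.
  have q2 : q.2 \in rr.
    have : q.2 \in unzip2 (zip rl rr) by exact: map_f.
    by rewrite unzip2_zip// -(inbs_size rrP) size_map.
  have w0 : 0 <= dy 40 q.1.1 by apply: dy_ge0 => //; exact: rl0.
  rewrite /= mulrCA [s * (_ * _)]mulrCA -mulrDr ler_wpM2l//.
  have /andP[s0 s1] := s01; have s1' : 0 < 1 - s by rewrite subr_gt0.
  have -> : (1 - s) * x0 + s * x2 - q.2 = (1 - s) * (x0 - q.2) + s * (x2 - q.2) by ring.
  have [[ha hb]|[ha hb]] := rP _ q2.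
    have a0 : 0 < x0 - q.2 by rewrite subr_gt0.
    have b0 : 0 < x2 - q.2 by rewrite subr_gt0.
    by rewrite (gtr0_norm a0) (gtr0_norm b0) gtr0_norm ?addr_gt0 ?mulr_gt0// ln_concave.
  have a0 : 0 < q.2 - x0 by rewrite subr_gt0.
  have b0 : 0 < q.2 - x2 by rewrite subr_gt0.
  rewrite (distrC x0) (distrC x2) -[X in _ <= ln X]normrN opprD -!mulrN !opprB.
  by rewrite (gtr0_norm a0) (gtr0_norm b0) gtr0_norm ?addr_gt0 ?mulr_gt0// ln_concave.
move: h1 h2; set u := \sum_(_ <- _) _; set v := \sum_(_ <- _) _; set w := \sum_(_ <- _) _.
set u' := \sum_(_ <- zip _ _) _; set v' := \sum_(_ <- zip _ _) _; set w' := \sum_(_ <- zip _ _) _.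
move=> h1 h2; have := ler_wpM2l L0 h1; move: h2; clear.
move: u v w u' v' w' Lam => u v w u' v' w' L; lra.
Qed.

(** Applies [convex_gap] to the field as a function of the distance from the edge, mirrored when
    [sg] is false. [D] records that the segment from the edge meets no other arc and no root. *)
Lemma gapP gam low b (sg : bool) t r t0 :
  (forall j, (j < n)%nat -> nodes_ok (za j)) -> 0 <= Lam ->
  (forall q, q \in rl -> Z.le Z0 q.1) ->
  gap_ok l2 (bdy 40 zLam) zs rl gam low b sg t r ->
  rG (dy 40 b) <= zr gam / S44 ->
  side_ok (dy 40 b) (dy 40 (if sg then Z.add b t.2 else Z.sub b t.2)) ->
  0 < t0 -> side_ok (dy 40 b) (dy 40 b + (if sg then 1 else -1) * t0) ->
  zr low / S44 <= rG (dy 40 b + (if sg then 1 else -1) * t0).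
Proof.
move=> ok L0 rl0 /and4P[/Z.ltb_lt t1 /Z.leb_le t12 _].
set p1 := (if sg then Z.add b t.1 else _); set p2 := (if sg then Z.add b t.2 else _).
case E1 : (bG _ _ _ _ _ _) => [g1|//]; case E2 : (bG _ _ _ _ _ _) => [g2|//].
case/and3P=> /Z.leb_le k1 /Z.leb_le k2 /Z.leb_le k3 gb sd2 t00 sd0.
have S0 := S44_gt0 R; have S0' : 0 < S44^-1 by rewrite invr_gt0.
have nn : (n < n)%nat -> False by rewrite ltnn.
have G1 := bGP ok (@inb_dy R 40 p1 le0_40) (fun h => False_ind _ (nn h)) E1.
have G2 := bGP ok (@inb_dy R 40 p2 le0_40) (fun h => False_ind _ (nn h)) E2.
pose sgr : R := if sg then 1 else -1.
pose f (u : R) := rG (dy 40 b + sgr * u).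
pose D (u : R) := 0 <= u /\ side_ok (dy 40 b) (dy 40 b + sgr * u).
have pE (u : Z) : dy 40 (if sg then Z.add b u else Z.sub b u) = dy 40 b + sgr * dy 40 u.
  by rewrite /sgr; case: (sg); rewrite ?mul1r ?mulN1r dyD ?dyN.
have f1 : f (dy 40 t.1) = rG (dy 40 p1) by rewrite /f -pE.
have f2 : f (dy 40 t.2) = rG (dy 40 p2) by rewrite /f -pE.
have hi1 : zr gam / S44 <= f (dy 40 t.1).
  by rewrite f1 ler_pdivrMr// (le_trans _ (inb_loP G1))// zr_le.
have lg : zr low / S44 <= zr gam / S44 by rewrite ler_pM2r// zr_le.
apply: (@convex_gap R f D (dy 40 t.1) (dy 40 t.2)) => //.
- move=> u v w u0 uv vw [w0 sdw].
  have wu : 0 < w - u by rewrite subr_gt0 (lt_trans uv).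
  pose s := (v - u) / (w - u).
  have s01 : 0 < s < 1.
    apply/andP; split; first by rewrite /s divr_gt0// subr_gt0.
    by rewrite /s ltr_pdivrMr// mul1r ltrD2r.
  have sE : 1 - s = (w - v) / (w - u) by rewrite /s; field; rewrite gt_eqF.
  have vE : dy 40 b + sgr * v = (1 - s) * (dy 40 b + sgr * u) + s * (dy 40 b + sgr * w).
    by rewrite sE /s; field; rewrite gt_eqF.
  have uw := ltW (lt_trans uv vw).
  have between (z : R) := between_le (dy 40 b) z sg u0 uw.
  have between' (z : R) := between_lt (dy 40 b) z sg u0 uw.
  have sduw : side_ok (dy 40 b + sgr * u) (dy 40 b + sgr * w).
    case: sdw => aP rP; split=> [j jn|r' rr'].
      have [[h1 h2]|[h1 h2]] := aP _ jn; [left|right]; split=> //.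
        exact: (between _).1.
      exact: (between _).2.
    have [[h1 h2]|[h1 h2]] := rP _ rr'; [left|right]; split=> //.
      exact: (between' _).1.
    exact: (between' _).2.
  have := rG_convex ok L0 rl0 s01 sduw; rewrite -vE -/(f v) -/(f u) -/(f w) sE /s.
  rewrite -(ler_pM2l wu) => H; apply: (le_trans H); rewrite le_eqVlt; apply/orP; left; apply/eqP.
  by move: (f u) (f w) => c d; field; rewrite gt_eqF.
- exact: dy_gt0.
- by rewrite -(zr2 R) mulrA -zrM; exact: dy_le.
- split; last by rewrite -pE.
  apply: dy_ge0 => //; lia.
- by rewrite (le_trans _ hi1)// /f mulr0 addr0.
- exact: le_trans lg hi1.
- rewrite f1 f2 ler_pdivrMr// mulrBl -mulrA.
  apply: (secant_ge (inb_loP G1) (inb_hiP G2)).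
  by move/(zr_le R): k3; rewrite zrB zrM zr2.
- by split=> //; exact: ltW.
Qed.

End field_check.

End BallField.
Export BallField.

(** * Soundness of the field check *)

Module FieldCheck.

#[local] Arguments Z.mul : simpl never.
#[local] Arguments Z.add : simpl never.
#[local] Arguments Z.sub : simpl never.
#[local] Arguments Z.div : simpl never.
#[local] Arguments Z.max : simpl never.
#[local] Arguments Z.of_nat : simpl never.
#[local] Arguments Z.abs : simpl never.

#[local] Opaque zr one44 bmul bsqrt binv bdy bdivn badd bsub bopp bln bhorner bbound bscale btail arc_eps far_eps bG.

Section field_theorem.
Variable R : realType.
Local Notation zr := (@zr R).
Local Notation S44 := (@S44 R).
Local Notation dy := (@dy R).
Variables (zs : seq zarc) (rl : seq (Z * ball44)) (rr : seq R) (zLam : Z) (l2 : ball44).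
Variables (gam low : Z) (N : nat).
Hypotheses (rrP : inbs (unzip2 rl) rr) (l2P : inb l2 (ln 2 : R)).
Hypothesis ok : field_ok l2 zs rl zLam gam low N.
Local Notation n := (size zs).
Local Notation G := (rG zs rl rr zLam).
Local Notation za j := (nth zarc0 zs j).
Let lo j : R := rmid R (za j) - rrad R (za j).
Let hi j : R := rmid R (za j) + rrad R (za j).

Let loE j : dy 40 (Z.sub (zmid (za j)) (zrad (za j))) = lo j.
Proof. by rewrite -Z.add_opp_r dyD dyN. Qed.

Let hiE j : dy 40 (Z.add (zmid (za j)) (zrad (za j))) = hi j.
Proof. by rewrite dyD. Qed.

Let size_rr : size rr = n.
Proof.
by have /and5P[/andP[/eqP <- _] _ _ _ _] := ok; rewrite -(inbs_size rrP) size_map.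
Qed.

Let order i j : (i < n)%nat -> (j < n)%nat ->
  if (i < j)%nat then hi i < lo j /\ hi i < rr`_j else rr`_j < lo i.
Proof.
move=> i_n jn; have /and5P[/andP[_ /allP H] _ _ _ _] := ok.
have := H i; rewrite mem_iota add0n => /(_ i_n) /allP /(_ j).
rewrite mem_iota add0n => /(_ jn).
have rj := inbs_nth rrP j.
case: ifP => ij.
  move=> /andP[/Z.ltb_lt h1 /Z.ltb_lt h2]; rewrite -hiE -loE; split; first exact: dy_lt.
  exact: inb_lt h2 (inb_dy R _ le0_40) rj.
by move=> /Z.ltb_lt h; rewrite -loE; exact: inb_lt h rj (inb_dy R _ le0_40).
Qed.

Let Lam0 : 0 <= dy 40 zLam <= 2.
Proof.
have /and5P[_ /Z.leb_le h1 /Z.leb_le h2 _ _] := ok; apply/andP; split; first exact: dy_ge0.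
rewrite ler_pdivrMr; last exact: pow2_gt0.
by rewrite -(zr2 R) -zrM; apply: zr_le.
Qed.

Let rl0 q : q \in rl -> Z.le Z0 q.1.
Proof. by have /and5P[_ _ _ /allP H _] := ok => /H /Z.leb_le. Qed.

Let arcs_okP : exists2 Es, omaps (far_eps N zs) (iota 0 n) = Some Es & all (Z.leb Z0) Es /\
  forall k, (k < n)%nat -> arc_ok l2 (bdy 40 zLam) zs rl gam low (zsumZ Es) k.
Proof.
have /and5P[_ _ _ _] := ok; case: (omaps _ _) => [Es|//] /andP[h /allP H].
exists Es => //; split=> // k kn; apply: H; rewrite mem_iota add0n; exact: kn.
Qed.

Let nodesP j : (j < n)%nat -> nodes_ok (za j).
Proof. by have [Es _ [_ H]] := arcs_okP => /H /and4P[]. Qed.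

Let rad_gt0 j : (j < n)%nat -> 0 < rrad R (za j).
Proof. by move=> /nodesP /(rnodesP R)[]. Qed.

Let lo_hi j : (j < n)%nat -> lo j < hi j.
Proof. by move=> /rad_gt0 h; rewrite /lo /hi ltrD2l (lt_trans _ h)// oppr_lt0. Qed.

Let arc_bound k x : (k < n)%nat -> `|x - rmid R (za k)| <= rrad R (za k) ->
  zr low / S44 <= G x <= zr gam / S44.
Proof.
move=> kn xl; have [Es EsE [Es0 /(_ _ kn)/and4P[_ + _ _]]] := arcs_okP.
case E : (arc_eps _ _ _ _) => [e|//]; case E2 : (bG _ _ _ _ _ _) => [g|//].
move=> /andP[/Z.leb_le h1 /Z.leb_le h2].
have ap i j : (i < j)%nat -> (j < n)%nat -> apart R zs i j.
  by move=> ij jn; have := order (ltn_trans ij jn) jn; rewrite ij => -[].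
have gP : inb g (G (hi k)).
  rewrite -hiE; apply: (bGP rrP l2P nodesP (inb_dy R _ le0_40) _ E2).
  by move=> _; exact: hiE.
have hl : `|hi k - rmid R (za k)| <= rrad R (za k).
  by rewrite /hi addrAC subrr add0r gtr0_norm// rad_gt0.
have := rG_osc rrP kn Lam0 nodesP rl0 ap E EsE Es0 xl hl.
have S0 := S44_gt0 R; rewrite -(ler_pM2r S0) divfK ?gt_eqF// => osc.
have osc' : `|G x * S44 - G (hi k) * S44| <= zr (Z.add e (Z.mul 4 (zsumZ Es))).
  by rewrite -mulrBl normrM (gtr0_norm S0).
move: osc'; rewrite ler_norml ler_pdivrMr// ler_pdivlMr//.
apply: (osc_bounds (inb_hiP gP) (inb_loP gP)).
  by rewrite -zrD; exact: zr_le.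
by rewrite -zrB; exact: zr_le.
Qed.

Lemma rr_lt i j : (i < j)%nat -> (j < n)%nat -> rr`_i < rr`_j.
Proof.
move=> ij jn; have i_n := ltn_trans ij jn.
have := order i_n i_n; rewrite ltnn => h1; have := order i_n jn; rewrite ij => -[_ h2].
by rewrite (lt_trans h1)// (lt_trans (lo_hi i_n)).
Qed.

Let side_left k y : (k < n)%nat -> rr`_k < y -> y <= lo k -> side_ok zs rr (lo k) y.
Proof.
move=> kn ry yl; split=> [j jn|r rin].
  have [jk|kj|->] := ltngtP j k.
  - left; have := order jn kn; rewrite jk => -[h1 h2].
    by split; [exact: ltW|exact: ltW (lt_trans h2 ry)].
  - right; have := order kn jn; rewrite kj => -[h1 h2].
    have h3 := ltW (lt_trans (lo_hi kn) h1).
    by split; [exact: h3|exact: le_trans h3].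
  - by right.
have [j jn ->] : exists2 j, (j < n)%nat & r = rr`_j.
  by exists (index r rr); [rewrite -size_rr index_mem|rewrite nth_index].
have [kj|jk] := ltnP k j.
  right; have := order kn jn; rewrite kj => -[_ h]; have h' := lt_trans (lo_hi kn) h.
  by split; [exact: h'|exact: le_lt_trans h'].
left; have := order kn jn; rewrite ltnNge jk/= => h; split=> //.
move: jk; rewrite leq_eqVlt => /orP[/eqP->//|jk].
exact: lt_trans (rr_lt jk kn) ry.
Qed.

Let side_right k y : (k < n)%nat -> hi k <= y ->
  (forall j, (k < j)%nat -> (j < n)%nat -> y < rr`_j) -> side_ok zs rr (hi k) y.
Proof.
move=> kn ry yr; split=> [j jn|r rin].
  have [jk|kj|->] := ltngtP j k.
  - left; have := order jn kn; rewrite jk => -[h1 h2].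
    have h3 := ltW (lt_trans h1 (lo_hi kn)).
    by split; [exact: h3|exact: le_trans ry].
  - right; have := order kn jn; rewrite kj => -[h1 h2].
    have := order jn jn; rewrite ltnn => h3.
    by split; [exact: ltW|exact: ltW (lt_trans (yr _ kj jn) h3)].
  - by left.
have [j jn ->] : exists2 j, (j < n)%nat & r = rr`_j.
  by exists (index r rr); [rewrite -size_rr index_mem|rewrite nth_index].
have [kj|jk] := ltnP k j.
  by right; have := order kn jn; rewrite kj => -[_ h]; split=> //; exact: yr.
left; have := order kn jn; rewrite ltnNge jk/= => h; have h' := lt_trans h (lo_hi kn).
by split; [exact: h'|exact: lt_le_trans ry].
Qed.

Theorem field_okP : (forall k x, (k < n)%nat -> `|x - rmid R (za k)| <= rrad R (za k) ->
    G x <= zr gam / S44) /\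
  (forall x, rr`_0 < x -> x \notin rr -> (0 < n)%nat -> zr low / S44 <= G x).
Proof.
split=> [k x kn xl|x x0 xr n0]; first by have /andP[] := arc_bound kn xl.
(* With k the last root before x, interlacing leaves arc k as the only arc between x's neighbouring
   roots: x is in the gap to its left, on it, or in the gap to its right. *)
have [k /andP[kn rk] kmax] : exists2 k, ((k < n)%nat && (rr`_k < x)) &
    forall j, (j < n)%nat && (rr`_j < x) -> (j <= k)%nat.
  have ex : exists k, (k < n)%nat && (rr`_k < x) by exists 0%nat; rewrite n0.
  have ub i : (i < n)%nat && (rr`_i < x) -> (i <= n)%nat by case/andP=> /ltnW.
  by case: (ex_maxnP ex ub) => k kP km; exists k.
have xlt j : (k < j)%nat -> (j < n)%nat -> x < rr`_j.
  move=> kj jn; rewrite ltNge le_eqVlt; apply/negP => /orP[/eqP e|rj].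
    by move/negP: xr; apply; rewrite -e mem_nth// size_rr.
  by have := kmax j; rewrite jn rj leqNgt kj => /(_ isT).
have [Es _ [_ /(_ _ kn)/and4P[_ _ gl gr]]] := arcs_okP.
have /andP[L0 _] := Lam0.
have mk : `|lo k - rmid R (za k)| <= rrad R (za k).
  by rewrite /lo addrAC subrr add0r normrN gtr0_norm// rad_gt0.
have hk : `|hi k - rmid R (za k)| <= rrad R (za k).
  by rewrite /hi addrAC subrr add0r gtr0_norm// rad_gt0.
have [xl|lx] := ltP x (lo k).
  have xE : x = lo k + -1 * (lo k - x) by ring.
  have := gapP rrP l2P nodesP L0 rl0 gl; rewrite loE => /(_ (lo k - x)).
  rewrite -xE; apply.
  - by have /andP[] := arc_bound kn mk.
  - move: gl => /and4P[/Z.ltb_lt t1 /Z.leb_le t2 /Z.ltb_lt h _].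
    apply: side_left => //; first exact: inb_lt h (inbs_nth rrP k) (inb_dy R _ le0_40).
    rewrite -loE; apply: dy_le => //; lia.
  - by rewrite subr_gt0.
  - by apply: side_left => //; exact: ltW.
have [xh|hx] := leP x (hi k).
  have xl' : `|x - rmid R (za k)| <= rrad R (za k).
    by rewrite ler_distl; apply/andP; split; [exact: lx|exact: xh].
  by have /andP[] := arc_bound kn xl'.
have xE : x = hi k + 1 * (x - hi k) by ring.
have := gapP rrP l2P nodesP L0 rl0 gr; rewrite hiE => /(_ (x - hi k)).
rewrite -xE; apply.
- by have /andP[] := arc_bound kn hk.
- move: gr => /and4P[/Z.ltb_lt t1 /Z.leb_le t2 h _].
  apply: side_right => //.
    rewrite -hiE; apply: dy_le => //; lia.
  move=> j kj jn; move: h; rewrite (leq_ltn_trans kj jn) => /Z.ltb_lt h.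
  have := inb_lt h (inb_dy R _ le0_40) (inbs_nth rrP k.+1) => /lt_le_trans; apply.
  move: kj; rewrite leq_eqVlt => /orP[/eqP->//|kj]; exact: ltW (rr_lt kj jn).
- by rewrite subr_gt0.
- by apply: side_right => //; exact: ltW.
Qed.

End field_theorem.

End FieldCheck.
Export FieldCheck.

(** * The numerical certificate *)

Module Certificate.

#[local] Arguments Z.mul : simpl never.
#[local] Arguments Z.add : simpl never.
#[local] Arguments Z.sub : simpl never.
#[local] Arguments Z.div : simpl never.
#[local] Arguments Z.max : simpl never.
#[local] Arguments Z.of_nat : simpl never.
#[local] Arguments Z.abs : simpl never.

Section certificate_data.
Local Open Scope Z_scope.
(** Antisymmetric coefficients make the squared modulus equal to 4 (sum b_k sin (k t))^2, which
    vanishes at both edges. In the coordinate x the density then behaves like a square root at each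
    edge, as for an equilibrium measure. *)
Definition odd_coefs (b : seq Z) : seq Z := map Z.opp (rev b) ++ 0 :: b.
(** The nodes are cos ((2k-1) pi / (2n)) rounded at 2^-40, the zeros of the Chebyshev polynomial of
    degree n; the number of nodes varies with the arc. The last two pairs of an arc are the sample
    distances for its left and right gaps. *)
Definition cert_arcs : seq zarc := [::
ZArc 125886560561 78613158227 (odd_coefs [:: 37911207879; (-966739561); 2894551556; 379008648; 493779310; 157026931; 113027646; 49667517; 29787426; 14880916; 8384573; 4414115; 2436585; 1312097; 720290; 392051; 215163; 117791; 64737; 35568; 19584; 10787; 5950; 3284])
 [:: 1096122200371; 1069132033977; 1015816288660; 937487775016; 836075201007; 714075680775; 574493247401; 420764883643; 256675892010; 86266688058; (-86266688058); (-256675892010); (-420764883643); (-574493247401); (-714075680775); (-836075201007); (-937487775016); (-1015816288660); (-1069132033977); (-1096122200371)]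
 [:: 1515518689; 3545226011; 5710053676; 7753519628; 9594926771; 11206134804; 12563205176; 13633654008; 14374711848; 14734336715; 14653692117; 14072303498; 12938757500; 11231415322; 8993610509; 6382912031; 3717332494; 1472598301; 172091459]
 (4266105, 10665263) (4041805, 10104512);
ZArc 301702439792 70281974828 (odd_coefs [:: 29249079959; (-2065924904); 1999790218; (-511455914); 354995669; (-140186349); 80717992; (-37690079); 20295126; (-10132940); 5342657; (-2743830); 1439832; (-749203); 393395; (-206132); 108471; (-57083); 30110; (-15894)])
 [:: 1094821305010; 1057538478562; 984242447603; 877429220560; 740736193771; 578818284319; 397189412410; 202034731438; 0; (-202034731438); (-397189412410); (-578818284319); (-740736193771); (-877429220560); (-984242447603); (-1057538478562); (-1094821305010)]
 [:: 921054274; 2341750478; 4071743280; 5841722944; 7459636069; 8803429799; 9796457619; 10387424563; 10539100307; 10223471246; 9420779655; 8121164649; 6335560576; 4144489245; 1854234374; 235812338]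
 (4156154, 10390385) (9763663, 24409158);
ZArc 677849781995 206815878647 (odd_coefs [:: 40323679063; (-3840317973); 2446870881; (-718107051); 381616014; (-157333966); 77024413; (-35242365); 16959924; (-8035887); 3869969; (-1859917); 899536; (-435531); 211542; (-102911); 50166; (-24490); 11974])
 [:: 1094217178761; 1052167026225; 969682684934; 849933981865; 697522792521; 518306193436; 319171378006; 107770985514; (-107770985514); (-319171378006); (-518306193436); (-697522792521); (-849933981865); (-969682684934); (-1052167026225); (-1094217178761)]
 [:: 1784772853; 4605595961; 8147660982; 11884475715; 15385914368; 18334446861; 20498554911; 21700189618; 21792645557; 20652718960; 18189582836; 14389164816; 9461244042; 4219323698; 533413937]
 (10379390, 25948474) (19395385, 48488463);
ZArc 1505001834939 162632014141 (odd_coefs [:: 26490867058; 1395913891; 1308037713; 406203836; 203979453; 87073155; 40896855; 18779063; 8815320; 4137730; 1956154; 927285; 441147; 210391; 100580; 48179; 23120])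
 [:: 1092598129441; 1037810696938; 930983102571; 777472127994; 584975454478; 363145669031; 123106243373; (-123106243373); (-363145669031); (-584975454478); (-777472127994); (-930983102571); (-1037810696938); (-1092598129441)]
 [:: 2176156771; 4783585711; 7197663314; 9068056865; 10271058334; 10741776356; 10444666262; 9391008715; 7672057550; 5495537034; 3207935017; 1269483407; 148148104]
 (21902272, 54755679) (12798315, 31995788);
ZArc 2236542924937 484639711629 (odd_coefs [:: 45577658855; (-3091920349); 4223613486; (-961533414); 1068974948; (-415815622); 346324400; (-173547803); 125465332; (-71234219); 48239431; (-29148175); 19172339; (-11956024); 7768706; (-4925181); 3186043; (-2038265); 1317230; (-847205); 547772; (-353517); 228811; (-148021); 95921; (-62164); 40332; (-26176); 17002; (-11048); 7183; (-4672)])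
 [:: 1097341992738; 1080036253992; 1045697698339; 994867865313; 928348371745; 847188269787; 752667502729; 646276719531; 529693766399; 404757226147; 273437422648; 137805347651; 0; (-137805347651); (-273437422648); (-404757226147); (-529693766399); (-646276719531); (-752667502729); (-847188269787); (-928348371745); (-994867865313); (-1045697698339); (-1080036253992); (-1097341992738)]
 [:: 884016982; 2281929373; 4054575585; 5981492800; 7906530199; 9734439808; 11410310905; 12900657455; 14181389181; 15231610793; 16031100313; 16559890358; 16798881074; 16730968471; 16342410442; 15624019108; 14571880710; 13187193735; 11474776577; 9441472717; 7102337866; 4525590056; 1991890658; 251442008]
 (12842296, 32105740) (31929818, 79824544);
ZArc 3270067143741 225456264375 (odd_coefs [:: 24306378137; 320230840; 1282475325; 186838538; 162132135; 41988038; 25053652; 8447748; 4274402; 1642487; 770303; 316266; 143274; 60877; 27164])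
 [:: 1091494950067; 1028061230992; 904880330022; 729111073377; 510968531359; 263130355593; 0; (-263130355593); (-510968531359); (-729111073377); (-904880330022); (-1028061230992); (-1091494950067)]
 [:: 1921693408; 4271149677; 6474189782; 8180505994; 9252151774; 9610510410; 9203634728; 8023499688; 6152811525; 3844977965; 1613607650; 195036752]
 (33689036, 84222591) (22693920, 56734800);
ZArc 4820089749463 1174052845187 (odd_coefs [:: 44517778435; (-8889268850); 3703343945; (-1974539036); 1166110768; (-723842519); 462074895; (-300178230); 197317617; (-130798881); 87249753; (-58482536); 39351211; (-26561245); 17974879; (-12190876); 8283593; (-5637800); 3842563; (-2622300); 1791577; (-1225270); 838745; (-574640); 394002; (-270341); 185615; (-127521); 87660; (-60291); 41488; (-28563); 19673; (-13556); 9345; (-6444); 4445; (-3068); 2118; (-1462)])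
 [:: 1098187217867; 1087611074629; 1066560642194; 1035238647732; 993946739174; 943082580171; 883136020380; 814684377941; 738386879591; 654978311948; 565261945112; 470101796741; 370414311084; 267159533123; 161331862813; 53950478471; (-53950478471); (-161331862813); (-267159533123); (-370414311084); (-470101796741); (-565261945112); (-654978311948); (-738386879591); (-814684377941); (-883136020380); (-943082580171); (-993946739174); (-1035238647732); (-1066560642194); (-1087611074629); (-1098187217867)]
 [:: 174289938; 481121741; 934156216; 1524814321; 2241783537; 3071130566; 3996440491; 4998985565; 6057932202; 7150574426; 8252608780; 9338452203; 10381592179; 11354994302; 12231553734; 12984588106; 13588393961; 14018829752; 14253926596; 14274512602; 14064767392; 13612666316; 12910187325; 11953096464; 10740241726; 9272606572; 7554221089; 5603400276; 3499064167; 1501814688; 185814387]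
 (23133725, 57834312) (114349209, 285873023)].
(** The seven roots in increasing order, each with the multiplier lam_Q of its polynomial in units
    of 2^-40. The roots 0 and 1 are exact. *)
Definition cert_roots : seq (Z * ball44) := [:: (525111054265, (0, 0)); (58840516891, (3484348200099, 1)); (163007939402, (6719617132555, 1)); (467057630356, (17592186044416, 0)); (58840516891, (27355112750958, 1)); (163007939402, (46056941000692, 1)); (58840516891, (57121469271021, 1))].
Definition cert_Lam := 1546829671339.
Definition cert_gam := 31635147762722.
(** [cert_low] and [cert_high] are 1.798248 and 1.798250 in units of 2^-44, taken slightly inward;
    [cert_gam] lies about 4.5 / 10^8 below [cert_high]. *)
Definition cert_low := 31635113370000.
Definition cert_high := 31635148554370.
End certificate_data.
Definition btot (l2 : ball44) (zs : seq zarc) (x : ball44) : option ball44 :=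
  osum (fun j => bpot_out l2 (mk_barc (nth zarc0 zs j)) x) (iota 0 (size zs)).

Definition bmass (zs : seq zarc) : ball44 :=
  bsum [seq nth ball0 (bauto (mk_barc a)) 0 | a <- zs].

Definition bmean (zs : seq zarc) : ball44 :=
  bsum [seq (let b := mk_barc a in
     badd (bmul (bmid b) (nth ball0 (bauto b) 0)) (bmul (brad b) (nth ball0 (bauto b) 1)))
   | a <- zs].

(** The first four signs are admissibility of nu, the root potentials being grouped by polynomial:
    {0}, {3}, {2, 5}, {1, 4, 6}. The next two comparisons bound the mean from below, for the energy
    of nu, and from above, for lambda. The arcs must lie in [0, 6]. *)
Definition sums_ok (l2 : ball44) (zs : seq zarc) (rl : seq (Z * ball44)) (gam high : Z) : bool :=
  if omaps (btot l2 zs) (unzip2 rl) is Some us then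
    let u i := nth ball0 us i in
    [&& [&& Z.leb Z0 (blo (u 0)), Z.leb Z0 (blo (u 3)), Z.leb Z0 (blo (badd (u 2) (u 5))) &
            Z.leb Z0 (blo (badd (badd (u 1) (u 4)) (u 6)))]%nat,
        Z.leb (bhi (badd (bmul (gam, Z0) (bmass zs))
                 (bsum (bmuls [seq bdy 40 q.1 | q <- rl] us)))) (blo (bmean zs)),
        Z.leb (bhi (bmean zs)) (blo (bmul (high, Z0) (bmass zs))), Z.ltb Z0 (blo (bmass zs)) &
        all (fun j => let a := nth zarc0 zs j in Z.leb (zrad a) (zmid a) &&
          Z.leb (Z.add (zmid a) (zrad a)) (Z.mul 6 (Z.pow 2 40))) (iota 0 (size zs))]
  else false.

Definition cert_check : bool :=
  if bln2 is Some l2 then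
    (* 81 is the longest coefficient list, 2 times 40 plus 1, and [far_eps] requires at least that
       many orders. *)
    field_ok l2 cert_arcs cert_roots cert_Lam cert_gam cert_low 81 &&
    sums_ok l2 cert_arcs cert_roots cert_gam cert_high
  else false.

Lemma cert_checked : cert_check = true.
Proof. vm_cast_no_check (@erefl bool true). Qed.

Lemma cert_ok : exists2 l2, bln2 = Some l2 &
  field_ok l2 cert_arcs cert_roots cert_Lam cert_gam cert_low 81 &&
  sums_ok l2 cert_arcs cert_roots cert_gam cert_high.
Proof.
move: cert_checked; rewrite /cert_check; case: bln2 => [l2 H|H]; last by discriminate H.
by exists l2; [exact: erefl|exact: H].
Qed.

End Certificate.
Export Certificate.

(** * Localisation of the roots *)

#[local] Arguments Z.mul : simpl never.
#[local] Arguments Z.add : simpl never.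
#[local] Arguments Z.sub : simpl never.
#[local] Arguments Z.div : simpl never.
#[local] Arguments Z.max : simpl never.
#[local] Arguments Z.of_nat : simpl never.
#[local] Arguments Z.abs : simpl never.
#[local] Opaque zr one44 bmul bsqrt binv bdy bdivn badd bsub bopp bln bhorner bbound bscale btail arc_eps far_eps bG.

Lemma int_poly_factor (R : realType) (c : seq int) (rs : seq R) :
  last 0 c = 1 -> size c = (size rs).+1 -> uniq rs ->
  (forall r, r \in rs -> (map_poly intr (Poly c)).[r] = 0) ->
  map_poly intr (Poly c) = \prod_(r <- rs) ('X - r%:P) :> {poly R}.
Proof.
move=> lc sc us rt.
have c0 : last 1 c != 0 by move: lc sc; case: (c) => //= x l ->.
have lr : last 1 [seq (z%:~R : R) | z <- c] != 0.
  by move: lc sc; case: (c) => //= x l; rewrite (last_map (fun z : int => z%:~R : R)) => ->; rewrite oner_eq0.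
have P : map_poly intr (Poly c) = Poly [seq (z%:~R : R) | z <- c] :> {poly R}.
  by rewrite map_Poly// rmorph0.
have sP : size (Poly [seq (z%:~R : R) | z <- c]) = (size rs).+1.
  by rewrite (PolyK lr) size_map sc.
rewrite P (@all_roots_prod_XsubC _ _ rs sP).
- rewrite /lead_coef (PolyK lr) size_map.
  rewrite (_ : _`_(size c).-1 = 1) ?scale1r// (nth_map 0); last by rewrite sc.
  by rewrite nth_last lc.
- by apply/allP => r /rt H; apply/rootP; rewrite -P.
- by rewrite uniq_rootsE.
Qed.

Lemma ivt_ball (R : realType) (c : seq int) (a b : Z) : (a <= b)%Z ->
  let p := map_poly intr (Poly c) : {poly R} in
  p.[zr R a / S44 R] * p.[zr R b / S44 R] <= 0 ->
  exists r, [/\ zr R a / S44 R <= r, r <= zr R b / S44 R & p.[r] = 0].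
Proof.
move=> ab p sgn; have S0 := S44_gt0 R.
have ab' : zr R a / S44 R <= zr R b / S44 R by rewrite ler_pM2r ?invr_gt0// zr_le.
have [pa|pa] := leP p.[zr R a / S44 R] 0.
  have [pb|pb] := leP 0 p.[zr R b / S44 R].
    have [|r /andP[h1 h2] /rootP h3] := @poly_ivt _ p _ _ ab'; first by rewrite pa pb.
    by exists r.
  have : 0 <= p.[zr R a / S44 R] by move: sgn; rewrite nmulr_lle0.
  move=> pa'; exists (zr R a / S44 R); split=> //.
  by apply/eqP; rewrite eq_le pa pa'.
have pb : p.[zr R b / S44 R] <= 0 by move: sgn; rewrite pmulr_rle0.
have [|r /andP[h1 h2] /rootP h3] := @poly_ivt _ (- p) _ _ ab'.
  by rewrite !hornerN !oppr_ge0 oppr_le0 (ltW pa) pb.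
exists r; split=> //; by move: h3; rewrite hornerN => /eqP; rewrite oppr_eq0 => /eqP.
Qed.

(* S^d p (a / S) for a polynomial p of degree d, over the integers *)
Fixpoint zhom (c : seq Z) (a S : Z) : Z :=
  if c is x :: c' then
    Z.add (Z.mul x (Z.pow S (Z.of_nat (size c')))) (Z.mul a (zhom c' a S)) else Z0.

Lemma zhomP (R : realType) (c : seq Z) (a : Z) :
  zr R (zhom c a one44) * S44 R =
  (map_poly intr (Poly (map int_of_Z c)) : {poly R}).[zr R a / S44 R] * S44 R ^+ size c.
Proof.
have S0 : S44 R != 0 by rewrite gt_eqF// S44_gt0.
rewrite map_Poly ?rmorph0// horner_Poly; elim: c => [|x c IH].
  by rewrite /= zr0 !mul0r.
have -> : zhom (x :: c) a one44 = Z.add (Z.mul x (Z.pow one44 (Z.of_nat (size c))))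
   (Z.mul a (zhom c a one44)) by [].
rewrite zrD [zr R (Z.mul x _)]zrM [zr R (Z.mul a _)]zrM zr_pow -/(S44 R).
rewrite mulrDl -[zr R a * _ * _]mulrA IH zrE /=.
move: (horner_rec _ _) => h; rewrite exprS.
by move: (S44 R) S0 (zr R a) (_%:~R) => w w0 u v; move: (w ^+ _) => t; field.
Qed.

(** A sign change between b - 1 and b + 1, seen on the homogenised integer values, yields a root in
    the ball of radius one unit. *)
Lemma bracket_root (R : realType) (c : seq Z) (b : Z) :
  Z.le (Z.mul (zhom c (Z.sub b 1) one44) (zhom c (Z.add b 1) one44)) Z0 ->
  exists r : R, inb (b, 1%Z) r /\ (map_poly intr (Poly (map int_of_Z c)) : {poly R}).[r] = 0.
Proof.
move=> sgn; have S0 := S44_gt0 R.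
have [||r [h1 h2 h3]] := @ivt_ball R (map int_of_Z c) (Z.sub b 1) (Z.add b 1); first by lia.
  have := zr_le R sgn; rewrite zrM zr0 -(pmulr_lle0 _ S0) -(pmulr_lle0 _ S0).
  rewrite (_ : _ * _ * _ * _ = (zr R (zhom c (Z.sub b 1) one44) * S44 R) *
    (zr R (zhom c (Z.add b 1) one44) * S44 R)); last by rewrite -!mulrA; congr (_ * _); rewrite mulrCA.
  by rewrite !zhomP mulrACA pmulr_lle0// mulr_gt0// exprn_gt0.
exists r; split=> //; rewrite /inb /= zr1.
move: h1 h2; rewrite ler_pdivrMr// ler_pdivlMr// zrB zrD zr1 => h1 h2.
rewrite ler_norml; apply/andP; split; move: h1 h2; move: (r * _) (zr R b) => u v; lra.
Qed.

(** * The four polynomials and the bounds on lambda *)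

Section final.
Variable R : realType.
Local Notation inbR := (@inb R).

Lemma arcs_potE (zs : seq zarc) x : arcs_pot (map (rarc R) zs) x =
  \sum_(j <- iota 0 (size zs)) itv_pot (rmid R (nth zarc0 zs j)) (rrad R (nth zarc0 zs j))
     (rcoef R (nth zarc0 zs j)) x.
Proof. by rewrite /arcs_pot big_map (big_nth zarc0) /index_iota subn0. Qed.

Lemma bmassP (zs : seq zarc) : inbR (bmass zs) (arcs_mass (map (rarc R) zs)).
Proof.
rewrite /bmass /arcs_mass big_map -(big_map (fun a => autocorr (rcoef R a) 0) xpredT id).
apply: bsumP; elim: zs => [|a l IH]; first by [].
by split; [exact: bautoP|exact: IH].
Qed.

Lemma bmeanP (zs : seq zarc) : inbR (bmean zs) (arcs_mean (map (rarc R) zs)).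
Proof.
rewrite /bmean /arcs_mean big_map.
rewrite -(big_map (fun a => rmid R a * autocorr (rcoef R a) 0 + rrad R a * autocorr (rcoef R a) 1) xpredT id).
apply: bsumP; elim: zs => [|a l IH]; first by [].
split; last exact: IH.
apply: inb_add; apply: inb_mul.
- exact: bmidP.
- exact: bautoP.
- exact: bradP.
- exact: bautoP.
Qed.

Lemma btotP l2 (zs : seq zarc) bx x u : inbR l2 (ln 2) ->
  (forall j, (j < size zs)%nat -> nodes_ok (nth zarc0 zs j)) -> inbR bx x ->
  btot l2 zs bx = Some u -> inbR u (arcs_pot (map (rarc R) zs) x).
Proof.
move=> l2P ok bxP E; rewrite arcs_potE; apply: (osumP _ E) => j v.
rewrite mem_iota add0n => /andP[_ jn]; have [_ b0 _ _] := rnodesP R (ok _ jn).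
exact: bpot_outP.
Qed.

Lemma omaps_btot l2 (zs : seq zarc) bs (xs : seq R) us : inbR l2 (ln 2) ->
  (forall j, (j < size zs)%nat -> nodes_ok (nth zarc0 zs j)) -> inbs bs xs ->
  omaps (btot l2 zs) bs = Some us -> inbs us [seq arcs_pot (map (rarc R) zs) x | x <- xs].
Proof.
move=> l2P ok; elim: bs xs us => [|b bs IH] [|x xs] us //=; first by move=> _ [<-].
case=> h1 h2; case E : (btot _ _ _) => [u|]; last by move=> H; discriminate H.
case E2 : (omaps _ _) => [w|]; last by move=> H; discriminate H.
by move=> /Some_inj <-; split; [exact: btotP E|exact: IH E2].
Qed.

Definition px : {poly int} := 'X.
Definition px1 : {poly int} := 'X - 1.
Definition pq : {poly int} := 'X^2 - 3 *: 'X + 1.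
Definition pc : {poly int} := 'X^3 - 5 *: 'X^2 + 6 *: 'X - 1.

Lemma pxE : px = Poly [:: 0; 1].
Proof. by apply/polyP => -[|[|i]]; rewrite coef_Poly coefX/= ?nth_nil. Qed.
Lemma px1E : px1 = Poly [:: -1; 1].
Proof. by apply/polyP => -[|[|i]]; rewrite coef_Poly coefB coefX coef1/= ?nth_nil. Qed.
Lemma pqE : pq = Poly [:: 1; -3; 1].
Proof.
by apply/polyP => -[|[|[|i]]]; rewrite coef_Poly coefD coefB coefZ coefXn coefX coef1/= ?nth_nil.
Qed.
Lemma pcE : pc = Poly [:: -1; 6; -5; 1].
Proof.
by apply/polyP => -[|[|[|[|i]]]];
  rewrite coef_Poly coefB coefD coefB !coefZ !coefXn coefX coef1/= ?nth_nil.
Qed.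

Lemma polys_uniq : uniq [:: px; px1; pq; pc].
Proof.
have N (p q : {poly int}) i : p`_i != q`_i -> p != q by apply: contraNneq => ->.
have K a b (u v : seq int) : a != b -> Poly (a :: u) != Poly (b :: v).
  by move=> ab; apply: (N _ _ 0%nat); rewrite !coef_Poly.
rewrite /= !inE pxE px1E pqE pcE !negb_or; apply/and4P; split.
- by apply/and3P; split; exact: K.
- by apply/andP; split; [exact: K|apply: (N _ _ 2%nat); rewrite !coef_Poly].
- exact: K.
- by [].
Qed.

Definition polyset : {fset {poly int}} := [fset px; px1; pq; pc]%fset.

Lemma big_polyset (F : {poly int} -> R) :
  \sum_(Q <- polyset) F Q = F px + F px1 + F pq + F pc.
Proof.
rewrite (perm_big [:: px; px1; pq; pc]).
  by rewrite !big_cons big_nil -[LHS]/(F px + (F px1 + (F pq + (F pc + 0)))) addr0 !addrA.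
apply: uniq_perm; [exact: fset_uniq|exact: polys_uniq|].
by move=> Q; rewrite !inE -!orbA.
Qed.

Lemma polysetP Q : Q \in polyset -> [\/ Q = px, Q = px1, Q = pq | Q = pc].
Proof.
rewrite !inE -!orbA => /or4P[] /eqP ->.
- exact: Or41.
- exact: Or42.
- exact: Or43.
- exact: Or44.
Qed.

Lemma roots_exist : exists rr : seq R,
  [/\ inbs (unzip2 cert_roots) rr, size rr = 7%nat, rr`_0 = 0 & rr`_3 = 1] /\
  [/\ (map_poly intr pq).[rr`_2] = 0, (map_poly intr pq).[rr`_5] = 0,
      (map_poly intr pc).[rr`_1] = 0, (map_poly intr pc).[rr`_4] = 0 &
      (map_poly intr pc).[rr`_6] = 0].
Proof.
have cE : pc = Poly (map int_of_Z [:: -1; 6; -5; 1]%Z) by rewrite pcE.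
have qE : pq = Poly (map int_of_Z [:: 1; -3; 1]%Z) by rewrite pqE.
have C b : Z.leb (Z.mul (zhom [:: -1; 6; -5; 1]%Z (Z.sub b 1) one44)
   (zhom [:: -1; 6; -5; 1]%Z (Z.add b 1) one44)) Z0 ->
   exists r : R, inb (b, 1%Z) r /\ (map_poly intr pc).[r] = 0.
  by move=> /Z.leb_le /(@bracket_root R); rewrite -cE.
have Q b : Z.leb (Z.mul (zhom [:: 1; -3; 1]%Z (Z.sub b 1) one44)
   (zhom [:: 1; -3; 1]%Z (Z.add b 1) one44)) Z0 ->
   exists r : R, inb (b, 1%Z) r /\ (map_poly intr pq).[r] = 0.
  by move=> /Z.leb_le /(@bracket_root R); rewrite -qE.
pose bb i := (nth ball0 (unzip2 cert_roots) i).1.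
have [r1 [i1 e1]] : exists r : R, inb (bb 1%nat, 1%Z) r /\ (map_poly intr pc).[r] = 0.
  by apply: C; vm_compute.
have [r2 [i2 e2]] : exists r : R, inb (bb 2%nat, 1%Z) r /\ (map_poly intr pq).[r] = 0.
  by apply: Q; vm_compute.
have [r4 [i4 e4]] : exists r : R, inb (bb 4%nat, 1%Z) r /\ (map_poly intr pc).[r] = 0.
  by apply: C; vm_compute.
have [r5 [i5 e5]] : exists r : R, inb (bb 5%nat, 1%Z) r /\ (map_poly intr pq).[r] = 0.
  by apply: Q; vm_compute.
have [r6 [i6 e6]] : exists r : R, inb (bb 6%nat, 1%Z) r /\ (map_poly intr pc).[r] = 0.
  by apply: C; vm_compute.
exists [:: 0; r1; r2; 1; r4; r5; r6]; split; split=> //.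
split; first exact: inb0.
split; first exact: i1.
split; first exact: i2.
split; first exact: inb1.
split; first exact: i4.
split; first exact: i5.
by split; [exact: i6|].
Qed.

Definition poly_roots (rr : seq R) (Q : {poly int}) : seq R :=
  if Q == px then [:: rr`_0] else if Q == px1 then [:: rr`_3] else
  if Q == pq then [:: rr`_2; rr`_5] else [:: rr`_1; rr`_4; rr`_6].

Lemma poly_rootsE rr : [/\ poly_roots rr px = [:: rr`_0], poly_roots rr px1 = [:: rr`_3],
  poly_roots rr pq = [:: rr`_2; rr`_5] & poly_roots rr pc = [:: rr`_1; rr`_4; rr`_6]].
Proof.
have := polys_uniq; rewrite /= !inE !negb_or => /and4P[/and3P[h1 h2 h3] /andP[h4 h5] h6 _].
rewrite /poly_roots eqxx (eq_sym px1) (negbTE h1) eqxx (eq_sym pq px) (negbTE h2).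
rewrite (eq_sym pq px1) (negbTE h4) eqxx (eq_sym pc px) (negbTE h3) (eq_sym pc px1) (negbTE h5).
by rewrite (eq_sym pc pq) (negbTE h6).
Qed.

Definition poly_weight (rl : seq (Z * ball44)) (Q : {poly int}) : R :=
  let l i := dy R 40 (nth (Z0, ball0) rl i).1 in
  if Q == px then l 0%nat else if Q == px1 then l 3%nat else
  if Q == pq then l 2%nat else l 1%nat.

Lemma poly_weightE rl : let l i := dy R 40 (nth (Z0, ball0) rl i).1 in
  [/\ poly_weight rl px = l 0%nat, poly_weight rl px1 = l 3%nat, poly_weight rl pq = l 2%nat &
      poly_weight rl pc = l 1%nat].
Proof.
have := polys_uniq; rewrite /= !inE !negb_or => /and4P[/and3P[h1 h2 h3] /andP[h4 h5] h6 _].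
rewrite /poly_weight eqxx (eq_sym px1) (negbTE h1) eqxx (eq_sym pq px) (negbTE h2).
rewrite (eq_sym pq px1) (negbTE h4) eqxx (eq_sym pc px) (negbTE h3) (eq_sym pc px1) (negbTE h5).
by rewrite (eq_sym pc pq) (negbTE h6).
Qed.

(** Passes from sums by polynomial, used in the certificate theorem, to sums by root, used in the
    computation; this needs equal multipliers at the roots of one polynomial. *)
Lemma sum_polys (rl : seq (Z * ball44)) rr (F : R -> R) : size rr = 7%nat -> size rl = 7%nat ->
  [/\ (nth (Z0, ball0) rl 4).1 = (nth (Z0, ball0) rl 1).1,
      (nth (Z0, ball0) rl 5).1 = (nth (Z0, ball0) rl 2).1 &
      (nth (Z0, ball0) rl 6).1 = (nth (Z0, ball0) rl 1).1] ->
  \sum_(Q <- polyset) poly_weight rl Q * \sum_(r <- poly_roots rr Q) F r =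
  \sum_(q <- zip rl rr) dy R 40 q.1.1 * F q.2.
Proof.
case: rr => [|a0 [|a1 [|a2 [|a3 [|a4 [|a5 [|a6 [|]]]]]]]]// _.
case: rl => [|l0 [|l1 [|l2 [|l3 [|l4 [|l5 [|l6 [|]]]]]]]]// _ /= [e4 e5 e6].
have [p0 p1 p2 p3] := poly_rootsE [:: a0; a1; a2; a3; a4; a5; a6].
have [w0 w1 w2 w3] := poly_weightE [:: l0; l1; l2; l3; l4; l5; l6].
rewrite big_polyset p0 p1 p2 p3 w0 w1 w2 w3 /= !big_cons !big_nil /= e4 e5 e6.
move: (dy R 40) => d; ring.
Qed.

Lemma inb_ge0 b (x : R) : Z.le Z0 (blo b) -> inb b x -> 0 <= x.
Proof. by move=> b0 bx; apply: inb_le (inb0 R) bx. Qed.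

Lemma inb_scaled g : inb (g, Z0) (zr R g / S44 R).
Proof. by rewrite /inb /= divfK ?subrr ?normr0 ?zr0// gt_eqF// S44_gt0. Qed.

Lemma polyset_mem : [/\ px \in polyset, px1 \in polyset, pq \in polyset & pc \in polyset].
Proof. by split; rewrite !inE eqxx ?orbT. Qed.

Section lambda_bounds.
Variables (zs : seq zarc) (rl : seq (Z * ball44)) (zLam gam low high : Z) (N : nat) (l2 : ball44).
Variable rr : seq R.
Hypotheses (El2 : bln2 = Some l2) (Lpos : Z.lt Z0 zLam).
Hypothesis fo : field_ok l2 zs rl zLam gam low N.
Hypothesis so : sums_ok l2 zs rl gam high.
Hypotheses (rrP : inbs (unzip2 rl) rr) (s7 : size rr = 7%nat) (z7 : size zs = 7%nat).
Hypotheses (r0 : rr`_0 = 0) (r3 : rr`_3 = 1).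
Hypothesis rlE : [/\ (nth (Z0, ball0) rl 4).1 = (nth (Z0, ball0) rl 1).1,
      (nth (Z0, ball0) rl 5).1 = (nth (Z0, ball0) rl 2).1 &
      (nth (Z0, ball0) rl 6).1 = (nth (Z0, ball0) rl 1).1].
Hypothesis rq : [/\ (map_poly intr pq).[rr`_2] = 0, (map_poly intr pq).[rr`_5] = 0,
      (map_poly intr pc).[rr`_1] = 0, (map_poly intr pc).[rr`_4] = 0 &
      (map_poly intr pc).[rr`_6] = 0].

Let rl7 : size rl = 7%nat.
Proof. by rewrite -s7 -(inbs_size rrP) size_map. Qed.

(** Distinctness of the roots, needed for the factorisations, comes from their interlacing with the
    arcs. *)
Let lt_rr i j : (i < j)%nat -> (j < 7)%nat -> rr`_i < rr`_j.
Proof.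
have H := rr_lt; move=> ij j7; move: (H R zs rl rr) => {}H.
by first [exact: (H _ _ _ _ _ rrP fo i j ij (eq_ind_r (fun k => (j < k)%nat) j7 z7))
  | (apply: H; [exact: rrP|exact: fo|exact: ij|rewrite z7; exact: j7]) | (apply: H; eauto; rewrite ?z7; eauto)].
Qed.

Let factorisation Q : Q \in polyset ->
  map_poly intr Q = \prod_(r <- poly_roots rr Q) ('X - r%:P) :> {poly R}.
Proof.
have [q2 q5 c1 c4 c6] := rq; have [p0 p1 p2 p3] := poly_rootsE rr.
case/polysetP=> ->.
- by rewrite p0 big_seq1 r0 subr0 /px map_polyX.
- by rewrite p1 big_seq1 r3 /px1 rmorphB/= map_polyX rmorph1.
- rewrite p2 pqE; apply: int_poly_factor => //.
    by rewrite /= inE andbT lt_eqF// lt_rr.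
  by move=> r; rewrite -pqE !inE => /orP[] /eqP ->.
- rewrite p3 pcE; apply: int_poly_factor => //.
    by rewrite /= !inE negb_or andbT !lt_eqF// lt_rr.
  by move=> r; rewrite -pcE !inE => /or3P[] /eqP ->.
Qed.

Let out x : (forall Q, Q \in polyset -> x \notin poly_roots rr Q) -> x \notin rr.
Proof.
move=> H; have [m0 m1 m2 m3] := polyset_mem; have [p0 p1 p2 p3] := poly_rootsE rr.
move: (H _ m0) (H _ m1) (H _ m2) (H _ m3); rewrite p0 p1 p2 p3 !inE !negb_or.
move=> n0 n3 /andP[n2 n5] /and3P[n1 n4 n6].
apply/negP => /(nthP 0)[i]; rewrite s7 => i7 xi; move: i7 xi.
case: i => [|[|[|[|[|[|[|]]]]]]]// _ xi; [move: n0|move: n1|move: n2|move: n3|move: n4|move: n5|move: n6];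
  by rewrite -xi eqxx.
Qed.

Let s := map (rarc R) zs.

Let nok j : (j < size zs)%nat -> nodes_ok (nth zarc0 zs j).
Proof.
move=> jn; have /and5P[_ _ _ _] := fo; case: (omaps _ _) => [Es|//] /andP[_ /allP H].
by have := H j; rewrite mem_iota add0n => /(_ jn) /and4P[].
Qed.

Let wt0 Q : 0 <= poly_weight rl Q.
Proof.
have /and5P[_ _ _ /allP w0 _] := fo.
have W i : 0 <= dy R 40 (nth (Z0, ball0) rl i).1.
  apply: dy_ge0 => //; have [il|il] := ltnP i (size rl); last by rewrite nth_default.
  exact/Z.leb_le/w0/mem_nth.
by rewrite /poly_weight; do 3 ![case: ifP => // _]; exact: W.
Qed.

Let zr6 : zr R 6%Z = 6.
Proof. by rewrite zrE. Qed.

Theorem lambda_bounds : ((zr R low / S44 R)%:E <= lambda R polyset <= (zr R high / S44 R)%:E)%E.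
Proof.
have l2P := @inb_ln2 R l2 El2; have S0 := S44_gt0 R.
have [up lowb] := field_okP rrP l2P fo.
move: so; rewrite /sums_ok; case E : (omaps _ _) => [us|//].
case/and5P=> /and4P[/Z.leb_le u0 /Z.leb_le u3 /Z.leb_le u25 /Z.leb_le u146] /Z.leb_le hm
  /Z.leb_le hh /Z.ltb_lt ms /allP sm.
have usP := omaps_btot l2P nok rrP E.
have uP i : (i < 7)%nat -> inb (nth ball0 us i) (arcs_pot s rr`_i).
  by move=> i7; have := inbs_nth usP i; rewrite (nth_map 0) ?s7.
have M0 : 0 < arcs_mass s by apply: inb_lt (inb0 R) (bmassP zs); exact: ms.
have rad0 j : (j < size zs)%nat -> 0 < rrad R (nth zarc0 zs j).
  by move=> /nok /(rnodesP R)[].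
have {}sm j : (j < size zs)%nat -> Z.le (zrad (nth zarc0 zs j)) (zmid (nth zarc0 zs j)) /\
    Z.le (Z.add (zmid (nth zarc0 zs j)) (zrad (nth zarc0 zs j))) (Z.mul 6 (Z.pow 2 40)).
  by move=> jn; have := sm j; rewrite mem_iota add0n => /(_ jn) /andP[/Z.leb_le ? /Z.leb_le ?].
have sP a : a \in s -> exists2 j, (j < size zs)%nat & a = rarc R (nth zarc0 zs j).
  move=> /(nthP (arc0 R))[j]; rewrite size_map => jn <-; exists j; first exact: jn.
  by rewrite (nth_map zarc0).
have sB : arcs_in s 6.
  move=> a /sP[j jn ->]; rewrite [amid _]/= [arad _]/=.
  have [h1 h2] := sm _ jn; have z0 := rad0 _ jn; split; first exact: z0.
  have m0 : 0 <= rmid R (nth zarc0 zs j) by rewrite (le_trans (ltW z0))//; exact: dy_le.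
  rewrite (ger0_norm m0) -dyD /dy ler_pdivrMr; last exact: (@pow2_gt0 R 40).
  by have := zr_le R h2; rewrite [zr R (Z.mul _ _)]zrM zr6.
have sge a : a \in s -> arad a <= amid a.
  by move=> /sP[j /sm[h1 _] ->]; exact: dy_le.
(* With this identity the lower and upper field inequalities of the certificate read low <= rG and
   rG <= gam. *)
have rhsE g x : cert_rhs polyset (poly_roots rr) (poly_weight rl) s (dy R 40 zLam) g x =
    g + (x - rG zs rl rr zLam x).
  rewrite /cert_rhs (sum_polys (fun r => ln `|x - r|) s7 rl7 rlE) arcs_potE /rG.
  by move: (\sum_(_ <- iota _ _) _) (\sum_(_ <- zip _ _) _) => a b; ring.
have [p0 p1 p2 p3] := poly_rootsE rr; have [m0 _ _ _] := polyset_mem.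
have n0 : (0 < size zs)%nat by rewrite z7.
have one6 : 1 <= 6 :> R by rewrite ler1n.
have Lp : 0 < dy R 40 zLam by exact: dy_gt0.
apply: (@arcs_certificate R polyset (poly_roots rr) (poly_weight rl) s 6 (dy R 40 zLam) M0 sB one6
  factorisation Lp wt0 sge (zr R low / S44 R) (zr R gam / S44 R)).
- move=> x x0 xr; rewrite rhsE.
  have x1 : rr`_0 < x.
    rewrite r0 lt_neqAle x0 andbT -r0 eq_sym.
    by have := xr _ m0; rewrite p0 inE.
  have := lowb x x1 (out xr) n0.
  by move: (rG _ _ _ _ _) (zr R low / _) => u v; lra.
- move=> a x /sP[j jn ->] xa xr; rewrite rhsE; have := up j x jn xa.
  by move: (rG _ _ _ _ _) (zr R gam / _) => u v; lra.
- move=> Q /polysetP[] ->; rewrite ?p0 ?p1 ?p2 ?p3 !big_cons big_nil addr0.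
  + exact: inb_ge0 u0 (uP 0%nat isT).
  + exact: inb_ge0 u3 (uP 3%nat isT).
  + exact: inb_ge0 u25 (inb_add (uP 2%nat isT) (uP 5%nat isT)).
  + rewrite addrA.
    exact: inb_ge0 u146 (inb_add (inb_add (uP 1%nat isT) (uP 4%nat isT)) (uP 6%nat isT)).
- rewrite (sum_polys (arcs_pot s) s7 rl7 rlE).
  apply: (inb_le hm _ (bmeanP zs)); apply: inb_add.
    by apply: inb_mul; [exact: inb_scaled|exact: bmassP].
  have z1 : unzip1 (zip rl rr) = rl by rewrite unzip1_zip// rl7 s7.
  have z2 : unzip2 (zip rl rr) = rr by rewrite unzip2_zip// rl7 s7.
  have i1 : inbs [seq bdy 40 q.1 | q <- rl] [seq dy R 40 q.1.1 | q <- zip rl rr].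
    rewrite (map_comp (fun q : Z * ball44 => dy R 40 q.1) fst) -/(unzip1 _) z1.
    by apply: inbs_map => q _; exact: inb_dy.
  have i2 : inbs us [seq arcs_pot s q.2 | q <- zip rl rr].
    by rewrite (map_comp (arcs_pot s) snd) -/(unzip2 _) z2.
  by have := bsumP (bmulsP i1 i2); rewrite big_map.
- by apply: (inb_le hh (bmeanP zs)); apply: inb_mul; [exact: inb_scaled|exact: bmassP].
Qed.

End lambda_bounds.
End final.

(** Clearing the denominators 10^6 and 2^44 turns the comparison of a dyadic bound with a decimal
    into one between integers. *)
Lemma zr_decimal (R : realType) (l v : Z) :
  let x := 1798 / 10 ^+ 3 + zr R v / 10 ^+ 6 in
  let c := Z.mul (Z.add (Z.mul 1798 (Z.pow 10 (Z.of_nat 3))) v) one44 in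
  let d := Z.mul l (Z.pow 10 (Z.of_nat 6)) in
  (Z.le c d -> x <= zr R l / S44 R) /\ (Z.le d c -> zr R l / S44 R <= x).
Proof.
move=> x c d; have S0 := S44_gt0 R.
have ten n : zr R (Z.pow 10 (Z.of_nat n)) = 10 ^+ n.
  by rewrite zr_pow; congr (_ ^+ _); rewrite zrE.
have n1798 : zr R 1798%Z = 1798 by rewrite -(zr_nat R 1798).
have T0 n : 0 < 10 ^+ n :> R by rewrite exprn_gt0// ltr0n.
have dE : zr R d = zr R l * 10 ^+ 6 by rewrite /d zrM ten.
have cE : zr R c = x * S44 R * 10 ^+ 6.
  rewrite /c zrM zrD [zr R (Z.mul 1798 _)]zrM n1798 ten -/(S44 R) /x.
  rewrite [10 ^+ 6](_ : _ = 10 ^+ 3 * 10 ^+ 3); last by rewrite -exprD.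
  have t0 := lt0r_neq0 (T0 3%nat).
  by move: (10 ^+ 3) t0 (zr R v) (S44 R) => t t0 z w; field.
split=> /(zr_le R); rewrite cE dE (ler_pM2r (T0 6%nat)).
  by rewrite ler_pdivlMr.
by rewrite ler_pdivrMr.
Qed.

Lemma abse_sub_le (R : realType) (l : \bar R) (u v w t : R) :
  w + 248 * t <= u -> v <= w + 250 * t -> (u%:E <= l <= v%:E)%E ->
  (`|l - (w + 249 * t)%:E| <= t%:E)%E.
Proof.
case: l => [r||] uP vP /andP[]//; rewrite !lee_fin => ur rv.
by rewrite ler_norml; apply/andP; split; lra.
Qed.

Theorem corollary1p7 (R : realType) :
  (`| lambda R [fset 'X%R; ('X - 1)%R; ('X^2 - 3 *: 'X + 1)%R;
                 ('X^3 - 5 *: 'X^2 + 6 *: 'X - 1)%R]%fset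
      - (1798 / 10 ^+ 3 + 249 / 10 ^+ 6)%:E | <= (10 ^- 6)%:E)%E.
Proof.
have [l2 El2 /andP[fo so]] := cert_ok.
have [rr [[rrP s7 r0 r3] rq]] := roots_exist R.
have rlE : [/\ (nth (Z0, ball0) cert_roots 4).1 = (nth (Z0, ball0) cert_roots 1).1,
      (nth (Z0, ball0) cert_roots 5).1 = (nth (Z0, ball0) cert_roots 2).1 &
      (nth (Z0, ball0) cert_roots 6).1 = (nth (Z0, ball0) cert_roots 1).1] by split.
have := lambda_bounds El2 (erefl : Z.lt Z0 cert_Lam) fo so rrP s7 (erefl : size cert_arcs = 7%nat)
  r0 r3 rlE rq.
rewrite -[[fset 'X; _; _; _]%fset]/polyset.
clear => bounds; apply: abse_sub_le bounds.
(* 248 and 250 are 249 minus and plus one unit of 10^-6. *)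
- have [+ _] := zr_decimal R cert_low 248.
  rewrite -(zr_nat R 248); apply; apply/Z.leb_le; vm_compute; reflexivity.
- have [_ +] := zr_decimal R cert_high 250.
  rewrite -(zr_nat R 250); apply; apply/Z.leb_le; vm_compute; reflexivity.
Qed.
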